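(* Fix $k\ge2$, $\eta\in[0,1)$ and $0<c<c_k(\eta)=\left(\frac{e}{(1-\eta)(k-1)}\right)^{\frac1{k-1}}$. Let $G_n=(V_n,E_n)$ be a sequence of asymptotically tree-like $k$-uniform hypergraphs with maximum degree $\Delta=\Delta(n)$, and let $p\sim c\Delta^{-\frac1{k-1}}$. Let $\zeta=\zeta(n)\in(0,1]$ with $\limsup_n\zeta(k-1)c^{k-1}<e$ and $\mathbf x^\ast$ the unique fixed point of $F^{G_n}_{c,\zeta}$ in $[0,c]^{V_n}$ be such that $(1-\zeta)\sum_{e\in E_n}\prod_{u\in e}x^\ast_u=(1+o(1))\eta c^k|E_n|$. Then $$\log\mathbb{P}_p(\mathbf X\le\eta\,\mathbb{E}\mathbf X)\sim\Delta^{-\frac1{k-1}}\mathcal B^{G_n}_{c,\zeta}(\mathbf x^\ast)-\log(1-\zeta)\,\eta\,\mathbb{E}\mathbf X-p|V_n|.$$ In particular, if $c<\left(\frac e{k-1}\right)^{\frac1{k-1}}$, then $$\Delta^{\frac1{k-1}}|V_n|^{-1}\log\mathbb{P}_p(\mathbf X=0)=|V_n|^{-1}\mathcal B^{G_n}_{c,1}(\mathbf x^\ast)-c+o(1),$$ where $\mathbf x^\ast$ is the unique fixed point of $F^{G_n}_{c,1}$.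
   Context: Hypergraphs are simple. For a hypergraph $G$ and $S\subseteq V(G)$, $d_G(S)=|\{e\in E(G):S\subseteq e\}|$, $\Delta_\ell(G)=\max_{|S|=\ell}d_G(S)$, $\Delta(G)=\Delta_1(G)$ the maximum degree, and $\Gamma(G)$ is the maximum over distinct $v,v'$ of the number of $(k-1)$-sets $S$ with $S\cup\{v\},S\cup\{v'\}\in E(G)$. A sequence $(G_n)$ of $k$-uniform hypergraphs is asymptotically tree-like if, with $G=G_n$, $\Delta=\Delta(G)$, as $n\to\infty$: (1) $\Delta\to\infty$; (2) $\Delta_\ell(G)=o(\Delta^{\frac{k-\ell}{k-1}})$ for each $\ell\in\{2,\dots,k-1\}$; (3) $\Gamma(G)=o(\Delta)$; (4) $|E(G)|/|V(G)|=\Omega(\Delta)$. $V_p$ is a $p$-random subset of $V_n$, $\mathbf X=|\{e\in E_n:e\subseteq V_p\}|$, $\mathbb{E}\mathbf X=|E_n|p^k$. For a $k$-uniform hypergraph $G=(V,E)$ with maximum degree $\Delta$: $(F^G_{c,\zeta}(\mathbf x))_v=c\exp\left(-\frac{\zeta}{\Delta}\sum_{e\ni v}\prod_{u\in e\setminus\{v\}}x_u\right)$, and the Bethe free energy is $\mathcal B^G_{c,\zeta}(\mathbf x)=-\frac{\zeta}{\Delta}\sum_{e\in E}\prod_{u\in e}x_u-\sum_{v\in V}x_v\left[\log\frac{x_v}{c}-1\right]$. (Such $\zeta$ exists for large $n$; when $\eta=0$ take $\zeta=1$ and interpret the term $\log(1-\zeta)\eta\mathbb{E}\mathbf X$ as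 $0$.) *)

(* Defs.v *)
From HB Require Import structures.
From mathcomp Require Import all_boot all_order all_algebra.
From mathcomp Require Import all_classical all_reals all_analysis.
Set Implicit Arguments. Unset Strict Implicit. Unset Printing Implicit Defensive.
Import Order.TTheory GRing.Theory Num.Theory.
Import numFieldNormedType.Exports.
Local Open Scope classical_set_scope.
Local Open Scope ring_scope.

(* A hypergraph on a finite vertex type V is a set of edges E : {set {set V}}
   (edges are sets, so hypergraphs are simple). *)

Definition kuniform (V : finType) (E : {set {set V}}) (k : nat) : Prop :=
  forall e, e \in E -> #|e| = k.

Definition hdeg (V : finType) (E : {set {set V}}) (S : {set V}) : nat :=
  #|[set e in E | S \subset e]|.

Definition maxdeg_l (V : finType) (E : {set {set V}}) (l : nat) : nat :=
  \max_(S : {set V} | #|S| == l) hdeg E S.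

Definition maxdeg (V : finType) (E : {set {set V}}) : nat := maxdeg_l E 1.

Definition Gamma (V : finType) (E : {set {set V}}) (k : nat) : nat :=
  \max_(v : V) \max_(v' : V | v' != v)
     #|[set S : {set V} | [&& #|S| == k.-1, v |: S \in E & v' |: S \in E]]|.

Definition numX (V : finType) (E : {set {set V}}) (S : {set V}) : nat :=
  #|[set e in E | e \subset S]|.

Section RealDefs.
Variable R : realType.

Definition probp (V : finType) (p : R) (A : pred {set V}) : R :=
  \sum_(S : {set V} | A S) p ^+ #|S| * (1 - p) ^+ (#|V| - #|S|).

Definition meanX (V : finType) (E : {set {set V}}) (k : nat) (p : R) : R :=
  #|E|%:R * p ^+ k.

Definition Fmap (V : finType) (E : {set {set V}}) (c zeta : R) (x : V -> R)
  (v : V) : R :=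
  c * expR (- (zeta / (maxdeg E)%:R) *
            \sum_(e in E | v \in e) \prod_(u in e :\ v) x u).

Definition is_fixed_point (V : finType) (E : {set {set V}}) (c zeta : R)
  (x : V -> R) : Prop := forall v, Fmap E c zeta x v = x v.

Definition in_box (V : finType) (c : R) (x : V -> R) : Prop :=
  forall v, 0 <= x v <= c.

Definition Bethe (V : finType) (E : {set {set V}}) (c zeta : R) (x : V -> R) : R :=
  - (zeta / (maxdeg E)%:R) * (\sum_(e in E) \prod_(u in e) x u)
  - \sum_(v : V) x v * (ln (x v / c) - 1).

Definition asymp (a b : nat -> R) : Prop :=
  (fun n => a n / b n) @ \oo --> (1 : R).

Definition tree_like (V : nat -> finType) (E : forall n, {set {set V n}})
  (k : nat) : Prop :=
  [/\ (fun n => ((maxdeg (E n))%:R : R)) @ \oo --> +oo,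
      (forall l : nat, (2 <= l <= k.-1)%N ->
         (fun n => ((maxdeg_l (E n) l)%:R : R) /
            powR ((maxdeg (E n))%:R) ((k - l)%:R / (k.-1)%:R)) @ \oo --> (0 : R)),
      (fun n => ((Gamma (E n) k)%:R : R) / (maxdeg (E n))%:R) @ \oo --> (0 : R)
    & exists C : R, 0 < C /\
        \forall n \near \oo,
          C * (maxdeg (E n))%:R <= (#|E n|%:R : R) / (#|V n|%:R)].

End RealDefs.

(* Main.v *)
Require Import Defs.
From HB Require Import structures.
From mathcomp Require Import all_boot all_order all_algebra.
From mathcomp Require Import all_classical all_reals all_analysis.
From mathcomp Require Import ring lra zify.
Set Implicit Arguments. Unset Strict Implicit. Unset Printing Implicit Defensive.
Import Order.TTheory GRing.Theory Num.Theory.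
Import numFieldNormedType.Exports.
Local Open Scope ring_scope.

(** Weight a p-random set T by (1 - s)^X(T), with total mass Z(s).  In this
  tilted measure the conditional probability that a vertex is occupied, given
  that some set W is, obeys up to o(1) the recursion of a tree, because by the
  codegree conditions almost no edge closes a cycle with W.  Read on the messages
  prod_(u in e - v) x_u and measured by their square roots, this recursion is a
  contraction as soon as s (k-1) c^(k-1) < e, since x exp(- x^2 / 2) has maximum
  exp(- 1 / 2).  Hence the probability of an edge e in the tilted measure is
  asymptotic to (1 - s) (p / c)^k prod_(u in e) x_u, where x is the fixed point at s.

  Since - (log Z)'(s) is the sum of these probabilities divided by 1 - s, and
  fixed points are critical points of the Bethe free energy B, whose explicit
  dependence on s is - (s / Delta) sum_e prod_(u in e) x_u, summing over a fine
  grid of [0, zeta] gives log Z(zeta) ~ Delta^(-1/(k-1)) (B - c |V|).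

  Markov's inequality for (1 - zeta)^X bounds P(X <= eta E X) from above by
  (1 - zeta)^(- eta E X) Z(zeta).  For the lower bound, zeta is such that X has
  tilted mean (1 + o(1)) eta E X, and its tilted variance is negligible by the
  same estimates for pairs of edges; so X <= (1 + o(1)) eta E X with tilted
  probability at least 1/2.  Deleting a few more random vertices removes the
  factor 1 + o(1), at negligible cost. *)

(** * Partition functions of the tilted measures *)

(** Every estimate is proved for one finite hypergraph, with an error explicit in a single [eps],
    and limits are taken only at the end. The recursion asks for this uniformity: ratios of
    partition functions are exposed one vertex and one edge at a time, so both the occupied set [W]
    and the edge set [D] vary, and [m] levels may add [m * k] vertices to [W]. The depth is
    therefore fixed before [eps]; the contraction makes the error from stopping at depth [m] a
    multiple of [rho ^+ m].

    Ratios of partition functions need [s < 1], whereas [zeta = 1] is allowed; the mean value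
    theorem bridges this, since its intermediate point lies strictly below the right end. A fixed
    point is given at [zeta] only, so iterates of the map started at the constant [c] stand in for
    it at smaller [s].

    The outcome is an additive error [o(D * #|V|)] with [D = Delta^(-1/(k-1))]. It becomes a
    statement on ratios because the log probability is at most a negative multiple of [D * #|V|],
    and constant factors are absorbed because [D * #|V|] tends to infinity. *)

Section Model.
Import mathcomp.boot.finset mathcomp.boot.fintype.
Variables (R : realType) (V : finType) (p s : R).
Implicit Types (W T f : {set V}) (D : {set {set V}}).

Definition bwt T : R := p ^+ #|T| * (1 - p) ^+ (#|V| - #|T|).

(* For [W = set0] this is the partition function of the measure that penalises
   each occupied edge of [D] by a factor [1 - s]; ratios of two values of [pf]
   are the occupation probabilities under that measure. *)
Definition pf W D : R :=
  \sum_(T : {set V} | W \subset T) bwt T * (1 - s) ^+ numX D T.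

Lemma numXU1 D f T : f \notin D ->
  numX (f |: D) T = ((f \subset T) + numX D T)%N.
Proof.
move=> fD; rewrite /numX; case: (boolP (f \subset T)) => fT.
  rewrite [X in #|pred_of_set X|](_ : _ = f |: [set e in D | e \subset T]).
    by rewrite cardsU1 inE (negbTE fD) /= add1n.
  by apply/setP => e; rewrite !inE andb_orl; case: eqP => // ->; rewrite fT.
rewrite add0n; apply: eq_card => e; rewrite !inE; case: eqP => // ->.
by rewrite (negbTE fT) !andbF.
Qed.

(** The factor due to [f] is [1 - s] times the indicator of [f \subset T], subtracted from [1];
    hence adding [f] multiplies [pf W D] by [1 - s * P], where [P] is the probability that [f] is
    occupied given [W]. *)
Lemma pf_edge W D f : f \notin D ->
  pf W (f |: D) = pf W D - s * pf (W :|: f) D.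
Proof.
move=> fD; rewrite /pf.
under [X in _ - s * X]eq_bigl => T do rewrite subUset.
rewrite [X in _ - s * X]big_mkcondr mulr_sumr -sumrB.
apply: eq_bigr => T WT; rewrite numXU1//.
move: (bwt T) (numX D T) => b n; case: (f \subset T).
  by rewrite add1n exprS; ring.
by rewrite add0n mulr0 subr0.
Qed.

Hypothesis p01 : 0 < p < 1.

Lemma bwt_gt0 T : 0 < bwt T.
Proof.
by case/andP: p01 => p0 p1; rewrite mulr_gt0// exprn_gt0// subr_gt0.
Qed.

Lemma bwtU1 T v : v \notin T -> (1 - p) * bwt (v |: T) = p * bwt T.
Proof.
move=> vT; rewrite /bwt cardsU1 vT add1n.
have TV : (#|T| < #|V|)%N.
  by rewrite -[#|V|]cardsT proper_card// properT; apply: contraNneq vT => ->; rewrite inE.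
rewrite -[(#|V| - #|T|)%N](@subnSK #|T|)// !exprS; ring.
Qed.

Lemma numX_avoid D T v : (forall f, f \in D -> v \notin f) ->
  numX D (v |: T) = numX D T.
Proof.
move=> vD; apply: eq_card => f; rewrite !inE; case: (boolP (f \in D)) => //= fD.
by rewrite -(subDset f [set v] T) (_ : f :\: [set v] = f)//; apply/setDidPl;
  rewrite disjoint_sym disjoints1 vD.
Qed.

Lemma numX_sep D T v : v \notin T ->
  numX [set f in D | v \notin f] T = numX D T.
Proof.
move=> vT; apply: eq_card => f; rewrite !inE -andbA; case: (f \in D) => //=.
apply: andb_idl => /subsetP fT; by apply: contra vT => /fT.
Qed.

(* The configurations avoiding [v] do not see the edges through [v]. *)
Lemma pf_vertex W D v : v \notin W ->
  p * (pf W D - pf (v |: W) D) =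
  (1 - p) * pf (v |: W) [set f in D | v \notin f].
Proof.
move=> vW; set D0 := [set f in D | _].
have -> : pf W D = pf (v |: W) D +
    \sum_(T : {set V} | (W \subset T) && (v \notin T)) bwt T * (1 - s) ^+ numX D T.
  rewrite /pf (bigID (fun T : {set V} => v \in T))/=; congr (_ + _).
  by apply: eq_bigl => T; rewrite subUset sub1set andbC.
rewrite addrAC subrr add0r /pf.
rewrite [X in _ = _ * X](reindex_onto (fun T => v |: T) (fun T => T :\ v))/=; last first.
  by move=> T; rewrite subUset sub1set => /andP[vT _]; rewrite setD1K.
rewrite !mulr_sumr; apply: eq_big => T.
  apply/andP/andP => [[WT vT]|[WT /eqP vT]].
    rewrite subUset sub1set setU11 (subset_trans WT) ?subsetUr//.
    by rewrite setU1K.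
  have vnT : v \notin T by rewrite -vT !inE eqxx.
  split=> //; move: WT; rewrite subUset => /andP[_ /subsetP WT].
  apply/subsetP => u uW; have := WT u uW; rewrite !inE => /orP[/eqP uv|//].
  by rewrite uv in uW; rewrite uW in vW.
move=> /andP[_ vT]; rewrite [LHS]mulrA [RHS]mulrA bwtU1// numX_avoid ?numX_sep//.
by move=> f; rewrite inE => /andP[].
Qed.

Hypothesis s01 : 0 <= s < 1.

Lemma pf_gt0 W D : 0 < pf W D.
Proof.
case/andP: s01 => s0 s1; rewrite /pf (bigD1 setT) ?subsetT//=.
rewrite ltr_wpDr//; last by rewrite mulr_gt0 ?bwt_gt0// exprn_gt0// subr_gt0.
by apply: sumr_ge0 => T _; rewrite mulr_ge0 ?(ltW (bwt_gt0 _))// exprn_ge0// subr_ge0 ltW.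
Qed.

Lemma pfS W D D' : D \subset D' -> pf W D' <= pf W D.
Proof.
move=> DD'; apply: ler_sum => T _; rewrite ler_wpM2l ?(ltW (bwt_gt0 _))//.
apply: ler_wiXn2l.
- by rewrite subr_ge0; case/andP: s01 => _ /ltW.
- by rewrite gerBl; case/andP: s01.
apply: subset_leq_card; apply/subsetP => f; rewrite !inE => /andP[fD ->].
by rewrite (subsetP DD').
Qed.

(** Penalties can only lower the occupation probability of [v]: by [pf_vertex] its odds are
    [p / (1 - p)] times a ratio of partition functions that is at most [1], since dropping the edges
    through [v] increases [pf]. *)
Lemma pf_vertex_le W D v : v \notin W -> pf (v |: W) D <= p * pf W D.
Proof.
move=> vW; have := pf_vertex D vW; set D0 := [set f in D | _] => h.
have : pf (v |: W) D <= pf (v |: W) D0.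
  by apply: pfS; apply/subsetP => f; rewrite inE => /andP[].
case/andP: p01 => p0 p1 le1.
suff : (1 - p) * pf (v |: W) D <= p * (pf W D - pf (v |: W) D) by lra.
by rewrite h ler_wpM2l// subr_ge0 ltW.
Qed.

Lemma pf_union_le W D f : [disjoint f & W] -> pf (W :|: f) D <= p ^+ #|f| * pf W D.
Proof.
have [n] := ubnP #|f|; elim: n f W => // n IH f W.
have [->|[v vf]] := set_0Vmem f; first by rewrite setU0 cards0 mul1r.
rewrite (cardsD1 v f) vf add1n ltnS => fn.
rewrite disjoint_sym disjoints_subset => fW.
have vW : v \notin W by apply: contraL vf => /(subsetP fW); rewrite inE.
rewrite -{1}(setD1K vf) setUA [W :|: [set v]]setUC.
apply: (le_trans (IH _ _ _ _)) => //.
  rewrite disjoint_sym disjoints_subset; apply/subsetP => u.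
  rewrite !inE => /orP[/eqP->|uW]; first by rewrite eqxx.
  by have := subsetP fW u uW; rewrite inE => /negbTE->; rewrite andbF.
rewrite exprSr -mulrA ler_wpM2l ?pf_vertex_le//.
by rewrite exprn_ge0//; case/andP: p01 => /ltW.
Qed.

(** Chain rule: the vertices of [f] are revealed one at a time. The order is hidden behind [W'], of
    which only [W \subset W' \subset W :|: f] is kept, because the later estimates are uniform in
    the occupied set. *)
Lemma pf_vertex_chain W D f : [disjoint f & W] ->
  exists x : V -> R,
    (forall u, u \in f -> exists W' : {set V}, [/\ W \subset W', W' \subset W :|: f,
        u \notin W' & x u = pf (u |: W') D / pf W' D]) /\
    pf (W :|: f) D = pf W D * \prod_(u in f) x u.
Proof.
have [n] := ubnP #|f|; elim: n f W => // n IH f W.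
have [->|[v vf]] := set_0Vmem f.
  exists (fun=> 0); split; first by move=> u; rewrite inE.
  by rewrite setU0 big_set0 mulr1.
rewrite (cardsD1 v f) vf add1n ltnS => fn.
rewrite disjoint_sym disjoints_subset => fW.
have vW : v \notin W by apply: contraL vf => /(subsetP fW); rewrite inE.
have eqf : (v |: W) :|: f :\ v = W :|: f.
  by rewrite [v |: W]setUC -setUA setD1K.
have [|x [xP xE]] := IH (f :\ v) (v |: W) fn.
  rewrite disjoint_sym disjoints_subset; apply/subsetP => u.
  rewrite !inE => /orP[/eqP->|uW]; first by rewrite eqxx.
  by have := subsetP fW u uW; rewrite inE => /negbTE->; rewrite andbF.
exists (fun u => if u == v then pf (v |: W) D / pf W D else x u); split.
  move=> u uf; case: eqP => [->|/eqP uv].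
    by exists W; rewrite subxx subsetUl vW.
  have [|W' [vWW' W'f uW' ->]] := xP u; first by rewrite !inE uv.
  exists W'; split=> //; first by rewrite (subset_trans _ vWW')// subsetUr.
  by rewrite -eqf.
rewrite -eqf xE (bigD1 v vf)/= eqxx !mulrA; congr (_ * _).
  by rewrite mulrAC divff ?mul1r ?gt_eqF ?pf_gt0.
apply: eq_big => u; first by rewrite !inE andbC.
by rewrite !inE => /andP[/negbTE->].
Qed.

(** The same telescoping over edges: those of [B] are added one at a time, each contributing the
    factor of [pf_edge]. *)
Lemma pf_edge_chain W D (B : {set {set V}}) : [disjoint B & D] ->
  exists P : {set V} -> R,
    (forall f, f \in B -> exists D' : {set {set V}}, [/\ D \subset D', D' \subset D :|: B,
        f \notin D' & P f = pf (W :|: f) D' / pf W D']) /\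
    pf W (D :|: B) = pf W D * \prod_(f in B) (1 - s * P f).
Proof.
have [n] := ubnP #|B|; elim: n B D => // n IH B D.
have [->|[f fB]] := set_0Vmem B.
  exists (fun=> 0); split; first by move=> u; rewrite inE.
  by rewrite setU0 big_set0 mulr1.
rewrite (cardsD1 f B) fB add1n ltnS => Bn.
rewrite disjoint_sym disjoints_subset => BD.
have fD : f \notin D by apply: contraL fB => /(subsetP BD); rewrite inE.
have eqB : (f |: D) :|: B :\ f = D :|: B.
  by rewrite [f |: D]setUC -setUA setD1K.
have [|x [xP xE]] := IH (B :\ f) (f |: D) Bn.
  rewrite disjoint_sym disjoints_subset; apply/subsetP => u.
  rewrite !inE => /orP[/eqP->|uD]; first by rewrite eqxx.
  by have := subsetP BD u uD; rewrite inE => /negbTE->; rewrite andbF.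
exists (fun u => if u == f then pf (W :|: f) D / pf W D else x u); split.
  move=> u uB; case: eqP => [->|/eqP uf].
    by exists D; rewrite subxx subsetUl fD.
  have [|D' [fDD' D'B uD' ->]] := xP u; first by rewrite !inE uf.
  exists D'; split=> //; first by rewrite (subset_trans _ fDD')// subsetUr.
  by rewrite -eqB.
rewrite -eqB xE (bigD1 f fB)/= eqxx !mulrA; congr (_ * _).
  by rewrite pf_edge//; field; rewrite gt_eqF ?pf_gt0.
apply: eq_big => u; first by rewrite !inE andbC.
by rewrite !inE => /andP[/negbTE->].
Qed.

(** [r] is the average penalty due to the edges through [v] when [v] is present, so presence and
    absence of [v] have weights [p * r] and [1 - p]. *)
Lemma pf_vertex_ratio W D v : v \notin W ->
  let r := pf (v |: W) D / pf (v |: W) [set f in D | v \notin f] in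
  pf (v |: W) D / pf W D = p * r / (1 - p + p * r).
Proof.
move=> vW r; have := pf_vertex D vW; rewrite /r; set D0 := [set f in D | _].
have := pf_gt0 (v |: W) D; have := pf_gt0 (v |: W) D0; have := pf_gt0 W D.
case/andP: p01 => p0 p1 g1 g2 g3 h.
have q0 : 0 < (1 - p) * pf (v |: W) D0 + p * pf (v |: W) D.
  by rewrite addr_gt0 ?mulr_gt0 ?subr_gt0.
have e1 : p * pf W D = (1 - p) * pf (v |: W) D0 + p * pf (v |: W) D.
  by rewrite -h; ring.
have -> : pf W D = ((1 - p) * pf (v |: W) D0 + p * pf (v |: W) D) / p.
  by rewrite -e1 mulrC mulKf ?gt_eqF.
by field; rewrite ?gt_eqF//= ?andbT.
Qed.

End Model.

(** * Contraction of the message recursion *)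

Section Contraction.
Import mathcomp.boot.finset mathcomp.boot.fintype.
Variable R : realType.

Lemma expRN_lip (a b : R) : 0 <= a -> 0 <= b ->
  `|expR (- a) - expR (- b)| <= `|a - b|.
Proof.
wlog ab : a b / a <= b => [H|] a0 b0.
  by case/orP: (le_total a b) => ab; [exact: H|rewrite distrC [`|a - b|]distrC; exact: H].
rewrite [X in _ <= X]ler0_norm ?subr_le0// ger0_norm ?subr_ge0 ?ler_expR ?lerN2//.
have -> : expR (- b) = expR (- a) * expR (- (b - a)) by rewrite -expRD; congr expR; ring.
have h1 := expR_ge1Dx (- (b - a)).
have h2 : expR (- a) <= 1 by rewrite expR_le1 oppr_le0.
have h3 := expR_ge0 (- a).
nra.
Qed.

(** After squaring this is [x ^+ 2 <= expR (x ^+ 2 - 1)], an instance of [1 + y <= expR y], sharp at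
    [x = 1]. The threshold [e] of the theorem originates here. *)
Lemma gauss_deriv_le (x : R) : `|x * expR (- (x ^+ 2 / 2))| <= expR (- 2^-1).
Proof.
have h : x ^+ 2 <= expR (x ^+ 2 - 1).
  by apply: le_trans (expR_ge1Dx _); rewrite addrC subrK.
rewrite -(@ler_pXn2r _ 2)// ?nnegrE ?expR_ge0// real_normK ?num_real//.
rewrite exprMn -!expRM_natl.
have -> : expR (2%:R * - (x ^+ 2 / 2)) = expR (- 1) * expR (- (x ^+ 2 - 1)) :> R.
  by rewrite -expRD; congr expR; field.
have -> : 2%:R * - 2^-1 = - 1 :> R by field.
rewrite mulrCA ler_piMr ?expR_ge0// expRN ler_pdivrMr ?expR_gt0//.
by rewrite mul1r.
Qed.

Lemma gauss_lip (x y : R) :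
  `|expR (- (x ^+ 2 / 2)) - expR (- (y ^+ 2 / 2))| <= expR (- 2^-1) * `|x - y|.
Proof.
wlog xy : x y / x <= y => [H|].
  by case/orP: (le_total x y) => xy; [exact: H|rewrite distrC [`|x - y|]distrC; exact: H].
pose f := fun t : R => expR (- (t ^+ 2 / 2)).
have df t : is_derive t (1 : R) f (- (t * f t)).
  apply: is_derive_eq => //.
  by rewrite /f /GRing.scale/=; field.
have [|t _ h] := MVT_segment xy (fun t _ => df t).
  apply: continuous_subspaceT => t; apply: differentiable_continuous.
  by apply/derivable1_diffP; case: (df t).
rewrite distrC -/(f x) -/(f y) h normrM normrN [`|y - x|]distrC.
by rewrite ler_wpM2r// gauss_deriv_le.
Qed.

Lemma sqr_sum_le (I : finType) (P : pred I) (N : R) (a : I -> R) :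
  #|P|%:R <= N -> (\sum_(i | P i) a i) ^+ 2 <= N * \sum_(i | P i) a i ^+ 2.
Proof.
move=> PN; apply: (@le_trans _ _ (#|P|%:R * \sum_(i | P i) a i ^+ 2)); last first.
  by rewrite ler_wpM2r// sumr_ge0// => i _; rewrite sqr_ge0.
have [P0|P0] := eqVneq #|P| 0%N.
  by rewrite big_pred0 ?P0 ?mul0r ?expr0n// => i; have := card0_eq P0 i; rewrite inE.
set n : R := #|P|%:R; set S := \sum_(i | P i) a i; set Q := \sum_(i | P i) _.
have n0 : 0 < n by rewrite ltr0n lt0n.
have : 0 <= \sum_(i | P i) (n * a i - S) ^+ 2 by rewrite sumr_ge0// => i _; rewrite sqr_ge0.
have -> : \sum_(i | P i) (n * a i - S) ^+ 2 = n ^+ 2 * Q - (n * S *+ 2) * S + n * S ^+ 2.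
  rewrite (eq_bigr (fun i => n ^+ 2 * a i ^+ 2 - n * S *+ 2 * a i + S ^+ 2)).
    by rewrite big_split/= sumrB -!mulr_sumr sumr_const [n * S ^+ 2]mulr_natl mulrnAr -expr2.
  by move=> i _; ring.
have -> : n ^+ 2 * Q - n * S *+ 2 * S + n * S ^+ 2 = n * (n * Q - S ^+ 2) by ring.
by rewrite pmulr_rge0// subr_ge0.
Qed.

(** The square root of a sum of nonnegative numbers is the Euclidean norm of the vector of their
    square roots, so this is the reverse triangle inequality with at most [N] coordinates, each off
    by at most [t]. *)
Lemma sqrt_sum_dist (I : finType) (P : pred I) (N t : R) (a b : I -> R) :
  #|P|%:R <= N -> 0 <= t ->
  (forall i, P i -> 0 <= a i) -> (forall i, P i -> 0 <= b i) ->
  (forall i, P i -> `|Num.sqrt (a i) - Num.sqrt (b i)| <= t) ->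
  `|Num.sqrt (\sum_(i | P i) a i) - Num.sqrt (\sum_(i | P i) b i)| <= Num.sqrt N * t.
Proof.
move=> PN t0 a0 b0 ab.
set A := \sum_(i | P i) a i; set B := \sum_(i | P i) b i.
have N0 : 0 <= N by apply: le_trans PN.
have A0 : 0 <= A by rewrite sumr_ge0.
have B0 : 0 <= B by rewrite sumr_ge0.
have CS (d : I -> R) : (forall i, P i -> 0 <= d i) ->
    \sum_(i | P i) Num.sqrt (d i) <= Num.sqrt N * Num.sqrt (\sum_(i | P i) d i).
  move=> d0; rewrite -sqrtrM// -[leLHS]ger0_norm ?sumr_ge0//; last first.
  rewrite -sqrtr_sqr; apply: ler_wsqrtr.
  apply: le_trans (sqr_sum_le _ PN) _; rewrite ler_wpM2l//.
  by apply: ler_sum => i Pi; rewrite sqr_sqrtr ?d0.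
have h : `|A - B| <= t * Num.sqrt N * (Num.sqrt A + Num.sqrt B).
  rewrite /A /B -sumrB (le_trans (ler_norm_sum _ _ _))//.
  apply: (@le_trans _ _ (\sum_(i | P i) t * (Num.sqrt (a i) + Num.sqrt (b i)))).
    apply: ler_sum => i Pi.
    rewrite -{1}(sqr_sqrtr (a0 i Pi)) -{1}(sqr_sqrtr (b0 i Pi)) subr_sqr normrM.
    rewrite [X in _ * X]ger0_norm ?addr_ge0 ?sqrtr_ge0//.
    by rewrite ler_wpM2r ?addr_ge0 ?sqrtr_ge0 ?ab.
  rewrite -mulr_sumr -mulrA ler_wpM2l// big_split mulrDr lerD//; exact: CS.
have [AB0|AB0] := eqVneq (Num.sqrt A + Num.sqrt B) 0.
  have a1 := sqrtr_ge0 A; have b1 := sqrtr_ge0 B.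
  have -> : Num.sqrt A = 0 by lra.
  have -> : Num.sqrt B = 0 by lra.
  by rewrite subrr normr0 mulr_ge0 ?sqrtr_ge0.
have AB1 : 0 < Num.sqrt A + Num.sqrt B by rewrite lt_def AB0 addr_ge0 ?sqrtr_ge0.
rewrite -(ler_pM2r AB1) -{1}[X in _ * X](gtr0_norm AB1) -normrM -subr_sqr !sqr_sqrtr//.
by rewrite [Num.sqrt N * t]mulrC.
Qed.

(* One step of the tree recursion, read on the messages [\prod_(u in e :\ v) x u]:
   these obey [z = c^(k-1) exp (- (s / Delta) * sum of (k-1) Delta messages)],
   for which the square root is a potential with contraction factor
   [sqrt (s (k-1) c^(k-1) / e)]. *)
Lemma message_contraction (V : finType) (E : {set {set V}}) (e : {set V})
  (c s rho d e1 e2 t : R) (x y : V -> R) (a b : V -> {set V} -> R) :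
  0 < c -> 0 <= s -> 0 < d -> 0 <= rho -> 0 <= t ->
  s * #|e|%:R * c ^+ #|e| <= rho ^+ 2 * expR 1 ->
  (forall u, u \in e -> #|[set f in E | u \in f]|%:R <= d) ->
  (forall u, u \in e -> 0 < x u <= c) -> (forall u, u \in e -> 0 < y u <= c) ->
  (forall u f, u \in e -> f \in E -> u \in f -> 0 <= a u f) ->
  (forall u f, u \in e -> f \in E -> u \in f -> 0 <= b u f) ->
  (forall u f, u \in e -> f \in E -> u \in f ->
     `|Num.sqrt (a u f) - Num.sqrt (b u f)| <= t) ->
  (forall u, u \in e ->
     `|ln (x u / c) + s / d * \sum_(f in E | u \in f) a u f| <= e1) ->
  (forall u, u \in e ->
     `|ln (y u / c) + s / d * \sum_(f in E | u \in f) b u f| <= e2) ->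
  `|Num.sqrt (\prod_(u in e) x u) - Num.sqrt (\prod_(u in e) y u)|
    <= rho * t + Num.sqrt (c ^+ #|e|) * #|e|%:R * (e1 + e2) / 2.
Proof.
move=> c0 s0 d0 rho0 t0 hrho deg x0 y0 a0 b0 ab hx hy.
set n : R := #|e|%:R; set C := c ^+ #|e|.
have C0 : 0 < C by rewrite exprn_gt0.
(* Halving the exponent puts the root of the product in the form exp(- X^2 / 2), where X^2 is the
   sum of the [- ln (z u / c)]; this is the function treated by [gauss_lip]. *)
have prodE (z : V -> R) : (forall u, u \in e -> 0 < z u <= c) ->
    Num.sqrt (\prod_(u in e) z u) =
    Num.sqrt C * expR (- ((- \sum_(u in e) ln (z u / c)) / 2)).
  move=> z0.
  have -> : \prod_(u in e) z u =
      C * expR (- ((- \sum_(u in e) ln (z u / c)) / 2)) ^+ 2.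
    rewrite -expRM_natl.
    have -> : 2%:R * - (- (\sum_(u in e) ln (z u / c)) / 2) =
      \sum_(u in e) ln (z u / c) by field.
    rewrite expR_sum /C -prodr_const -big_split/=; apply: eq_bigr => u ue.
    have /andP[zu _] := z0 u ue.
    by rewrite lnK ?posrE ?divr_gt0// mulrCA divff ?mulr1// gt_eqF.
  by rewrite sqrtrM ?(ltW C0)// sqrtr_sqr ger0_norm ?expR_ge0.
have lnz (z : V -> R) : (forall u, u \in e -> 0 < z u <= c) ->
    0 <= (- \sum_(u in e) ln (z u / c)) / 2.
  move=> z0; rewrite divr_ge0// oppr_ge0 sumr_le0// => u ue.
  by have /andP[zu zc] := z0 u ue; rewrite ln_le0// ler_pdivrMr// mul1r.
set A := s / d * \sum_(u in e) \sum_(f in E | u \in f) a u f.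
set B := s / d * \sum_(u in e) \sum_(f in E | u \in f) b u f.
have sd0 : 0 <= s / d by rewrite divr_ge0// ltW.
have A0 : 0 <= A.
  by rewrite mulr_ge0// sumr_ge0// => u ue; rewrite sumr_ge0// => f /andP[]; exact: a0.
have B0 : 0 <= B.
  by rewrite mulr_ge0// sumr_ge0// => u ue; rewrite sumr_ge0// => f /andP[]; exact: b0.
have close (z : V -> R) (m : V -> {set V} -> R) (er : R) :
    (forall u, u \in e -> 0 < z u <= c) ->
    0 <= s / d * (\sum_(u in e) \sum_(f in E | u \in f) m u f) ->
    (forall u, u \in e ->
     `|ln (z u / c) + s / d * \sum_(f in E | u \in f) m u f| <= er) ->
    `|expR (- ((- \sum_(u in e) ln (z u / c)) / 2)) -
      expR (- ((s / d * (\sum_(u in e) \sum_(f in E | u \in f) m u f)) / 2))|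
      <= n * er / 2.
  move=> z0 m0 hz; apply: le_trans (expRN_lip (lnz z z0) _) _; first by rewrite divr_ge0.
  rewrite -mulrBl normrM [X in _ * X]ger0_norm// ler_wpM2r//.
  rewrite -opprD normrN mulr_sumr -big_split/=.
  apply: le_trans (ler_norm_sum _ _ _) _.
  apply: le_trans (ler_sum _ hz) _.
  by rewrite sumr_const mulr_natl.
have hX := close x a e1 x0 A0 hx; have hY := close y b e2 y0 B0 hy.
rewrite (prodE x x0) (prodE y y0) -mulrBr normrM (ger0_norm (sqrtr_ge0 _)).
rewrite -/A -/B in hX hY.
(* [gauss_lip] costs [expR (- 2^-1)] and [sqrt_sum_dist] over at most [n * d] pairs [(u, f)] costs
   [Num.sqrt (n * d)]. With [Num.sqrt (s / d)] and [Num.sqrt C] the square of the total is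
   [s * n * C / expR 1], at most [rho ^+ 2]. *)
have hAB : Num.sqrt C * `|expR (- (A / 2)) - expR (- (B / 2))| <= rho * t.
  rewrite -{1}(sqr_sqrtr A0) -{1}(sqr_sqrtr B0).
  apply: (@le_trans _ _ (Num.sqrt C * (expR (- 2^-1) * (Num.sqrt (s / d) * (Num.sqrt (n * d) * t))))).
    rewrite ler_wpM2l ?sqrtr_ge0// (le_trans (gauss_lip _ _))//.
    rewrite ler_wpM2l ?expR_ge0// /A /B !(sqrtrM _ sd0) -mulrBr normrM.
    rewrite [`|Num.sqrt (s / d)|]ger0_norm ?sqrtr_ge0// ler_wpM2l ?sqrtr_ge0//.
    rewrite !pair_big_dep/=.
    apply: sqrt_sum_dist => //.
    - pose P := [set q : V * {set V} | (q.1 \in e) && ((q.2 \in E) && (q.1 \in q.2))].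
      apply: (@le_trans _ _ (\sum_(u in e) #|[set f in E | u \in f]|%:R)).
        rewrite -natr_sum ler_nat -(eq_card (_ : P =i _)); last by move=> q; rewrite inE.
        rewrite -sum1_card (eq_bigl (fun q : V * {set V} =>
          (q.1 \in e) && ((q.2 \in E) && (q.1 \in q.2)))); last by move=> q; rewrite inE.
        rewrite -(pair_big_dep (mem e) (fun u f => (f \in E) && (u \in f)) (fun _ _ => 1%N)).
        apply: leq_sum => u ue; rewrite -sum1_card.
        by rewrite [leqRHS](eq_bigl (fun f => (f \in E) && (u \in f)))// => f; rewrite inE.
      by rewrite mulr_natl -sumr_const ler_sum.
    - by move=> q /andP[? /andP[]]; exact: a0.
    - by move=> q /andP[? /andP[]]; exact: b0.
    - by move=> q /andP[? /andP[]]; exact: ab.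
  rewrite !mulrA ler_wpM2r//.
  rewrite -(@ler_pXn2r _ 2)// ?nnegrE// ?mulr_ge0 ?sqrtr_ge0 ?expR_ge0//.
  rewrite !exprMn !sqr_sqrtr ?mulr_ge0 ?invr_ge0 ?(ltW C0) ?(ltW d0)// -expRM_natl.
  rewrite (_ : 2%:R * - 2^-1 = -1); last by field.
  rewrite expRN.
  have e0 := expR_gt0 (1 : R).
  rewrite (_ : C / expR 1 * (s / d) * (n * d) = (s * n * C) / expR 1); last first.
    by field; rewrite !gt_eqF.
  by rewrite ler_pdivrMr.
have sC := sqrtr_ge0 C.
set X := expR _ in hX *; set Y := expR _ in hY *.
have : `|X - Y| <= `|expR (- (A / 2)) - expR (- (B / 2))| + n * e1 / 2 + n * e2 / 2.
  have -> : X - Y = (expR (- (A / 2)) - expR (- (B / 2))) +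
     ((X - expR (- (A / 2))) - (Y - expR (- (B / 2)))) by ring.
  rewrite (le_trans (ler_normD _ _))// -[leRHS]addrA lerD2l (le_trans (ler_normB _ _))//.
  by rewrite lerD.
move=> /(ler_wpM2l sC) h; apply: (le_trans h).
rewrite !mulrDr; nra.
Qed.

End Contraction.

(** * Codegree counting *)

Section Counting.
Import mathcomp.boot.finset mathcomp.boot.fintype.
Local Open Scope set_scope.
Local Open Scope nat_scope.

Lemma card_bigcup_le (I T : finType) (P : pred I) (F : I -> {set T}) :
  #|\bigcup_(i | P i) F i| <= \sum_(i | P i) #|F i|.
Proof.
elim/big_rec2: _ => [|i n A _ le]; first by rewrite cards0.
by rewrite (leq_trans (leq_card_setU _ _))// leq_add2l.
Qed.

Variables (V : finType) (E : {set {set V}}) (k : nat).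
Hypothesis unif : kuniform E k.
Implicit Types (A B T f g W : {set V}).

Lemma hdeg_le T : (hdeg E T <= maxdeg_l E #|T|)%N.
Proof. exact: (leq_bigmax_cond T). Qed.

Lemma hdeg1_le v : (#|[set f in E | v \in f]| <= maxdeg E)%N.
Proof.
rewrite /maxdeg -(cards1 v); apply: leq_trans (hdeg_le _).
by apply/eq_leq/eq_card => f; rewrite !inE sub1set.
Qed.

(* [f] is bad when some other edge becomes fully occupied as soon as [f] joins
   the occupied set [A]. *)
Definition bad A f : bool :=
  [exists g in E, [&& g != f, g \subset A :|: f & ~~ (g \subset A)]].

(** Sort by the trace [T] of [g] on [A]: at most [maxdeg_l E #|T|] edges [g] contain [T], and each
    forces [f] to contain the disjoint union of [B] and [g :\: A], a set of size
    [k - #|T| + #|B|]. *)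
Lemma card_link_pairs A B (t : nat) :
  (#|[set f in E | (f :&: A == B) &&
      [exists g in E, [&& (t <= #|g :&: A|)%N, g \subset A :|: f & ~~ (g \subset A)]]]|
   <= \sum_(T in powerset A | t <= #|T| <= k.-1)
        maxdeg_l E #|T| * maxdeg_l E (k - #|T| + #|B|))%N.
Proof.
apply: (@leq_trans (\sum_(T in powerset A | (t <= #|T| <= k.-1)%N)
   \sum_(g in E | g :&: A == T) #|[set f in E | (B :|: (g :\: A) \subset f) && [disjoint B & g :\: A]]|)).
  set L := [set f in E | _].
  apply: (@leq_trans #|\bigcup_(T in [set T in powerset A | (t <= #|T| <= k.-1)%N])
      \bigcup_(g in [set g in E | g :&: A == T])
        [set f in E | (B :|: (g :\: A) \subset f) && [disjoint B & g :\: A]]|).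
    apply: subset_leq_card; apply/subsetP => f.
    rewrite inE => /andP[fE /andP[/eqP fA /exists_inP[g gE /and3P[tg gAf gA]]]].
    apply/bigcupP; exists (g :&: A).
      rewrite inE powersetE subsetIr tg/=.
      have lt : #|g :&: A| < k.
        rewrite -(unif gE) proper_card// properEneq subsetIl andbT.
        by apply: contra gA => /eqP <-; rewrite subsetIr.
      by rewrite -ltnS prednK// (leq_ltn_trans _ lt).
    apply/bigcupP; exists g; first by rewrite inE gE eqxx.
    rewrite inE fE subUset -fA subsetIl/=; apply/andP; split.
      by rewrite subDset.
    rewrite -setI_eq0; apply/eqP/setP => u; rewrite !inE.
    by case: (u \in A); rewrite /= ?andbF.
  apply: leq_trans (card_bigcup_le _ _) _ => //=.
  rewrite (eq_bigl (fun T => (T \in powerset A) && (t <= #|T| <= k.-1)%N)); last first.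
    by move=> T; rewrite inE.
  apply: leq_sum => T _; apply: leq_trans (card_bigcup_le _ _) _.
  by rewrite [leqLHS](eq_bigl (fun g => (g \in E) && (g :&: A == T)))// => g; rewrite inE.
apply: leq_sum => T /andP[TA /andP[tT Tk]].
apply: (@leq_trans (\sum_(g in E | g :&: A == T) maxdeg_l E (k - #|T| + #|B|))).
  apply: leq_sum => g /andP[gE /eqP gA].
  case: (boolP [disjoint B & g :\: A]) => dBg; last first.
    by rewrite (eq_card (_ : _ =i pred0)) ?card0// => f; rewrite !inE !andbF.
  have -> : (k - #|T| + #|B| = #|B :|: g :\: A|)%N.
    by rewrite cardsU (eqP (_ : B :&: _ == set0)) ?setI_eq0// cards0 subn0 cardsD gA
      (unif gE) addnC.
  apply: leq_trans (hdeg_le _); apply/eq_leq/eq_card => f.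
  by rewrite !inE andbT.
rewrite sum_nat_const leq_mul2r; apply/orP; right.
apply: leq_trans (hdeg_le _); apply/subset_leq_card/subsetP => g.
by rewrite !inE => /andP[-> /eqP <-]; rewrite subsetIl.
Qed.

(** An edge disjoint from [A] would lie inside [f], and uniformity would make it equal to [f]. *)
Lemma bad_inter_gt0 A f : f \in E -> forall g, g \in E -> g != f ->
  g \subset A :|: f -> (0 < #|g :&: A|)%N.
Proof.
move=> fE g gE gf gAf; rewrite card_gt0; apply: contra gf => /eqP gA.
rewrite eqEcard (unif fE) (unif gE) leqnn andbT.
apply/subsetP => u ug; have := subsetP gAf u ug; rewrite inE => /orP[uA|//].
by have : u \in g :&: A; [rewrite inE ug|rewrite gA inE].
Qed.

Lemma card_bad0 W :
  (#|[set f in E | [disjoint f & W] && bad W f]|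
   <= \sum_(T in powerset W | 1 <= #|T| <= k.-1)
        maxdeg_l E #|T| * maxdeg_l E (k - #|T|))%N.
Proof.
apply: leq_trans; last first.
  have := card_link_pairs W set0 1; under eq_bigr do rewrite cards0 addn0; apply.
apply/subset_leq_card/subsetP => f; rewrite !inE setI_eq0.
move=> /andP[fE /andP[-> /exists_inP[g gE /and3P[gf gWf gW]]]]; rewrite fE/=.
apply/exists_inP; exists g => //; rewrite gWf gW !andbT.
exact: bad_inter_gt0 gE gf gWf.
Qed.

(** Sort by the trace of the second edge [g] on [A]. If it is a single vertex [w], uniformity gives
    [g :\: A = f :\ v], so [f] and [g] differ by exchanging [v] and [w], which [Gamma] counts;
    larger traces fall under [card_link_pairs] with [B = [set v]]. *)
Lemma card_bad1 A v : v \in A ->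
  (#|[set f in E | (f :&: A == [set v]) && bad A f]|
   <= #|A| * Gamma E k + \sum_(T in powerset A | 2 <= #|T| <= k.-1)
        maxdeg_l E #|T| * maxdeg_l E (k.+1 - #|T|))%N.
Proof.
move=> vA.
pose L := [set f in E | (f :&: A == [set v]) &&
      [exists g in E, [&& (2 <= #|g :&: A|)%N, g \subset A :|: f & ~~ (g \subset A)]]].
pose Phi w := [set f in E | [&& v \in f & w |: (f :\ v) \in E]].
apply: (@leq_trans #|(\bigcup_(w in A :\ v) Phi w) :|: L|).
  apply/subset_leq_card/subsetP => f; rewrite !inE.
  move=> /andP[fE /andP[fA /exists_inP[g gE /and3P[gf gAf gA]]]]; rewrite fE fA/=.
  have vf : v \in f by have := set11 v; rewrite -(eqP fA) inE => /andP[].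
  have := bad_inter_gt0 fE gE gf gAf; rewrite leq_eqVlt => /orP[gA1|gA2]; last first.
    by apply/orP; right; apply/exists_inP; exists g => //; rewrite gA2 gAf gA.
  apply/orP; left.
  move: gA1; rewrite eq_sym => /cards1P[w gAw].
  have wgA : w \in g :&: A by rewrite gAw set11.
  have eqgf : g :\: A = f :\ v.
    apply/eqP; rewrite eqEcard; apply/andP; split.
      apply/subsetP => u; rewrite !inE => /andP[uA ug].
      have := subsetP gAf u ug; rewrite inE (negbTE uA)/= => ->; rewrite andbT.
      by apply: contraNneq uA => ->.
    by rewrite (cardsD g) gAw cards1 (unif gE) cardsD (setIidPr _) ?sub1set// cards1 (unif fE).
  have gE' : g = w |: (f :\ v) by rewrite -eqgf -gAw setID.
  move: wgA; rewrite inE => /andP[wg wA].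
  apply/bigcupP; exists w; last by rewrite inE fE vf -gE'.
  rewrite !inE wA andbT; apply: contra gf => /eqP wv.
  by rewrite gE' wv setD1K.
apply: leq_trans (leq_card_setU _ _) _; apply: leq_add; last first.
  apply: leq_trans (card_link_pairs _ _ _) _.
  by apply/eq_leq/eq_bigr => T /andP[_ /andP[_ Tk]]; rewrite cards1 addn1 subSn//
    (leq_trans Tk)// leq_pred.
apply: leq_trans (card_bigcup_le _ _) _.
apply: (@leq_trans (\sum_(w in A :\ v) Gamma E k)); last first.
  by rewrite sum_nat_const leq_mul2r subset_leq_card ?orbT// subsetDl.
apply: leq_sum => w; rewrite !inE => /andP[wv wA].
rewrite /Gamma (bigD1 v)//= leq_max; apply/orP; left.
rewrite (bigD1 w)//= leq_max; apply/orP; left.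
rewrite -(card_in_imset (_ : {in Phi w &, injective (fun f => f :\ v)})); last first.
  move=> f g; rewrite !inE => /and3P[_ vf _] /and3P[_ vg _] fg.
  by rewrite -(setD1K vf) -(setD1K vg) fg.
apply/subset_leq_card/subsetP => S /imsetP[f]; rewrite !inE => /and3P[fE vf wf] ->.
by apply: mem_set; rewrite /= setD1K// fE wf cardsD (setIidPr _) ?sub1set// cards1 (unif fE) subn1 eqxx.
Qed.

End Counting.

(** * The recursion in the tilted model *)

Section Recursion.
Import mathcomp.boot.finset mathcomp.boot.fintype.
Variable R : realType.

(* The quantitative content, at a fixed hypergraph, of tree-likeness
   and of [p ~ c Delta^(-1/(k-1))]. *)
Record tame (V : finType) (E : {set {set V}}) (k : nat) (c p eps : R) : Prop := Tame {
  tame_unif : kuniform E k;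
  tame_p : 0 < p <= eps;
  tame_deg : `|p ^+ k.-1 * (maxdeg E)%:R / c ^+ k.-1 - 1| <= eps;
  tame_codeg : forall l, (2 <= l <= k.-1)%N -> (maxdeg_l E l)%:R * p ^+ (k - l) <= eps;
  tame_two : (maxdeg_l E 2)%:R <= eps * (maxdeg E)%:R;
  tame_Gamma : (Gamma E k)%:R <= eps * (maxdeg E)%:R;
  tame_big : 1 <= eps * (maxdeg E)%:R }.

Lemma eq_ler (x y : R) : x = y -> x <= y. Proof. by move->. Qed.

Lemma codim_bounds (k l : nat) : (2 <= l <= k.-1)%N ->
  [/\ (2 <= k.+1 - l <= k.-1)%N & (k - l + (k - (k.+1 - l)) = k.-1)%N].
Proof. lia. Qed.

Lemma dbl_sqr_le (u : R) : 0 <= u <= 2^-1 -> u ^+ 2 *+ 2 <= u.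
Proof. nra. Qed.

Lemma dbl_sqr_le_mul (u x y : R) : 0 <= u -> u <= x -> u <= y ->
  u ^+ 2 *+ 2 <= x * y * 2.
Proof.
move=> u0 ux uy; rewrite -mulr_natr ler_wpM2r// expr2.
exact: ler_pM.
Qed.

Lemma norm_le_of_bounds (l u v b e : R) :
  - u - v <= l <= - u -> 0 <= u -> v <= u -> u <= 2 * b -> 0 <= e <= b ->
  `|l + e| <= 5 * b.
Proof. by move=> ? ? ? ? ?; rewrite ler_norml; apply/andP; split; lra. Qed.

Lemma norm_add_bounds (l u v w : R) : - u - v <= l <= - u -> 0 <= w -> v <= w ->
  `|l + u| <= w.
Proof. by move=> ? ? ?; rewrite ler_norml; apply/andP; split; lra. Qed.

Lemma norm_le_of_sums (l u v q e Y e1 e2 S T : R) :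
  - u - v <= l <= - u -> 0 <= u -> v <= u -> u <= q -> 0 <= e <= Y ->
  0 <= e1 -> 0 <= e2 -> 2 * q <= S -> Y <= T ->
  `|l + e| <= e1 + e2 + S + T.
Proof. by move=> ? ? ? ? ? ? ? ? ?; rewrite ler_norml; apply/andP; split; lra. Qed.

Lemma le_sum5 (a b x y z e : R) : 0 <= a -> 0 <= b -> 0 <= x -> 0 <= y -> 0 <= z ->
  e <= y + z -> e <= a + b + x + y + z.
Proof. lra. Qed.

Lemma err_total (C N X eps S1 S2 S3 S4 S5 : R) :
  0 <= X * eps -> 0 <= C * eps -> 0 <= C * N * eps ->
  S1 <= 5 * C * eps -> S2 <= 5 * C * N * eps + 10 * X * eps ->
  S3 <= 2 * X * eps -> S4 <= C * N * eps -> S5 <= C * eps ->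
  S1 + S2 + S3 + S4 + S5 <= (6 * C * (N + 1) + 12 * X) * eps.
Proof. lra. Qed.

Lemma ln1B_bounds (u : R) : 0 <= u <= 2^-1 -> - u - u ^+ 2 *+ 2 <= ln (1 - u) <= - u.
Proof.
move=> /andP[u0 u1]; apply/andP; split; last by apply: le_ln1Dx; lra.
have u2 : 0 < 1 - u by lra.
have -> : ln (1 - u) = - ln (1 + u / (1 - u)).
  by rewrite -lnV ?posrE ?ltr_wpDr ?divr_ge0 ?(ltW u2)//; congr ln; field; rewrite ?gt_eqF//; lra.
rewrite -opprD lerN2.
apply: le_trans (le_ln1Dx _) _; first by rewrite (lt_le_trans (ltrN10 R))// divr_ge0// ltW.
rewrite ler_pdivrMr//; nra.
Qed.

Lemma sum_indicator (I : finType) (P Q : pred I) (x : R) :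
  \sum_(i | P i) (if Q i then x else 0) = #|[set i | P i && Q i]|%:R * x.
Proof.
by rewrite -big_mkcondr/= mulr_natl -sumr_const; apply: eq_bigl => i; rewrite inE.
Qed.

Variables (V : finType) (E : {set {set V}}) (k : nat) (c p eps s : R).
Hypothesis k2 : (2 <= k)%N.
Hypothesis c0 : 0 < c.
Hypothesis tm : tame E k c p eps.
Hypothesis eps1 : eps <= 2^-1.
Hypothesis s01 : 0 <= s < 1.
Implicit Types (W A T f g : {set V}) (D : {set {set V}}).

Let d : R := (maxdeg E)%:R.
Let C : R := c ^+ k.-1.

Lemma tame_C0 : 0 < C. Proof. exact: exprn_gt0. Qed.

Lemma tame_p0 : 0 < p. Proof. by case: tm => _ /andP[]. Qed.

Lemma tame_p2 : p <= 2^-1.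
Proof. by case: tm => _ /andP[_ pe] *; exact: le_trans pe eps1. Qed.

Lemma tame_p01 : 0 < p < 1.
Proof. by rewrite tame_p0/= (le_lt_trans tame_p2)// invf_lt1 ?ltr1n. Qed.

Lemma tame_eps0 : 0 < eps.
Proof. by case: tm => _ /andP[pp pe] *; exact: lt_le_trans pe. Qed.

Lemma tame_d0 : 0 < d.
Proof.
rewrite ltNge; apply/negP => d0; have := tame_big tm; have := tame_eps0.
rewrite -/d; nra.
Qed.

Lemma tame_pk : C / 2 <= p ^+ k.-1 * d <= C *+ 2.
Proof.
have := tame_deg tm; rewrite -/d -/C ler_norml => /andP[h1 h2].
have C0 := tame_C0.
have -> : p ^+ k.-1 * d = C * (p ^+ k.-1 * d / C).
  by rewrite mulrCA divff ?mulr1 ?gt_eqF.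
have e2 := eps1; set x := p ^+ k.-1 * d / C in h1 h2 *.
by apply/andP; split; nra.
Qed.

Lemma pkd_le : p ^+ k.-1 <= C *+ 2 / d.
Proof. by rewrite ler_pdivlMr ?tame_d0//; case/andP: tame_pk. Qed.

Lemma card_powerset_bound A n : (#|A| <= n)%N -> (#|powerset A|%:R <= 2 ^+ n :> R).
Proof. by move=> An; rewrite card_powerset natrX ler_eXn2l ?ltr1n. Qed.

Lemma sum_codeg_bound A n (t : nat) : (2 <= t)%N -> (#|A| <= n)%N ->
  \sum_(T in powerset A | (t <= #|T| <= k.-1)%N) (maxdeg_l E #|T|)%:R * p ^+ (k - #|T|)
   <= 2 ^+ n * eps.
Proof.
move=> t2 An; apply: (@le_trans _ _ (\sum_(T in powerset A) eps)).
  rewrite [leRHS](bigID (fun T : {set V} => (t <= #|T| <= k.-1)%N))/=.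
  rewrite -[leLHS]addr0 lerD//; last by rewrite sumr_ge0// => *; rewrite ltW ?tame_eps0.
  apply: ler_sum => T /andP[_ /andP[tT Tk]].
  by apply: (tame_codeg tm); rewrite (leq_trans t2).
rewrite sumr_const -[leLHS]mulr_natl ler_wpM2r ?card_powerset_bound//.
exact: ltW tame_eps0.
Qed.

(** Multiply each codegree product by [p ^+ k.-1], split as [p ^+ (k - l) * p ^+ (l - 1)] with
    [l = #|T|]: both factors of the product then become at most [eps]. Dividing back uses
    [p ^+ k.-1 * d >= C / 2], and there are at most [2 ^+ n] sets [T]. *)
Lemma card_bad_bound A v n : v \in A -> (#|A| <= n)%N ->
  #|[set f in E | (f :&: A == [set v]) && bad E A f]|%:R
    <= eps * d * (n%:R + 2 ^+ n.+1 / C).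
Proof.
move=> vA An; have C0 := tame_C0; have d0 := tame_d0; have e0 := tame_eps0.
have p0 := tame_p0.
apply: (@le_trans _ _ (#|A|%:R * (Gamma E k)%:R +
   \sum_(T in powerset A | (2 <= #|T| <= k.-1)%N)
     (maxdeg_l E #|T|)%:R * (maxdeg_l E (k.+1 - #|T|))%:R)).
  under eq_bigr do rewrite -natrM.
  by rewrite -natr_sum -natrM -natrD ler_nat; exact: card_bad1 (tame_unif tm) _ _ vA.
rewrite mulrDr lerD//.
  rewrite [leRHS]mulrC; apply: ler_pM => //; first by rewrite ler_nat.
  exact: tame_Gamma tm.
apply: (@le_trans _ _ (\sum_(T in powerset A) (eps * (2 * d / C)))).
  rewrite [leRHS](bigID (fun T : {set V} => (2 <= #|T| <= k.-1)%N))/=.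
  rewrite -[leLHS]addr0 lerD//; last first.
    by rewrite sumr_ge0// => *; rewrite !mulr_ge0 ?invr_ge0 ?ltW.
  apply: ler_sum => T /andP[_ /andP[T2 Tk]].
  have h1 := tame_codeg tm (_ : (2 <= #|T| <= k.-1)%N).
  have h2 := tame_codeg tm (_ : (2 <= k.+1 - #|T| <= k.-1)%N).
  have {}h1 := h1 (introT andP (conj T2 Tk)).
  have [T3 Tk1] := codim_bounds (introT andP (conj T2 Tk)); have {}h2 := h2 T3.
  have pk0 : 0 < p ^+ k.-1 by rewrite exprn_gt0.
  rewrite -(ler_pM2r pk0).
  have -> : p ^+ k.-1 = p ^+ (k - #|T|) * p ^+ (k - (k.+1 - #|T|)).
    by rewrite -exprD Tk1.
  rewrite mulrACA.
  apply: (@le_trans _ _ (eps * eps)).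
    by apply: ler_pM; rewrite ?mulr_ge0 ?exprn_ge0 ?ler0n ?(ltW p0).
  rewrite -exprD Tk1.
  rewrite -[leRHS]mulrA ler_wpM2l ?(ltW e0)//.
  have /andP[hp _] := tame_pk.
  have -> : 2 * d / C * p ^+ k.-1 = (p ^+ k.-1 * d) * 2 / C by ring.
  rewrite ler_pdivlMr//; have e2 := eps1; nra.
rewrite sumr_const -[leLHS]mulr_natl.
apply: (@le_trans _ _ (2 ^+ n * (eps * (2 * d / C)))).
  by rewrite ler_wpM2r ?card_powerset_bound// !mulr_ge0 ?invr_ge0 ?ltW.
by apply: eq_ler; rewrite exprS; ring.
Qed.

(* In the recursion every edge removed from [E] meets [W], except for the one
   edge whose probability is being computed. *)
Definition almost_full W D : Prop :=
  D \subset E /\ (#|[set g in E | (g \notin D) && [disjoint g & W]]| <= 1)%N.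

(* The message from [f] to [v], rescaled by [(p / c)^(k-1)], compared in the
   square-root potential with the one computed from [y]. *)
Definition model_close (n : nat) (t : R) (y : V -> R) : Prop :=
  forall W D v f, (#|W| <= n)%N -> almost_full W D -> v \in W -> f \in E ->
    f :&: W = [set v] -> f \notin D -> ~~ bad E W f ->
    `|Num.sqrt ((c / p) ^+ k.-1 * (pf p s (W :|: f) D / pf p s W D)) -
      Num.sqrt (\prod_(u in f :\ v) y u)| <= t.

(** Sum of the five contributions bounded in [model_vertex_step], with [n] bounding the occupied
    set; the last [2] pays for the normalisation [1 - p + p * r]. *)
Definition step_err (n : nat) : R := 6 * C * n.+1%:R + 12 * 2 ^+ n + 2.

Lemma pf_ratio_bounds W D f :
  0 <= pf p s (W :|: f) D / pf p s W D <= p ^+ #|f :\: W|.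
Proof.
have p01 := tame_p01.
apply/andP; split; first by rewrite divr_ge0// ltW// pf_gt0.
rewrite ler_pdivrMr ?pf_gt0//.
have -> : W :|: f = W :|: (f :\: W).
  by apply/setP => u; rewrite !inE; case: (u \in W).
apply: pf_union_le => //.
by rewrite disjoints_subset; apply/subsetP => u; rewrite !inE => /andP[].
Qed.

(** Revealing the edges at [v] one by one gives [r], a product of factors [1 - s * P f]. For a
    typical edge [P f] is [(p / c) ^+ k.-1] times its message, and [(p / c) ^+ k.-1] is nearly
    [d^-1]; so [ln r] is nearly [- s / d] times the sum of the messages. *)
Lemma model_vertex_step n t y W D v :
  model_close n t y -> (forall u, 0 <= y u <= c) -> 0 <= t ->
  (#|v |: W| <= n)%N -> v \notin W -> almost_full W D ->
  (forall g, g \in D -> v \in g -> ~~ (g \subset v |: W)) ->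
  exists a : {set V} -> R,
    (forall f, f \in E -> v \in f -> 0 <= a f <= C /\
       `|Num.sqrt (a f) - Num.sqrt (\prod_(u in f :\ v) y u)| <= t) /\
    `|ln (pf p s (v |: W) D / pf p s W D / p)
      + s / d * \sum_(f in E | v \in f) a f| <= step_err n * eps.
Proof.
move=> IH y0 t0 An vW [DE Dfull] vgood.
set A := v |: W.
have p01 := tame_p01; have p0 := tame_p0; have p2 := tame_p2; have C0 := tame_C0.
have d0 := tame_d0; have e0 := tame_eps0; have e1 := eps1.
have [s0 s1] := andP s01.
have vA : v \in A by rewrite setU11.
pose D0 := [set f in D | v \notin f]; pose B := [set f in D | v \in f].
have eqD : D0 :|: B = D.
  by apply/setP => f; rewrite !inE; case: (f \in D); case: (v \in f).
have dBD : [disjoint B & D0].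
  by rewrite disjoints_subset; apply/subsetP => f; rewrite !inE => /andP[-> ->].
have [P [PP PE]] := pf_edge_chain p01 s01 A dBD.
rewrite eqD in PE.
set r := \prod_(f in B) (1 - s * P f) in PE.
have rE : pf p s A D / pf p s A D0 = r.
  by rewrite PE mulrC mulKf// gt_eqF// pf_gt0.
have ratE := pf_vertex_ratio p01 s01 D vW; rewrite -/D0 -/A rE in ratE.
have Pbd f : f \in B -> 0 <= P f <= p ^+ #|f :\: A|.
  by move=> /PP[D' [_ _ _ ->]]; exact: pf_ratio_bounds.
(* An edge inside [A] would have conditional probability [1], and the expansion of the logarithm
   would fail; [vgood] excludes it. *)
have Bcard f : f \in B -> (0 < #|f :\: A|)%N.
  rewrite inE => /andP[fD vf]; rewrite card_gt0 -subset0 subDset setU0.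
  exact: vgood.
have Pp f : f \in B -> P f <= p.
  move=> fB; have /andP[_ h] := Pbd f fB; apply: le_trans h _.
  by rewrite -[leRHS]expr1 ler_wiXn2l ?Bcard// ?ltW//; case/andP: p01.
have sPbd f : f \in B -> 0 <= s * P f <= 2^-1.
  move=> fB; have /andP[h _] := Pbd f fB; have h2 := Pp f fB; nra.
have r01 : 0 < r <= 1.
  rewrite /r; apply/andP; split.
    by apply: prodr_gt0 => f fB; have := sPbd f fB; lra.
  by apply: prodr_ile1 => f fB; have := sPbd f fB; lra.
have lnr : ln r = \sum_(f in B) ln (1 - s * P f).
  suff [] : 0 < r /\ ln r = \sum_(f in B) ln (1 - s * P f) by [].
  rewrite /r; elim/big_rec2: _ => [|f b a fB [a0 ab]].
    by rewrite ln1.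
  have h : 0 < 1 - s * P f by have := sPbd f fB; lra.
  by rewrite mulr_gt0// lnM ?posrE// ab.
pose Gd f := [&& f \in B, f :&: A == [set v] & ~~ bad E A f].
(* On exceptional edges [a] is the message of [y] itself: closeness is then free, and the
   discrepancy with the model is charged to [err]. *)
pose a f := if Gd f then (c / p) ^+ k.-1 * P f else \prod_(u in f :\ v) y u.
have cardf f : f \in E -> #|f| = k by exact: (tame_unif tm).
have card1 f : f \in E -> v \in f -> #|f :\ v| = k.-1.
  by move=> fE vf; rewrite cardsD (setIidPr _) ?sub1set// cards1 cardf// subn1.
have cardA f : f \in E -> f :&: A == [set v] -> #|f :\: A| = k.-1.
  by move=> fE /eqP fA; rewrite cardsD fA cards1 cardf// subn1.
have yC f : f \in E -> v \in f -> 0 <= \prod_(u in f :\ v) y u <= C.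
  move=> fE vf; rewrite prodr_ge0/=; last by move=> u _; case/andP: (y0 u).
  rewrite /C -(card1 f fE vf) -prodr_const.
  by apply: ler_prod => u _.
have aC f : f \in E -> v \in f -> 0 <= a f <= C.
  move=> fE vf; rewrite /a; case: ifPn => [/and3P[fB fA _]|_]; last exact: yC.
  have /andP[h1 h2] := Pbd f fB; rewrite (cardA f fE fA) in h2.
  apply/andP; split.
    by rewrite mulr_ge0// exprn_ge0// divr_ge0// ltW.
  rewrite expr_div_n -mulrA -/C ger_pMr//.
  by rewrite mulrC ler_pdivrMr ?exprn_gt0// mul1r.
exists a; split.
  move=> f fE vf; split; first exact: aC.
  rewrite /a; case: ifPn => [/and3P[fB fA fb]|_]; last by rewrite subrr normr0.
  have [D' [D0D' D'D fD' ->]] := PP f fB.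
  apply: IH => //; last exact/eqP.
  split; first by apply: subset_trans D'D _; rewrite eqD.
  (* The edges not yet put back all pass through [v], which lies in [A]; so an edge disjoint from
     [A] that is missing from [D'] was already missing from [D]. *)
  apply: leq_trans Dfull; apply/subset_leq_card/subsetP => g.
  rewrite !inE => /and3P[gE gD' gA]; rewrite gE/=.
  have vg : v \notin g.
    by move: gA; rewrite disjoint_sym disjoints_subset => /subsetP/(_ v vA); rewrite inE.
  apply/andP; split.
    apply: contra gD' => gD; apply: (subsetP D0D').
    by rewrite inE gD.
  by apply: disjointWr gA; exact: subsetUr.
have dV0 : 0 <= d^-1 by rewrite invr_ge0 ltW.
have pk0 : 0 < p ^+ k.-1 by rewrite exprn_gt0.
pose Bd := [set f in E | (f :&: A == [set v]) && bad E A f].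
(* Five deviations: at ordinary edges, the quadratic term of the logarithm and the mismatch between
   [p ^+ k.-1 * d] and [C]; bad edges; the probability of edges with a larger trace on [A]; the
   message of edges meeting [W], charged to a pair [[set v; w]]; the missing edge disjoint from
   [W]. *)
pose err f := 5 * C * eps / d + (if f \in Bd then 5 * C / d else 0)
  + (\sum_(T in powerset A | (2 <= #|T| <= k.-1)%N) (if T \subset f then 2 * p ^+ (k - #|T|) else 0))
  + (\sum_(w in W) (if [set v; w] \subset f then C / d else 0))
  + (if (f \notin D) && [disjoint f & W] then C / d else 0).
have term f : f \in E -> v \in f ->
    `|(if f \in D then ln (1 - s * P f) else 0) + s / d * a f| <= err f.
  move=> fE vf.
  have ha := aC f fE vf.
  have sdC : 0 <= s / d * a f <= C / d.
    have [a0 a1] := andP ha.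
    rewrite mulr_ge0 ?mulr_ge0//= mulrAC ler_wpM2r//.
    by rewrite (le_trans _ a1)// ler_piMl// ltW.
  have E1 : 0 <= 5 * C * eps / d by rewrite !mulr_ge0// ltW.
  have E2 : 0 <= (if f \in Bd then 5 * C / d else 0).
    by case: ifP => // _; rewrite !mulr_ge0// ltW.
  have E3 : 0 <= \sum_(T in powerset A | (2 <= #|T| <= k.-1)%N) (if T \subset f then 2 * p ^+ (k - #|T|) else 0).
    by rewrite sumr_ge0// => T _; case: ifP => // _; rewrite mulr_ge0// exprn_ge0// ltW.
  have E4 : 0 <= \sum_(w in W) (if [set v; w] \subset f then C / d else 0).
    by rewrite sumr_ge0// => w _; case: ifP => // _; rewrite mulr_ge0// ltW.
  have E5 : 0 <= (if (f \notin D) && [disjoint f & W] then C / d else 0).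
    by case: ifP => // _; rewrite mulr_ge0// ltW.
  have touch : ~~ [disjoint f & W] ->
      C / d <= \sum_(w in W) (if [set v; w] \subset f then C / d else 0).
    rewrite -setI_eq0 => /set0Pn[w]; rewrite inE => /andP[wf wW].
    rewrite (bigD1 w)//= subUset !sub1set vf wf/= lerDl.
    by rewrite sumr_ge0// => w' _; case: ifP => // _; rewrite mulr_ge0// ltW.
  rewrite /err.
  case: (boolP (f \in D)) => fD; last first.
    rewrite add0r ger0_norm; last by case/andP: sdC.
    have [_ h] := andP sdC.
    apply: le_sum5 => //; first by case: ifP => // _; rewrite mulr_ge0// ltW.
    apply: (le_trans h).
    case: (boolP [disjoint f & W]) => fW; first by rewrite lerDr.
    by rewrite addr0 touch.
  rewrite /= addr0.
  have fB : f \in B by rewrite inE fD.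
  have := ln1B_bounds (sPbd f fB); have := sPbd f fB; have [P0 P1] := andP (Pbd f fB).
  have Pp' := Pp f fB.
  have sPP : s * P f <= P f by rewrite ler_piMl// ltW.
  have fA_v : v \in f :&: A by rewrite inE vf.
  case: (boolP (f :&: A == [set v])) => fA.
    have P1' := P1; rewrite (cardA f fE fA) in P1'.
    have := pkd_le; have pkp : p ^+ k.-1 <= eps.
      apply: le_trans (_ : p <= _); last by case: tm => _ /andP[].
      rewrite -[leRHS]expr1; apply: ler_wiXn2l; first exact: ltW.
        by case/andP: p01 => _ /ltW.
      by rewrite -ltnS prednK ?(ltnW k2).
    case: (boolP (bad E A f)) => fb.
      have fBd : f \in Bd by rewrite inE fE fA fb.
      move: E1 E3 E4; rewrite fBd.
      have -> : 5 * C / d = 5 * (C / d) by rewrite mulrA.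
      have -> : C *+ 2 / d = 2 * (C / d) by ring.
      move: sdC; set X := s / d * a f; set Y := C / d => sdC E1' E3' E4' hpk hsP hln.
      have hsP2 : s * P f <= 2 * Y by apply: le_trans hpk; exact: le_trans P1'.
      have := norm_le_of_bounds hln (proj1 (andP hsP)) (dbl_sqr_le hsP) hsP2 sdC.
      move=> h; apply: (le_trans h).
      by rewrite [5 * C * eps / d + _]addrC -!addrA lerDl !addr_ge0.
    have aE : a f = (c / p) ^+ k.-1 * P f by rewrite /a /Gd fB fA fb.
    move=> hpk hsP hln.
    have : `|ln (1 - s * P f) + s / d * a f| <= 5 * C * eps / d; last first.
      by move=> h; apply: (le_trans h); rewrite -!addrA lerDl !addr_ge0.
    have hsq : (s * P f) ^+ 2 *+ 2 <= 4 * C * eps / d.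
      have h1 : s * P f <= eps by apply: (le_trans sPP); exact: le_trans pkp.
      have h2 : s * P f <= C *+ 2 / d by apply: (le_trans sPP); exact: le_trans hpk.
      have -> : 4 * C * eps / d = (C *+ 2 / d) * eps * 2 by ring.
      by apply: dbl_sqr_le_mul => //; case/andP: hsP.
    have hlin : `|s / d * a f - s * P f| <= C * eps / d.
      have -> : s / d * a f - s * P f = (1 - p ^+ k.-1 * d / C) * (s / d * a f).
        rewrite aE /C exprMn exprVn; field.
        by rewrite !gt_eqF// exprn_gt0.
      rewrite normrM distrC.
      have -> : C * eps / d = eps * (C / d) by ring.
      apply: ler_pM => //; first exact: tame_deg tm.
      by rewrite ger0_norm; case/andP: sdC.
    have -> : ln (1 - s * P f) + s / d * a f =
      (ln (1 - s * P f) + s * P f) + (s / d * a f - s * P f) by ring.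
    apply: le_trans (ler_normD _ _) _.
    have : `|ln (1 - s * P f) + s * P f| <= 4 * C * eps / d.
      apply: norm_add_bounds hln _ hsq.
      by rewrite !mulr_ge0 ?(ltW C0) ?(ltW e0).
    have -> : 5 * C * eps / d = 4 * C * eps / d + C * eps / d by ring.
    by move=> h1; rewrite lerD.
  have fW : ~~ [disjoint f & W].
    apply: contra fA => fW; rewrite eqEsubset sub1set fA_v andbT.
    apply/subsetP => u; rewrite !inE => /andP[uf /orP[//|uW]].
    by move: fW; rewrite disjoints_subset => /subsetP/(_ u uf); rewrite inE uW.
  have h4 := touch fW.
  have h3 : 2 * p ^+ #|f :\: A| <=
     \sum_(T in powerset A | (2 <= #|T| <= k.-1)%N) (if T \subset f then 2 * p ^+ (k - #|T|) else 0).
    have cT : (2 <= #|f :&: A| <= k.-1)%N.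
      apply/andP; split.
        rewrite ltn_neqAle card_gt0; apply/andP; split; last by apply/set0Pn; exists v.
        apply: contra fA => /eqP/esym/eqP/cards1P[w fAw].
        by move: fA_v; rewrite fAw inE => /eqP ->.
      rewrite -ltnS prednK ?(ltnW k2)// -(cardf f fE) -(cardsID A f) -addn1 leq_add2l.
      exact: Bcard.
    rewrite (bigD1 (f :&: A))/=; last by rewrite powersetE subsetIr.
    rewrite subsetIl -(cardf f fE) cardsD lerDl.
    by rewrite sumr_ge0// => w' _; case: ifP => // _; rewrite mulr_ge0// exprn_ge0// ltW.
  move=> hsP hln.
  have hsP2 : s * P f <= p ^+ #|f :\: A| by exact: le_trans P1.
  have hsq := dbl_sqr_le hsP.
  apply: norm_le_of_sums hln _ hsq hsP2 sdC E1 E2 h3 h4.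
  by case/andP: hsP.
have lnsum : `|ln r + s / d * \sum_(f in E | v \in f) a f| <= \sum_(f in E | v \in f) err f.
  have -> : ln r = \sum_(f in E | v \in f) (if f \in D then ln (1 - s * P f) else 0).
    rewrite -big_mkcondr lnr; apply: eq_bigl => f; rewrite inE.
    by case: (boolP (f \in D)) => fD; rewrite ?andbF// (subsetP DE f fD) andbT.
  rewrite mulr_sumr -big_split/=; apply: le_trans (ler_norm_sum _ _ _) _.
  by apply: ler_sum => f /andP[fE vf]; exact: term.
have degv : #|[set f in E | v \in f]|%:R <= d by rewrite ler_nat hdeg1_le.
have n0 : (0 < n)%N by apply: leq_trans An; rewrite card_gt0; apply/set0Pn; exists v.
have An' : (#|A| <= n)%N by [].
have Wn : (#|W| <= n)%N by apply: leq_trans An; apply/subset_leq_card/subsetUr.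
have sumerr : \sum_(f in E | v \in f) err f <= (6 * C * n.+1%:R + 12 * 2 ^+ n) * eps.
  rewrite /err !big_split/=.
  have S1 : \sum_(f in E | v \in f) 5 * C * eps / d <= 5 * C * eps.
    rewrite sumr_const -[leLHS]mulr_natl.
    apply: (@le_trans _ _ (d * (5 * C * eps / d))); last first.
      by rewrite mulrCA divff ?mulr1// gt_eqF.
    rewrite ler_wpM2r ?(le_trans _ degv) ?mulr_ge0 ?(ltW C0) ?(ltW e0)//.
    by rewrite ler_nat; apply/eq_leq/eq_card => f; rewrite inE.
  have S2 : \sum_(f in E | v \in f) (if f \in Bd then 5 * C / d else 0)
      <= 5 * C * n%:R * eps + 10 * 2 ^+ n * eps.
    rewrite sum_indicator.
    apply: (@le_trans _ _ ((eps * d * (n%:R + 2 ^+ n.+1 / C)) * (5 * C / d))).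
      rewrite ler_wpM2r ?mulr_ge0 ?(ltW C0)//.
      apply: le_trans (card_bad_bound vA An').
      by rewrite ler_nat; apply/subset_leq_card/subsetP => f; rewrite !inE => /andP[].
    by apply: eq_ler; rewrite exprS; field; rewrite !gt_eqF.
  have S3 : \sum_(f in E | v \in f) \sum_(T in powerset A | (2 <= #|T| <= k.-1)%N)
       (if T \subset f then 2 * p ^+ (k - #|T|) else 0) <= 2 * 2 ^+ n * eps.
    rewrite exchange_big/=.
    apply: (@le_trans _ _ (2 * \sum_(T in powerset A | (2 <= #|T| <= k.-1)%N)
          (maxdeg_l E #|T|)%:R * p ^+ (k - #|T|))); last first.
      by rewrite -mulrA ler_wpM2l// sum_codeg_bound.
    rewrite mulr_sumr; apply: ler_sum => T _; rewrite sum_indicator mulrCA.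
    rewrite ler_wpM2l// ler_wpM2r ?exprn_ge0 ?(ltW p0)// ler_nat.
    apply: leq_trans (hdeg_le _ _); apply/subset_leq_card/subsetP => f.
    by rewrite !inE => /andP[/andP[-> _] ->].
  have S4 : \sum_(f in E | v \in f) \sum_(w in W) (if [set v; w] \subset f then C / d else 0)
      <= C * n%:R * eps.
    rewrite exchange_big/=.
    apply: (@le_trans _ _ (\sum_(w in W) (eps * d) * (C / d))).
      apply: ler_sum => w wW; rewrite sum_indicator ler_wpM2r ?mulr_ge0 ?(ltW C0)//.
      apply: le_trans (tame_two tm); rewrite ler_nat.
      have -> : 2%N = #|[set v; w]|.
        by rewrite cards2; case: eqP => // vw; rewrite vw wW in vW.
      apply: leq_trans (hdeg_le _ _); apply/subset_leq_card/subsetP => f.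
      by rewrite !inE => /andP[/andP[-> _] ->].
    rewrite sumr_const -[leLHS]mulr_natl.
    have -> : eps * d * (C / d) = C * eps by field; rewrite gt_eqF.
    rewrite [C * n%:R]mulrC -mulrA ler_wpM2r ?ler_nat// mulr_ge0 ?ltW//.
  have S5 : \sum_(f in E | v \in f) (if (f \notin D) && [disjoint f & W] then C / d else 0)
      <= C * eps.
    rewrite sum_indicator; apply: (@le_trans _ _ (1 * (C / d))).
      rewrite ler_wpM2r ?mulr_ge0 ?(ltW C0)// lern1.
      apply: leq_trans Dfull; apply/subset_leq_card/subsetP => f.
      by rewrite !inE => /andP[/andP[-> _] ->].
    rewrite mul1r ler_pdivrMr// -mulrA ler_peMr ?(ltW C0)//.
    exact: tame_big tm.
  rewrite -[n.+1%:R]natr1.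
  apply: err_total S1 S2 S3 S4 S5.
  - by rewrite mulr_ge0 ?exprn_ge0 ?ler0n ?(ltW e0).
  - by rewrite mulr_ge0 ?(ltW C0) ?(ltW e0).
  - by rewrite !mulr_ge0 ?ler0n ?(ltW C0) ?(ltW e0).
have q1 : 0 < 1 - p + p * r <= 1 by nra.
have ratE' : pf p s A D / pf p s W D / p = r / (1 - p + p * r).
  by rewrite ratE; field; rewrite !gt_eqF//; case/andP: q1.
rewrite ratE' ln_div ?posrE; [|by case/andP: r01|by case/andP: q1].
(* The normalisation lies between [1 - p] and [1], so its logarithm is only of order [eps]. *)
have lnq : - (2 * eps) <= ln (1 - p + p * r) <= 0.
  rewrite ln_le0; last by case/andP: q1.
  rewrite andbT.
  have hp : 0 <= p <= 2^-1 by rewrite (ltW p0).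
  have := ln1B_bounds hp => /andP[h1 _].
  have : ln (1 - p) <= ln (1 - p + p * r).
    by rewrite ler_ln ?posrE; nra.
  have : p <= eps by case: tm => _ /andP[].
  by nra.
rewrite addrAC; apply: le_trans (ler_normB _ _) _.
rewrite /step_err [leRHS]mulrDl lerD//; first exact: le_trans sumerr.
by rewrite ler_norml; apply/andP; split; lra.
Qed.

End Recursion.

(** * Iterates of the fixed-point map *)

Section FmapFacts.
Import mathcomp.boot.finset mathcomp.boot.fintype.
Variables (R : realType) (V : finType) (E : {set {set V}}) (c s : R).
Hypothesis c0 : 0 < c.

Lemma ln_Fmap (y : V -> R) v : ln (Fmap E c s y v / c) =
  - (s / (maxdeg E)%:R * \sum_(e in E | v \in e) \prod_(u in e :\ v) y u).
Proof. by rewrite /Fmap mulrC mulKf ?gt_eqF// expRK mulNr. Qed.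

Lemma Fmap_bounds (y : V -> R) v : 0 <= s -> (forall u, 0 <= y u) ->
  0 < Fmap E c s y v <= c.
Proof.
move=> s0 y0; rewrite /Fmap mulr_gt0 ?expR_gt0//= ger_pMr// expR_le1 mulNr oppr_le0.
rewrite mulr_ge0 ?divr_ge0// sumr_ge0// => e _; exact: prodr_ge0.
Qed.

(** Stand-in for the fixed point at every tilt [s]. The start [c] is the top of the box, so its
    messages equal [C], which also bounds the rescaled model messages from above. *)
Definition Fiter m : V -> R := iter m (Fmap E c s) (fun _ => c).

Lemma Fiter_bounds m v : 0 <= s -> 0 < Fiter m v <= c.
Proof.
move=> s0; elim: m v => [|m IH] v; first by rewrite /= c0 lexx.
by apply: Fmap_bounds => // u; case/andP: (IH u) => /ltW.
Qed.

End FmapFacts.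

(** * Induction on the depth of the recursion *)

Section Induction.
Import mathcomp.boot.finset mathcomp.boot.fintype.
Variable R : realType.
Variables (V : finType) (E : {set {set V}}) (k : nat) (c p eps s rho : R).
Hypothesis k2 : (2 <= k)%N.
Hypothesis c0 : 0 < c.
Hypothesis tm : tame E k c p eps.
Hypothesis eps1 : eps <= 2^-1.
Hypothesis s01 : 0 <= s < 1.
Hypothesis rho01 : 0 <= rho < 1.
Hypothesis hrho : s * (k.-1)%:R * c ^+ k.-1 <= rho ^+ 2 * expR 1.
Implicit Types (W A T e f g : {set V}) (D : {set {set V}}).

Let d : R := (maxdeg E)%:R.
Let C : R := c ^+ k.-1.
Notation model_close := (model_close E k c p s).
Notation step_err := (step_err k c).
Notation Fiter := (Fiter E c s).

Lemma step_err_ge0 n : 0 <= step_err n.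
Proof. by rewrite /step_err !addr_ge0 ?mulr_ge0 ?exprn_ge0 ?ler0n ?(ltW c0). Qed.

Lemma step_err_le n m : (n <= m)%N -> step_err n <= step_err m.
Proof.
move=> nm; rewrite /step_err lerD2r lerD//; last by rewrite ler_wpM2l// ler_eXn2l ?ltr1n.
by rewrite ler_wpM2l ?ler_nat// mulr_ge0// exprn_ge0// ltW.
Qed.

(** The vertices of [e] are revealed one at a time and [model_vertex_step] is applied to each. Its
    condition on edges inside the occupied set holds because such an edge, inside [W :|: f] but not
    inside [W], would make [f] bad, and it is not [f] since [f \notin D]. Allowing any [e \subset f]
    serves both [f :\ v] in the recursion and [f] in [model_edge]. *)
Lemma model_chain n t y W D e f :
  model_close n t y -> (forall u, 0 <= y u <= c) -> 0 <= t ->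
  (#|W| + k <= n)%N -> almost_full E W D -> f \in E -> f \notin D -> ~~ bad E W f ->
  e \subset f -> [disjoint e & W] ->
  exists (x : V -> R) (a : V -> {set V} -> R),
    [/\ forall u, u \in e -> 0 < x u <= p,
        forall u g, u \in e -> g \in E -> u \in g -> 0 <= a u g <= C /\
          `|Num.sqrt (a u g) - Num.sqrt (\prod_(w in g :\ u) y w)| <= t,
        forall u, u \in e ->
          `|ln (x u / p) + s / d * \sum_(g in E | u \in g) a u g| <= step_err n * eps
      & pf p s (W :|: e) D / pf p s W D = \prod_(u in e) x u].
Proof.
move=> IH y0 t0 Wn Dfull fE fD fb ef eW.
have p01 := tame_p01 tm eps1.
have [DE miss] := Dfull.
have [x [xP xE]] := pf_vertex_chain p01 s01 D eW.
have xW u : u \in e -> exists W', [/\ W \subset W', u \notin W', W' \subset W :|: f,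
    (#|u |: W'| <= n)%N & x u = pf p s (u |: W') D / pf p s W' D].
  move=> ue; have [W' [WW' W'e uW' xu]] := xP u ue.
  have W'f : W' \subset W :|: f by apply: subset_trans W'e (setUS _ ef).
  exists W'; split=> //; apply: leq_trans Wn.
  rewrite -(tame_unif tm fE); apply: leq_trans (leq_card_setU _ _).
  by apply: subset_leq_card; rewrite subUset W'f sub1set inE (subsetP ef u ue) orbT.
have step u : exists a : {set V} -> R, u \in e ->
    (forall g, g \in E -> u \in g -> 0 <= a g <= C /\
       `|Num.sqrt (a g) - Num.sqrt (\prod_(w in g :\ u) y w)| <= t) /\
    `|ln (x u / p) + s / d * \sum_(g in E | u \in g) a g| <= step_err n * eps.
  case: (boolP (u \in e)) => ue; last by exists (fun=> 0).
  have [W' [WW' uW' W'f W'n xu]] := xW u ue.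
  have full' : almost_full E W' D.
    split=> //; apply: leq_trans miss; apply/subset_leq_card/subsetP => g.
    rewrite !inE => /and3P[-> -> gW'] /=.
    by apply: disjointWr gW'; exact: WW'.
  have [|a [aP aE]] := model_vertex_step k2 c0 tm eps1 s01 IH y0 t0 W'n uW' full'.
    move=> g gD ug; apply: contra fb => guW'.
    apply/exists_inP; exists g; first exact: (subsetP DE).
    apply/and3P; split.
    - by apply: contra fD => /eqP <-.
    - apply: subset_trans guW' _; rewrite subUset W'f sub1set inE.
      by rewrite (subsetP ef u ue) orbT.
    - by apply: contra uW' => /subsetP/(_ u ug)/(subsetP WW').
  by exists a => _; rewrite xu.
have [a aP] := boolp.choice step.
exists x, a; split.
- move=> u ue; have [W' [_ uW' _ _ ->]] := xW u ue.
  rewrite divr_gt0 ?pf_gt0//= ler_pdivrMr ?pf_gt0//; exact: pf_vertex_le.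
- by move=> u g ue gE ug; have [h _] := aP u ue; exact: h.
- by move=> u ue; have [] := aP u ue.
- by rewrite xE mulrC mulKf// gt_eqF// pf_gt0.
Qed.

(** Revealing an edge enlarges the occupied set by at most [k], so the estimate for sets of size [n]
    consumes the one for [n + k]. The messages of [Fmap E c s y] satisfy the recursion exactly; only
    the model side has an error. *)
Lemma model_close_step n t y :
  model_close (n + k) t y -> (forall u, 0 <= y u <= c) -> 0 <= t ->
  model_close n (rho * t + Num.sqrt C * (k.-1)%:R * (step_err (n + k) * eps) / 2)
    (Fmap E c s y).
Proof.
move=> IH y0 t0 W D v f Wn Dfull vW fE fW fD fb.
have p0 := tame_p0 tm; have C0 := tame_C0 k c0.
have vf : v \in f by have := set11 v; rewrite -fW inE => /andP[].
have cf : #|f :\ v| = k.-1.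
  by rewrite cardsD (setIidPr _) ?sub1set// cards1 (tame_unif tm fE) subn1.
have dfW : [disjoint f :\ v & W].
  rewrite disjoints_subset; apply/subsetP => u; rewrite !inE => /andP[uv uf].
  apply: contra uv => uW; have : u \in f :&: W by rewrite inE uf.
  by rewrite fW inE.
have Wk : (#|W| + k <= n + k)%N by rewrite leq_add2r.
have [x [a [x0 aP xa xE]]] := model_chain IH y0 t0 Wk Dfull fE fD fb (subD1set f v) dfW.
have -> : W :|: f = W :|: (f :\ v).
  by apply/setP => u; rewrite !inE; case: eqP => // ->; rewrite vW.
rewrite xE.
have -> : (c / p) ^+ k.-1 * \prod_(u in f :\ v) x u = \prod_(u in f :\ v) (c / p * x u).
  by rewrite -cf -prodr_const -big_split.
rewrite -cf.
have e1 : step_err (n + k) * eps = step_err (n + k) * eps + 0 by rewrite addr0.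
rewrite e1 /C -cf.
have [r0 r1] := andP rho01; have [s0 s1] := andP s01.
apply: (@message_contraction _ _ E (f :\ v) c s rho d _ _ _ _ _ a
   (fun u g => \prod_(w in g :\ u) y w)) => //.
- exact: tame_d0 tm.
- by rewrite cf.
- by move=> u _; rewrite ler_nat; exact: hdeg1_le.
- move=> u ue; have /andP[xu xp] := x0 u ue.
  rewrite mulr_gt0 ?divr_gt0//= -mulrA ger_pMr// mulrC ler_pdivrMr//.
  by rewrite mul1r.
- by move=> u _; apply: Fmap_bounds => // w; case/andP: (y0 w).
- by move=> u g ue gE ug; have [/andP[]] := aP u g ue gE ug.
- by move=> u g ue gE ug; apply: prodr_ge0 => w _; case/andP: (y0 w).
- by move=> u g ue gE ug; have [_] := aP u g ue gE ug.
- move=> u ue; rewrite (_ : c / p * x u / c = x u / p); first exact: xa.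
  by field; rewrite !gt_eqF.
- by move=> u ue; rewrite ln_Fmap// addNr normr0.
Qed.

(* The bound reached after [m] steps of the recursion [t |-> rho * t + error],
   started from [sqrt C]. *)
Definition depth_err N m : R := rho ^+ m * Num.sqrt C +
  Num.sqrt C * (k.-1)%:R * (step_err N * eps) / 2 / (1 - rho).

Lemma depth_err_ge0 N m : 0 <= depth_err N m.
Proof.
have [r0 r1] := andP rho01; have e0 := tame_eps0 tm.
by rewrite /depth_err addr_ge0 ?mulr_ge0 ?exprn_ge0 ?sqrtr_ge0 ?ler0n ?step_err_ge0
  ?invr_ge0 ?subr_ge0 ?(ltW r1) ?(ltW e0).
Qed.

(** At depth [0] both messages lie in [[0, C]], so their roots differ by at most [Num.sqrt C]. Each
    further level consumes [k] of the [N] vertices allowed. *)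
Lemma model_close_iter N m n : (n + m * k <= N)%N ->
  model_close n (depth_err N m) (Fiter m).
Proof.
have [r0 r1] := andP rho01; have [s0 s1] := andP s01; have e0 := tame_eps0 tm.
have C0 := tame_C0 k c0.
elim: m n => [|m IH] n nN.
  move=> W D v f Wn Dfull vW fE fW fD fb.
  have vf : v \in f by have := set11 v; rewrite -fW inE => /andP[].
  have cf : #|f :\ v| = k.-1.
    by rewrite cardsD (setIidPr _) ?sub1set// cards1 (tame_unif tm fE) subn1.
  have -> : \prod_(u in f :\ v) Fiter 0 u = C by rewrite /= prodr_const cf.
  have /andP[q0 q1] := pf_ratio_bounds tm eps1 s01 W D f.
  rewrite cardsD fW cards1 (tame_unif tm fE) subn1 in q1.
  set z := _ * (_ / _); have z0 : 0 <= z.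
    by rewrite /z mulr_ge0// exprn_ge0// divr_ge0 ?ltW// (tame_p0 tm).
  have zC : z <= C.
    rewrite /z expr_div_n -mulrA -/C ger_pMr// mulrC ler_pdivrMr ?mul1r//.
    by rewrite exprn_gt0// (tame_p0 tm).
  rewrite distrC ger0_norm ?subr_ge0 ?ler_wsqrtr//.
  rewrite (@le_trans _ _ (Num.sqrt C)) ?gerBl ?sqrtr_ge0//.
  rewrite /depth_err expr0 mul1r lerDl.
  by rewrite ?mulr_ge0 ?exprn_ge0 ?sqrtr_ge0 ?ler0n ?step_err_ge0
    ?invr_ge0 ?subr_ge0 ?(ltW r1) ?(ltW e0).
have /IH h : (n + k + m * k <= N)%N by rewrite -addnA -mulSn.
have yb u : 0 <= Fiter m u <= c.
  by have /andP[/ltW-> ->] := Fiter_bounds E c0 m u s0.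
have {}h := model_close_step h yb (depth_err_ge0 N m).
move=> W D v f Wn Dfull vW fE fW fD fb; apply: le_trans (h W D v f Wn Dfull vW fE fW fD fb) _.
set K := Num.sqrt C * (k.-1)%:R * (step_err (n + k) * eps) / 2.
set K' := Num.sqrt C * (k.-1)%:R * (step_err N * eps) / 2.
have KK' : K <= K'.
  rewrite /K /K' ler_wpM2r// ler_wpM2l ?mulr_ge0 ?sqrtr_ge0//.
  rewrite ler_wpM2r ?(ltW e0)// step_err_le//.
  by apply: leq_trans nN; rewrite mulSn addnA leq_addr.
rewrite /depth_err -/K' exprS.
have -> : rho * (rho ^+ m * Num.sqrt C + K' / (1 - rho)) =
   rho * rho ^+ m * Num.sqrt C + K' / (1 - rho) - K'.
  by field; rewrite subr_eq0 eq_sym lt_eqF.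
lra.
Qed.

(** A distance [t] between roots of messages in [[0, C]] becomes [2 * Num.sqrt C * t] between the
    messages, and this survives summation over at most [d] edges with weight [s / d]. *)
Definition marginal_err N m : R := step_err N * eps + 2 * Num.sqrt C * depth_err N m.

Lemma model_marginals N m W D e f :
  (#|W| + k + m * k <= N)%N -> almost_full E W D -> f \in E -> f \notin D ->
  ~~ bad E W f -> e \subset f -> [disjoint e & W] ->
  exists x : V -> R,
    [/\ forall u, u \in e -> 0 < x u <= p,
        forall u, u \in e -> `|ln (x u / p) - ln (Fiter m.+1 u / c)| <= marginal_err N m
      & pf p s (W :|: e) D / pf p s W D = \prod_(u in e) x u].
Proof.
move=> WN Dfull fE fD fb ef eW.
have [s0 s1] := andP s01; have e0 := tame_eps0 tm; have C0 := tame_C0 k c0.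
have yb u : 0 <= Fiter m u <= c.
  by have /andP[/ltW-> ->] := Fiter_bounds E c0 m u s0.
have d0 : 0 < d by exact: tame_d0 tm.
have close := model_close_iter WN.
have [x [a [x0 aP xa xE]]] :=
  model_chain close yb (depth_err_ge0 N m) (leqnn _) Dfull fE fD fb ef eW.
exists x; split=> // u ue.
rewrite /= ln_Fmap// opprK.
set b := fun g => \prod_(w in g :\ u) Fiter m w.
have -> : ln (x u / p) + s / (maxdeg E)%:R * \sum_(g in E | u \in g) b g =
  (ln (x u / p) + s / d * \sum_(g in E | u \in g) a u g) -
  s / d * \sum_(g in E | u \in g) (a u g - b g) by rewrite sumrB /d; ring.
apply: le_trans (ler_normB _ _) _; apply: lerD.
  apply: le_trans (xa u ue) _; rewrite ler_wpM2r ?(ltW e0)// step_err_le//.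
  by apply: leq_trans WN; rewrite leq_addr.
rewrite normrM ger0_norm ?divr_ge0 ?(ltW d0)//.
set t := depth_err N m in aP *.
have t0 : 0 <= t by exact: depth_err_ge0.
have hb g : g \in E -> u \in g -> `|a u g - b g| <= 2 * Num.sqrt C * t.
  move=> gE ug; have [/andP[a0 aC] h] := aP u g ue gE ug.
  have b0 : 0 <= b g by apply: prodr_ge0 => w _; case/andP: (yb w).
  have bC : b g <= C.
    rewrite /C -(_ : #|g :\ u| = k.-1); last first.
      by rewrite cardsD (setIidPr _) ?sub1set// cards1 (tame_unif tm gE) subn1.
    by rewrite -prodr_const; apply: ler_prod => w _.
  rewrite -(sqr_sqrtr a0) -(sqr_sqrtr b0) subr_sqr normrM [leRHS]mulrC.
  apply: ler_pM => //.
  rewrite ger0_norm ?addr_ge0 ?sqrtr_ge0// mulr_natl mulr2n.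
  by rewrite lerD ?ler_wsqrtr.
apply: (@le_trans _ _ (s / d * (d * (2 * Num.sqrt C * t)))).
  rewrite ler_wpM2l ?divr_ge0 ?(ltW d0)//.
  apply: le_trans (ler_norm_sum _ _ _) _.
  apply: (@le_trans _ _ (\sum_(g in E | u \in g) 2 * Num.sqrt C * t)).
    by apply: ler_sum => g /andP[]; exact: hb.
  rewrite sumr_const -[leLHS]mulr_natl ler_wpM2r ?mulr_ge0 ?sqrtr_ge0//.
  rewrite ler_nat; apply: leq_trans (hdeg1_le E u).
  by apply/eq_leq/eq_card => g; rewrite inE.
rewrite mulrA divfK ?gt_eqF// ler_piMl ?mulr_ge0 ?sqrtr_ge0//; exact: ltW.
Qed.

Lemma expR_lip_nonpos (a b : R) : a <= 0 -> b <= 0 -> `|expR a - expR b| <= `|a - b|.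
Proof.
move=> a0 b0; have := @expRN_lip R (- a) (- b); rewrite !opprK !oppr_ge0.
by move=> /(_ a0 b0) h; apply: (le_trans h); rewrite -normrN opprD opprK.
Qed.

(** [f] is taken out of the edge set, the one missing edge that [almost_full] tolerates, so that its
    own penalty does not enter. *)
Lemma model_edge N m W f :
  (#|W| + k + m * k <= N)%N -> f \in E -> [disjoint f & W] -> ~~ bad E W f ->
  `|pf p s (W :|: f) (E :\ f) / pf p s W (E :\ f) / p ^+ k -
    \prod_(u in f) Fiter m.+1 u / c ^+ k| <= k%:R * marginal_err N m.
Proof.
move=> WN fE fW fb; have [s0 s1] := andP s01; have p0 := tame_p0 tm.
have full : almost_full E W (E :\ f).
  split; first exact: subsetDl.
  rewrite -(cards1 f); apply/subset_leq_card/subsetP => g.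
  by rewrite !inE negb_and negbK => /and3P[gE /orP[->|/negP]].
have fn : f \notin E :\ f by rewrite !inE eqxx.
have [x [x0 xy ->]] := model_marginals WN full fE fn fb (subxx f) fW.
have prodE (z : V -> R) (q : R) : 0 < q -> (forall u, u \in f -> 0 < z u <= q) ->
    \prod_(u in f) z u / q ^+ k = expR (\sum_(u in f) ln (z u / q)) /\
    \sum_(u in f) ln (z u / q) <= 0.
  move=> q0 zq; split.
    rewrite expR_sum -(tame_unif tm fE) -exprVn -prodr_const -big_split/=.
    apply: eq_bigr => u uf; have /andP[z0 _] := zq u uf.
    by rewrite lnK// posrE divr_gt0.
  rewrite sumr_le0// => u uf; have /andP[z0 zle] := zq u uf.
  by rewrite ln_le0// ler_pdivrMr// mul1r.
have [-> sx] := prodE x p p0 x0.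
have [-> sy] := prodE (Fiter m.+1) c c0 (fun u _ => Fiter_bounds E c0 m.+1 u s0).
apply: le_trans (expR_lip_nonpos sx sy) _.
rewrite -sumrB; apply: le_trans (ler_norm_sum _ _ _) _.
apply: le_trans (ler_sum _ xy) _.
by rewrite sumr_const (tame_unif tm fE) mulr_natl.
Qed.

End Induction.

(** * Stability of the fixed point and of the Bethe free energy *)

Section Deterministic.
Import mathcomp.boot.finset mathcomp.boot.fintype.
Variable R : realType.

Lemma prod_dist (I : finType) (e : {set I}) (M t : R) (x y : I -> R) : 1 <= M -> 0 <= t ->
  (forall u, 0 <= x u <= M) -> (forall u, 0 <= y u <= M) ->
  (forall u, `|y u - x u| <= t) ->
  `|\prod_(u in e) y u - \prod_(u in e) x u| <= #|e|%:R * M ^+ #|e| * t.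
Proof.
move=> M1 t0 xM yM xy; have M0 : 0 <= M by exact: le_trans M1.
have [n] := ubnP #|e|; elim: n e => // n IH e.
have [->|[v ve]] := set_0Vmem e; first by rewrite !big_set0 subrr normr0 cards0 !mul0r.
rewrite (cardsD1 v e) ve add1n ltnS => en.
rewrite !(big_setD1 v ve)/=; set e1 := e :\ v in en *.
set Y := \prod_(u in e1) y u; set X := \prod_(u in e1) x u.
have h := IH e1 en; rewrite -/X -/Y in h.
have X0 : 0 <= X by rewrite prodr_ge0// => u _; case/andP: (xM u).
have XM : X <= M ^+ #|e1| by rewrite -prodr_const; apply: ler_prod => u _.
have -> : y v * Y - x v * X = (y v - x v) * X + y v * (Y - X) by ring.
apply: le_trans (ler_normD _ _) _; rewrite !normrM (ger0_norm X0).
have [yv0 yvM] := andP (yM v); rewrite (ger0_norm yv0).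
rewrite -natr1 !mulrDl mul1r [leRHS]addrC lerD//.
  rewrite mulrC; apply: ler_pM => //; apply: (le_trans XM).
  by rewrite exprS ler_peMl// exprn_ge0.
apply: (@le_trans _ _ (M * (#|e1|%:R * M ^+ #|e1| * t))); first exact: ler_pM.
by apply: eq_ler; rewrite exprS; ring.
Qed.

(** Induction on [e]: when [v] is split off, the cross term [(y v - x v) * (Y - X)] is of second
    order by [prod_dist], and the rest is the induction hypothesis. *)
Lemma prod_taylor (I : finType) (e : {set I}) (M t : R) (x y : I -> R) : 1 <= M -> 0 <= t ->
  (forall u, 0 <= x u <= M) -> (forall u, 0 <= y u <= M) ->
  (forall u, `|y u - x u| <= t) ->
  `|\prod_(u in e) y u - \prod_(u in e) x u
    - \sum_(u in e) (y u - x u) * \prod_(w in e :\ u) x w|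
   <= #|e|%:R ^+ 2 * M ^+ #|e| * t ^+ 2.
Proof.
move=> M1 t0 xM yM xy; have M0 : 0 <= M by exact: le_trans M1.
have [n] := ubnP #|e|; elim: n e => // n IH e.
have [->|[v ve]] := set_0Vmem e.
  by rewrite !big_set0 subrr subr0 normr0 cards0 expr0n/= !mul0r.
rewrite (cardsD1 v e) ve add1n ltnS => en.
rewrite !(big_setD1 v ve)/=; set e1 := e :\ v in en *.
set Y := \prod_(u in e1) y u; set X := \prod_(u in e1) x u.
have -> : \sum_(u in e1) (y u - x u) * \prod_(w in e :\ u) x w =
    x v * \sum_(u in e1) (y u - x u) * \prod_(w in e1 :\ u) x w.
  rewrite mulr_sumr; apply: eq_bigr => u; rewrite !inE => /andP[uv ue].
  rewrite (big_setD1 v)/=; last by rewrite !inE eq_sym uv.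
  rewrite mulrCA; congr (_ * (_ * _)); apply: eq_bigl => w.
  by rewrite !inE; case: (w == v); case: (w == u).
set S := \sum_(u in e1) _.
have h := IH e1 en; rewrite -/X -/Y -/S in h.
have hd := prod_dist e1 M1 t0 xM yM xy; rewrite -/X -/Y in hd.
have -> : y v * Y - x v * X - ((y v - x v) * X + x v * S) =
   (y v - x v) * (Y - X) + x v * (Y - X - S) by ring.
apply: le_trans (ler_normD _ _) _; rewrite !normrM.
have [xv0 xvM] := andP (xM v); rewrite (ger0_norm xv0).
apply: (@le_trans _ _ (t * (#|e1|%:R * M ^+ #|e1| * t) +
    M * (#|e1|%:R ^+ 2 * M ^+ #|e1| * t ^+ 2))).
  by apply: lerD; apply: ler_pM.
rewrite -natr1 [M ^+ _.+1]exprS; set N := #|e1|%:R; set P := M ^+ #|e1|.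
have P0 : 0 <= P by rewrite exprn_ge0.
have N0 : 0 <= N by [].
have PM : P <= M * P by rewrite ler_peMl.
have t2 : 0 <= t ^+ 2 by rewrite exprn_ge0.
have -> : t * (N * P * t) + M * (N ^+ 2 * P * t ^+ 2) =
  N * t ^+ 2 * P + N ^+ 2 * t ^+ 2 * (M * P) by ring.
have -> : (N + 1) ^+ 2 * (M * P) * t ^+ 2 =
  N * t ^+ 2 * (M * P) + N ^+ 2 * t ^+ 2 * (M * P) + (N + 1) * t ^+ 2 * (M * P) by ring.
rewrite -[leLHS]addr0; apply: lerD; last by rewrite !mulr_ge0// addr_ge0.
by rewrite lerD2r ler_wpM2l// mulr_ge0.
Qed.

(** The middle expression is the Bregman divergence [y * ln (y / x) - (y - x)]; both bounds come
    from [ln z <= z - 1], at [z = x / y] and [z = y / x]. *)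
Lemma entropy_taylor (c x y : R) : 0 < c -> 0 < x -> 0 < y ->
  0 <= y * (ln (y / c) - 1) - x * (ln (x / c) - 1) - ln (x / c) * (y - x)
    <= (y - x) ^+ 2 / x.
Proof.
move=> c0 x0 y0.
have -> : y * (ln (y / c) - 1) - x * (ln (x / c) - 1) - ln (x / c) * (y - x) =
    y * ln (y / x) - (y - x).
  have -> : y / x = (y / c) / (x / c) by field; rewrite !gt_eqF.
  by rewrite (@ln_div _ (y / c) (x / c)) ?posrE ?divr_gt0//; ring.
have lnle (z : R) : 0 < z -> ln z <= z - 1.
  by move=> z0; rewrite -{1}(subrK 1 z) addrC le_ln1Dx//; lra.
apply/andP; split.
  have := lnle (x / y) (divr_gt0 x0 y0).
  have -> : x / y = (y / x)^-1 by rewrite invf_div.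
  rewrite lnV ?posrE ?divr_gt0// => /(ler_wpM2l (ltW y0)).
  by rewrite mulrBr invf_div mulrCA divff ?gt_eqF// !mulr1; lra.
have := lnle (y / x) (divr_gt0 y0 x0) => /(ler_wpM2l (ltW y0)) h.
have -> : (y - x) ^+ 2 / x = y * (y / x - 1) - (y - x) by field; rewrite gt_eqF.
lra.
Qed.

Variables (V : finType) (E : {set {set V}}) (k : nat) (c rho : R).
Implicit Types (s t : R) (x y z : V -> R) (e f g : {set V}).
Hypothesis unif : kuniform E k.
Hypothesis k1 : (1 <= k)%N.
Hypothesis c0 : 0 < c.
Hypothesis deg0 : 0 < (maxdeg E)%:R :> R.
Hypothesis rho01 : 0 <= rho < 1.

Let d : R := (maxdeg E)%:R.
Let C : R := c ^+ k.-1.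

Lemma card_edge_del e v : e \in E -> v \in e -> #|e :\ v| = k.-1.
Proof. by move=> eE ve; rewrite cardsD (setIidPr _) ?sub1set// cards1 (unif eE) subn1. Qed.

Lemma handshake : k%:R * #|E|%:R <= d * #|V|%:R.
Proof.
rewrite -!natrM ler_nat.
have -> : (k * #|E| = \sum_(e in E) \sum_(v in e) 1)%N.
  rewrite mulnC -sum_nat_const; apply: eq_bigr => e eE.
  by rewrite sum1_card unif.
rewrite (exchange_big_dep predT)//= mulnC -sum_nat_const.
apply: leq_sum => v _; rewrite sum1_card; apply: leq_trans (hdeg1_le E v).
by apply/eq_leq/eq_card => e; rewrite inE.
Qed.

Lemma card_edges_le : #|E|%:R <= d * #|V|%:R.
Proof. by apply: le_trans handshake; rewrite ler_peMl// ler1n. Qed.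

Lemma sum_edges_at_le v (K : R) (h : {set V} -> R) : 0 <= K ->
  (forall e, e \in E -> v \in e -> h e <= K) ->
  \sum_(e in E | v \in e) h e <= d * K.
Proof.
move=> K0 hK; apply: (@le_trans _ _ (\sum_(e in E | v \in e) K)).
  by apply: ler_sum => e /andP[]; exact: hK.
rewrite sumr_const -[leLHS]mulr_natl ler_wpM2r// ler_nat.
by apply: leq_trans (hdeg1_le E v); apply/eq_leq/eq_card => e; rewrite inE.
Qed.

Lemma message_le (y : V -> R) e v : (forall u, 0 <= y u <= c) -> e \in E -> v \in e ->
  0 <= \prod_(u in e :\ v) y u <= C.
Proof.
move=> yb eE ve; rewrite prodr_ge0/=; last by move=> u _; case/andP: (yb u).
by rewrite /C -(card_edge_del eE ve) -prodr_const; apply: ler_prod => u _.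
Qed.

Definition message_close (t : R) (x y : V -> R) : Prop :=
  forall v e, e \in E -> v \in e ->
  `|Num.sqrt (\prod_(u in e :\ v) x u) - Num.sqrt (\prod_(u in e :\ v) y u)| <= t.

Lemma message_close_trans t1 t2 x y z :
  message_close t1 x y -> message_close t2 y z -> message_close (t1 + t2) x z.
Proof.
move=> h1 h2 v e eE ve; apply: le_trans (lerD (h1 v e eE ve) (h2 v e eE ve)).
by rewrite -[X in `|X| <= _](subrKA (Num.sqrt (\prod_(u in e :\ v) y u))) ler_normD.
Qed.

Lemma sqrt_dist_sqr (a b t : R) : 0 <= a <= C -> 0 <= b <= C ->
  `|Num.sqrt a - Num.sqrt b| <= t -> `|a - b| <= 2 * Num.sqrt C * t.
Proof.
move=> /andP[a0 aC] /andP[b0 bC] h.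
rewrite -(sqr_sqrtr a0) -(sqr_sqrtr b0) subr_sqr normrM [leRHS]mulrC.
apply: ler_pM => //.
rewrite ger0_norm ?addr_ge0 ?sqrtr_ge0// mulr_natl mulr2n.
by rewrite lerD ?ler_wsqrtr.
Qed.

Lemma Fmap_close s s' t x y v : 0 <= s <= 1 -> 0 <= s' <= 1 ->
  (forall u, 0 <= x u <= c) -> (forall u, 0 <= y u <= c) ->
  0 <= t -> message_close t x y ->
  `|ln (Fmap E c s x v / c) - ln (Fmap E c s' y v / c)| <=
     `|s - s'| * C + 2 * Num.sqrt C * t.
Proof.
move=> /andP[s0 s1] /andP[s0' s1'] xb yb t0 xy; rewrite !ln_Fmap// -/d.
have C0 : 0 <= C by rewrite exprn_ge0// ltW.
set a := fun e => \prod_(u in e :\ v) x u; set b := fun e => \prod_(u in e :\ v) y u.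
have -> : - (s / d * \sum_(e in E | v \in e) a e) - - (s' / d * \sum_(e in E | v \in e) b e)
  = - (s / d * \sum_(e in E | v \in e) (a e - b e)
      + (s - s') / d * \sum_(e in E | v \in e) b e) by rewrite sumrB; ring.
rewrite normrN addrC; apply: le_trans (ler_normD _ _) _; apply: lerD.
  have B0 : 0 <= \sum_(e in E | v \in e) b e.
    by apply: sumr_ge0 => e /andP[eE ve]; case/andP: (message_le yb eE ve).
  rewrite !normrM normfV [`|d|]gtr0_norm// (ger0_norm B0).
  rewrite -mulrA ler_wpM2l// mulrC ler_pdivrMr// mulrC sum_edges_at_le//.
  by move=> e eE ve; case/andP: (message_le yb eE ve).
rewrite normrM ger0_norm ?divr_ge0 ?(ltW deg0)//.
apply: (@le_trans _ _ (s / d * (d * (2 * Num.sqrt C * t)))).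
  rewrite ler_wpM2l ?divr_ge0 ?(ltW deg0)//.
  apply: le_trans (ler_norm_sum _ _ _) _.
  apply: sum_edges_at_le => [|e eE ve]; first by rewrite !mulr_ge0 ?sqrtr_ge0.
  by apply: sqrt_dist_sqr (xy v e eE ve); exact: message_le.
by rewrite mulrA divfK ?gt_eqF// ler_piMl// !mulr_ge0 ?sqrtr_ge0.
Qed.

(** A change of tilt acts as an additive error [|s - s'| * C] in the recursion for [y], because at
    most [d] messages of size at most [C] enter. *)
Lemma Fmap_message_close s s' t x y : 0 <= s <= 1 -> 0 <= s' <= 1 ->
  s * (k.-1)%:R * C <= rho ^+ 2 * expR 1 ->
  (forall u, 0 <= x u <= c) -> (forall u, 0 <= y u <= c) ->
  0 <= t -> message_close t x y ->
  message_close (rho * t + Num.sqrt C * (k.-1)%:R * (`|s - s'| * C) / 2)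
    (Fmap E c s x) (Fmap E c s' y).
Proof.
move=> s01 s01' hrho xb yb t0 xy v e eE ve.
have [s0 s1] := andP s01; have [s0' s1'] := andP s01'; have [r0 r1] := andP rho01.
have C0 : 0 <= C by rewrite exprn_ge0// ltW.
have ce := card_edge_del eE ve.
have e1 : `|s - s'| * C = 0 + `|s - s'| * C by rewrite add0r.
rewrite e1 [in Num.sqrt C]/C -ce.
apply: (@message_contraction _ _ E (e :\ v) c s rho d _ _ _ _ _
   (fun u g => \prod_(w in g :\ u) x w) (fun u g => \prod_(w in g :\ u) y w)) => //.
- by rewrite ce.
- by move=> u _; rewrite ler_nat; exact: hdeg1_le.
- by move=> u _; apply: Fmap_bounds => // w; case/andP: (xb w).
- by move=> u _; apply: Fmap_bounds => // w; case/andP: (yb w).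
- by move=> u g _ gE ug; case/andP: (message_le xb gE ug).
- by move=> u g _ gE ug; case/andP: (message_le yb gE ug).
- by move=> u g _ gE ug; exact: xy.
- by move=> u _; rewrite ln_Fmap// addNr normr0.
move=> u _; rewrite ln_Fmap// -/d.
set S := \sum_(e in E | u \in e) _.
have -> : - (s' / d * S) + s / d * S = (s - s') * (S / d) by ring.
have S0 : 0 <= S.
  by apply: sumr_ge0 => g /andP[gE ug]; case/andP: (message_le yb gE ug).
rewrite normrM ler_wpM2l// normrM normfV [`|d|]gtr0_norm// ler_pdivrMr// mulrC.
rewrite (ger0_norm S0); apply: sum_edges_at_le => // g gE ug.
by case/andP: (message_le yb gE ug).
Qed.

Lemma Fiter_bounds_le s m u : 0 <= s <= 1 -> 0 <= Fiter E c s m u <= c.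
Proof.
by move=> /andP[s0 _]; have /andP[/ltW-> ->] := Fiter_bounds E c0 m u s0.
Qed.

Lemma const_message_close x : (forall u, 0 <= x u <= c) ->
  message_close (Num.sqrt C) (fun=> c) x.
Proof.
move=> xb v e eE ve; have /andP[x0 xC] := message_le xb eE ve.
have -> : \prod_(u in e :\ v) c = C by rewrite prodr_const (card_edge_del eE ve).
rewrite ger0_norm ?subr_ge0 ?ler_wsqrtr//.
by rewrite gerBl sqrtr_ge0.
Qed.

Lemma Fiter_fixed_close s m xs : 0 <= s <= 1 ->
  s * (k.-1)%:R * C <= rho ^+ 2 * expR 1 ->
  in_box c xs -> is_fixed_point E c s xs ->
  message_close (rho ^+ m * Num.sqrt C) (Fiter E c s m) xs.
Proof.
move=> s01 hrho xb xF; have [r0 r1] := andP rho01.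
elim: m => [|m IH]; first by rewrite expr0 mul1r; exact: const_message_close.
have -> : xs = Fmap E c s xs by apply: boolp.funext => v; rewrite xF.
have t0 : 0 <= rho ^+ m * Num.sqrt C by rewrite mulr_ge0 ?exprn_ge0 ?sqrtr_ge0.
have := Fmap_message_close s01 s01 hrho (fun u => Fiter_bounds_le m u s01) xb t0 IH.
by rewrite subrr normr0 mul0r mulr0 mul0r addr0 mulrA -exprS.
Qed.

Lemma Fiter_succ_close s m : 0 <= s <= 1 ->
  s * (k.-1)%:R * C <= rho ^+ 2 * expR 1 ->
  message_close (rho ^+ m * Num.sqrt C) (Fiter E c s m) (Fiter E c s m.+1).
Proof.
move=> s01 hrho; have [r0 r1] := andP rho01.
elim: m => [|m IH].
  by rewrite expr0 mul1r; apply: const_message_close => u; exact: Fiter_bounds_le 1 _ s01.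
have t0 : 0 <= rho ^+ m * Num.sqrt C by rewrite mulr_ge0 ?exprn_ge0 ?sqrtr_ge0.
have := Fmap_message_close s01 s01 hrho (fun u => Fiter_bounds_le m u s01)
  (fun u => Fiter_bounds_le m.+1 u s01) t0 IH.
by rewrite subrr normr0 mul0r mulr0 mul0r addr0 mulrA -exprS.
Qed.

(** The solution [L] of [L = rho * L + Num.sqrt C * (k.-1)%:R * C / 2]: the Lipschitz constant in
    [s] that one application of the map preserves. *)
Definition lip_const : R := Num.sqrt C * (k.-1)%:R * C / 2 / (1 - rho).

Lemma lip_const_ge0 : 0 <= lip_const.
Proof.
have [r0 r1] := andP rho01.
by rewrite !mulr_ge0 ?sqrtr_ge0 ?exprn_ge0 ?invr_ge0 ?subr_ge0 ?(ltW r1) ?(ltW c0).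
Qed.

Lemma Fiter_lip s s' m : 0 <= s <= 1 -> 0 <= s' <= 1 ->
  s * (k.-1)%:R * C <= rho ^+ 2 * expR 1 ->
  message_close (lip_const * `|s - s'|) (Fiter E c s m) (Fiter E c s' m).
Proof.
move=> s01 s01' hrho; have [r0 r1] := andP rho01.
have t0 : 0 <= lip_const * `|s - s'| by rewrite mulr_ge0// lip_const_ge0.
elim: m => [|m IH]; first by move=> v e eE ve; rewrite subrr normr0.
have := Fmap_message_close s01 s01' hrho (fun u => Fiter_bounds_le m u s01)
  (fun u => Fiter_bounds_le m u s01') t0 IH.
have -> // : rho * (lip_const * `|s - s'|) + Num.sqrt C * (k.-1)%:R * (`|s - s'| * C) / 2 =
  lip_const * `|s - s'|.
by rewrite /lip_const; field; rewrite subr_eq0 gt_eqF.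
Qed.

Lemma Fmap_ge_s s x v : 0 <= s -> (forall u, 0 <= x u <= c) ->
  c * expR (- (s * C)) <= Fmap E c s x v.
Proof.
move=> s0 xb; rewrite /Fmap ler_pM2l// ler_expR mulNr lerN2 -/d.
have C0 : 0 <= C by rewrite exprn_ge0// ltW.
rewrite -mulrA; apply: (@le_trans _ _ (s * (d^-1 * (d * C)))); last first.
  by rewrite mulKf// gt_eqF.
rewrite ler_wpM2l// ler_wpM2l ?invr_ge0 ?(ltW deg0)//; apply: sum_edges_at_le => // g gE ug.
by case/andP: (message_le xb gE ug).
Qed.

Lemma Fmap_ge s x v : 0 <= s <= 1 -> (forall u, 0 <= x u <= c) ->
  c * expR (- C) <= Fmap E c s x v.
Proof.
move=> /andP[s0 s1] xb; apply: le_trans (Fmap_ge_s v s0 xb).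
by rewrite ler_pM2l// ler_expR lerN2 ler_piMl// exprn_ge0// ltW.
Qed.

Lemma Fmap_dist s s' t x y v : 0 <= s <= 1 -> 0 <= s' <= 1 ->
  (forall u, 0 <= x u <= c) -> (forall u, 0 <= y u <= c) ->
  0 <= t -> message_close t x y ->
  `|Fmap E c s x v - Fmap E c s' y v| <= c * (`|s - s'| * C + 2 * Num.sqrt C * t).
Proof.
move=> s01 s01' xb yb t0 xy; have h := Fmap_close v s01 s01' xb yb t0 xy.
have [s0 _] := andP s01; have [s0' _] := andP s01'.
have x0 u : 0 <= x u by case/andP: (xb u).
have y0 u : 0 <= y u by case/andP: (yb u).
have fx := Fmap_bounds E c0 v s0 x0; have fy := Fmap_bounds E c0 v s0' y0.
have eF (z : R) : 0 < z <= c -> z = c * expR (ln (z / c)) /\ ln (z / c) <= 0.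
  move=> /andP[z0 zc]; rewrite lnK ?posrE ?divr_gt0// mulrCA divff ?gt_eqF// mulr1.
  by rewrite ln_le0// ler_pdivrMr// mul1r.
have [e1 l1] := eF _ fx; have [e2 l2] := eF _ fy.
rewrite e1 e2 -mulrBr normrM gtr0_norm// ler_wpM2l ?(ltW c0)//.
exact: le_trans (expR_lip_nonpos l1 l2) h.
Qed.

(** The first term comes from [prod_taylor], the second from the division by [x] in
    [entropy_taylor], where coordinates are at least [c * expR (- C)]. *)
Definition bethe_curv (M : R) : R := k%:R ^+ 2 * M ^+ k + (c * expR (- C))^-1.

(** The quantity bounded by [e1] is minus the partial derivative of the Bethe free energy, so [e1]
    measures how far [x] is from stationary. A displacement [t] costs [t * e1] at first order and a
    multiple of [t ^+ 2] at second; what remains is the explicit dependence on [s]. *)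
Lemma Bethe_diff s s' t (e1 M : R) x y : 0 <= s <= 1 -> 0 <= t -> 1 <= M -> c <= M ->
  (forall u, c * expR (- C) <= x u <= c) -> (forall u, c * expR (- C) <= y u <= c) ->
  (forall u, `|y u - x u| <= t) ->
  (forall v, `|ln (x v / c) + s / d * \sum_(e in E | v \in e) \prod_(u in e :\ v) x u| <= e1) ->
  `|Bethe E c s' y - Bethe E c s x + (s' - s) / d * \sum_(e in E) \prod_(u in e) y u|
   <= #|V|%:R * (t * e1 + bethe_curv M * t ^+ 2).
Proof.
move=> /andP[s0 s1] t0 M1 cM xb yb xy hx.
have cm0 : 0 < c * expR (- C) by rewrite mulr_gt0// expR_gt0.
have xp u : 0 < x u by case/andP: (xb u) => h _; exact: lt_le_trans h.
have yp u : 0 < y u by case/andP: (yb u) => h _; exact: lt_le_trans h.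
have xM u : 0 <= x u <= M by rewrite ltW//=; case/andP: (xb u) => _ h; exact: le_trans h _.
have yM u : 0 <= y u <= M by rewrite ltW//=; case/andP: (yb u) => _ h; exact: le_trans h _.
pose Q e := \prod_(u in e) y u - \prod_(u in e) x u
    - \sum_(u in e) (y u - x u) * \prod_(w in e :\ u) x w.
pose H v := y v * (ln (y v / c) - 1) - x v * (ln (x v / c) - 1) - ln (x v / c) * (y v - x v).
pose G v := ln (x v / c) + s / d * \sum_(e in E | v \in e) \prod_(u in e :\ v) x u.
(* [Q] and [H] are the second-order remainders of the edge products and of the entropy; [G] is minus
   the gradient. *)
have eqB : Bethe E c s' y - Bethe E c s x + (s' - s) / d * \sum_(e in E) \prod_(u in e) y u =
  - (s / d * \sum_(e in E) Q e + \sum_v H v + \sum_v (y v - x v) * G v).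
  have -> : \sum_v (y v - x v) * G v = \sum_v ln (x v / c) * (y v - x v) +
     s / d * \sum_(e in E) \sum_(u in e) (y u - x u) * \prod_(w in e :\ u) x w.
    rewrite (exchange_big_dep predT)//= mulr_sumr -big_split/=.
    apply: eq_bigr => v _; rewrite /G mulrDr mulrC; congr (_ + _).
    by rewrite mulrCA; congr (_ * _); rewrite mulr_sumr.
  rewrite /Bethe -/d /Q /H !sumrB; ring.
rewrite eqB normrN; apply: le_trans (ler_normD _ _) _.
rewrite mulrDr [leRHS]addrC; apply: lerD; last first.
  apply: le_trans (ler_norm_sum _ _ _) _.
  rewrite mulr_natl -sumr_const; apply: ler_sum => v _.
  by rewrite normrM; apply: ler_pM => //; exact: hx.
apply: le_trans (ler_normD _ _) _; rewrite /bethe_curv !mulrDl mulrDr; apply: lerD.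
  rewrite normrM ger0_norm ?divr_ge0 ?(ltW deg0)//.
  set K := k%:R ^+ 2 * M ^+ k * t ^+ 2.
  have K0 : 0 <= K by rewrite !mulr_ge0 ?exprn_ge0// (le_trans _ M1).
  have h : `|\sum_(e in E) Q e| <= #|E|%:R * K.
    apply: le_trans (ler_norm_sum _ _ _) _.
    rewrite mulr_natl -sumr_const; apply: ler_sum => e eE.
    by rewrite /K -(unif eE); exact: prod_taylor.
  apply: le_trans (ler_wpM2l _ h) _; first by rewrite divr_ge0 ?(ltW deg0).
  rewrite mulrA ler_wpM2r// mulrAC ler_pdivrMr// [leRHS]mulrC.
  apply: le_trans card_edges_le; exact: ler_piMl.
apply: le_trans (ler_norm_sum _ _ _) _.
rewrite mulr_natl -sumr_const; apply: ler_sum => v _.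
have /andP[h1 h2] := entropy_taylor c0 (xp v) (yp v).
rewrite ger0_norm//; apply: (le_trans h2); rewrite mulrC; apply: ler_pM.
- by rewrite invr_ge0 ltW.
- by rewrite sqr_ge0.
- by rewrite lef_pV2 ?posrE//; case/andP: (xb v).
by rewrite -real_normK ?num_real// ler_pXn2r ?nnegrE.
Qed.

End Deterministic.

(** * The derivative of the log partition function *)

Section Binomial.
Import mathcomp.boot.finset mathcomp.boot.fintype.
Variables (R : realType) (V : finType).
Implicit Types (T S : {set V}).

Lemma prod_mem_set T (a b : R) :
  \prod_(v : V) (if v \in T then a else b) = a ^+ #|T| * b ^+ (#|V| - #|T|).
Proof.
rewrite (bigID (mem T))/=; congr (_ * _).
  by rewrite -prodr_const; apply: eq_bigr => v ->.
rewrite -[in (_ - #|T|)%N](setCK T) -cardsCs -prodr_const.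
apply: eq_big => v; first by rewrite inE.
by move=> /negbTE ->.
Qed.

Lemma prod_add_sets (F G : V -> R) : \prod_v (F v + G v) =
  \sum_(J : {set V}) \prod_v (if v \in J then F v else G v).
Proof. by rewrite bigA_distr; apply: eq_bigl => J; rewrite inE. Qed.

Lemma sum_bwt (p : R) : \sum_(T : {set V}) bwt p T = 1.
Proof.
have := prod_add_sets (fun _ : V => p) (fun _ => 1 - p).
under [X in _ = X -> _]eq_bigr => T _ do rewrite prod_mem_set.
by move=> <-; rewrite big1// => i _; rewrite addrC subrK.
Qed.

Lemma pf_s0 (p : R) (E : {set {set V}}) : pf p 0 finset.set0 E = 1.
Proof.
rewrite -[RHS](sum_bwt p) /pf; apply: eq_big => T; first by rewrite sub0set.
by move=> _; rewrite subr0 expr1n mulr1.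
Qed.

(* Deleting each point of a [p]-random set with probability [1 - q]
   leaves a [p q]-random set. *)
Lemma bwt_thin (p q : R) S :
  \sum_(T : {set V} | S \subset T)
     bwt p T * (q ^+ #|S| * (1 - q) ^+ (#|T| - #|S|)) = bwt (p * q) S.
Proof.
pose F v := p * (if v \in S then q else 1 - q).
pose G v := (1 - p) * (if v \in S then 0 else 1).
have := prod_add_sets F G.
have -> : \prod_(i : V) (F i + G i) = bwt (p * q) S.
  rewrite /bwt -prod_mem_set; apply: eq_bigr => v _; rewrite /F /G.
  by case: ifP => _; ring.
move=> ->; rewrite [RHS](bigID (fun T => S \subset T))/= [X in _ = _ + X]big1 ?addr0.
  apply: eq_bigr => T ST.
  have -> : q ^+ #|S| * (1 - q) ^+ (#|T| - #|S|) =
      \prod_(v in T) (if v \in S then q else 1 - q).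
    rewrite (bigID (mem S))/=; congr (_ * _).
      rewrite -prodr_const; apply: eq_big => v; last by move=> ->.
      by apply/idP/andP => [vS|[]//]; rewrite (subsetP ST).
    rewrite -[in (#|T| - #|S|)%N](setIidPr ST) -cardsD -prodr_const.
    apply: eq_big => v; first by rewrite inE andbC.
    by rewrite inE => /andP[/negbTE ->].
  have -> : \prod_(v in T) (if v \in S then q else 1 - q) =
      \prod_(v : V) (if v \in T then (if v \in S then q else 1 - q) else 1).
    by rewrite big_mkcond.
  rewrite /bwt -prod_mem_set -big_split/=; apply: eq_bigr => v _; rewrite /F /G.
  case: (boolP (v \in T)) => // vT; rewrite mulr1.
  by case: (boolP (v \in S)) => [/(subsetP ST)|]; rewrite ?(negbTE vT)// mulr1.
move=> T /subsetPn[v vS vT]; apply/eqP; rewrite prodf_seq_eq0; apply/hasP.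
by exists v; rewrite ?mem_index_enum//= (negbTE vT) /G vS mulr0.
Qed.

End Binomial.

Section LogDerivative.
Import mathcomp.boot.finset mathcomp.boot.fintype.
Variables (R : realType) (V : finType) (E : {set {set V}}) (p : R).
Hypothesis p01 : 0 < p < 1.
Hypothesis E0 : set0 \notin E.

(** Covers [s = 1] as well: the empty configuration spans no edge, so it keeps its full weight. *)
Lemma pf_gt0_le1 s : s <= 1 -> 0 < pf p s set0 E.
Proof.
move=> s1; rewrite /pf (bigD1 set0) ?sub0set//=.
have -> : numX E set0 = 0%N.
  apply/eqP; rewrite cards_eq0; apply/eqP/setP => f; rewrite !inE subset0.
  by apply/negP => /andP[fE /eqP f0]; rewrite f0 (negbTE E0) in fE.
rewrite expr0 mulr1 ltr_wpDr ?bwt_gt0//.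
apply: sumr_ge0 => T _; rewrite mulr_ge0 ?(ltW (bwt_gt0 _ _))//.
by rewrite exprn_ge0// subr_ge0.
Qed.

(** Minus the logarithmic derivative of the partition function. Each summand leaves out the penalty
    of its own edge, because differentiating [(1 - s) ^+ X] removes one factor. *)
Definition edge_rate (s : R) : R :=
  \sum_(e in E) pf p s e (E :\ e) / pf p s set0 E.

Let q : {poly R} := \sum_(T : {set V}) bwt p T *: (1 - 'X) ^+ numX E T.

Let qE s : q.[s] = pf p s set0 E.
Proof.
rewrite horner_sum /pf; apply: eq_big => T; first by rewrite sub0set.
by move=> _; rewrite !hornerE.
Qed.

Let dqE s : (q^`()).[s] = - \sum_(e in E) pf p s e (E :\ e).
Proof.
rewrite /q raddf_sum/= horner_sum.
rewrite /pf (exchange_big_dep predT)//= -sumrN; apply: eq_bigr => T _.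
rewrite derivZ deriv_exp derivB derivX derivC sub0r mulN1r hornerZ hornerMn hornerN.
have -> : ((1 - 'X) ^+ (numX E T).-1).[s] = (1 - s) ^+ (numX E T).-1 by rewrite !hornerE.
have -> : \sum_(e in E | e \subset T) bwt p T * (1 - s) ^+ numX (E :\ e) T =
    (numX E T)%:R * (bwt p T * (1 - s) ^+ (numX E T).-1).
  rewrite [in RHS]mulr_natl -[in RHS]sumr_const.
  rewrite [RHS](eq_bigl (fun e => (e \in E) && (e \subset T))); last by move=> e; rewrite !inE.
  apply: eq_bigr => e /andP[eE eT].
  by rewrite -{2}(setD1K eE) numXU1 ?eT ?add1n// !inE eqxx.
by rewrite mulNrn mulrN mulrnAr mulr_natl.
Qed.

Lemma pf_derive s : is_derive s (1 : R) (fun t => pf p t set0 E)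
  (- \sum_(e in E) pf p s e (E :\ e)).
Proof.
rewrite (_ : (fun t => _) = horner q); last by apply: boolp.funext => t; rewrite qE.
by rewrite -dqE; exact: is_derive_poly.
Qed.

Lemma ln_pf_derive (s : R) : s <= 1 ->
  is_derive s (1 : R) (fun t => ln (pf p t set0 E)) (- edge_rate s).
Proof.
move=> s1; have h := pf_derive s; have z0 := pf_gt0_le1 s1.
have h2 := is_derive1_comp (is_derive1_ln z0) h.
apply: (is_derive_eq h2).
by rewrite /edge_rate -mulr_suml mulrN mulrC.
Qed.

(** The intermediate point satisfies [t < b <= 1], so the estimates for tilts below [1] apply to it
    even when [b = 1]. *)
Lemma ln_pf_MVT (a b : R) : a < b -> b <= 1 ->
  exists t, a < t < b /\
    ln (pf p b set0 E) - ln (pf p a set0 E) = - edge_rate t * (b - a).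
Proof.
move=> ab b1.
have [x xab||t] := MVT (f := fun t => ln (pf p t set0 E)) (df := fun t => - edge_rate t) ab.
- by apply: ln_pf_derive; move: xab; rewrite in_itv/= => /andP[_ /ltW xb]; exact: le_trans b1.
- apply: derivable_within_continuous => x; rewrite in_itv/= => /andP[_ xb].
  by have [] := ln_pf_derive (le_trans xb b1).
by rewrite in_itv/= => tab h; exists t.
Qed.

End LogDerivative.

(** [P] is the probability of an edge when its own penalty is dropped; restoring the penalty in the
    denominator, by [pf_edge], gives [P / (1 - s * P)]. *)
Lemma ratio_shift (R : realType) (s P x : R) : 0 <= s < 1 -> 0 <= P <= x -> x <= 2^-1 ->
  P <= P / (1 - s * P) <= P + 2 * x ^+ 2.
Proof.
move=> /andP[s0 s1] /andP[P0 Px] x1.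
have sP : 0 <= s * P <= P by rewrite mulr_ge0//= ler_piMl// ltW.
have d0 : 0 < 1 - s * P by case/andP: sP => *; lra.
rewrite ler_pdivlMr// ler_pdivrMr//; set u := s * P in sP d0 *.
apply/andP; split; first by nra.
have Pu : P * u <= x ^+ 2 by case/andP: sP => *; nra.
have : 0 <= x ^+ 2 by rewrite sqr_ge0.
by case/andP: sP => *; nra.
Qed.

(** * Edge probabilities in the tilted measure *)

Section EdgeRate.
Import mathcomp.boot.finset mathcomp.boot.fintype.
Variable R : realType.
Variables (V : finType) (E : {set {set V}}) (k : nat) (c p eps s rho : R).
Hypothesis k2 : (2 <= k)%N.
Hypothesis c0 : 0 < c.
Hypothesis tm : tame E k c p eps.
Hypothesis eps1 : eps <= 2^-1.
Hypothesis s01 : 0 <= s < 1.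
Hypothesis rho01 : 0 <= rho < 1.
Hypothesis hrho : s * (k.-1)%:R * c ^+ k.-1 <= rho ^+ 2 * expR 1.

Lemma set0_notin : set0 \notin E.
Proof. by apply/negP => /(tame_unif tm); rewrite cards0; case: k k2. Qed.

(* [pf (W :|: f) E = (1 - s) * pf (W :|: f) (E :\ f)], so the
   probability of [f] carries a factor [1 - s] which is divided out here. *)
Lemma edge_prob N m (W f : {set V}) :
  (#|W| + k + m * k <= N)%N -> f \in E -> [disjoint f & W] -> ~~ bad E W f ->
  `|pf p s (W :|: f) (E :\ f) / pf p s W E -
    p ^+ k * (\prod_(u in f) Fiter E c s m.+1 u / c ^+ k)|
  <= p ^+ k * (k%:R * marginal_err k c eps rho N m + 2 * eps).
Proof.
move=> WN fE fW fb.
have h := model_edge k2 c0 tm eps1 s01 rho01 hrho WN fE fW fb.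
have p0 := tame_p0 tm; have pk0 : 0 < p ^+ k by rewrite exprn_gt0.
have p2 := tame_p2 tm eps1; have p01 := tame_p01 tm eps1.
set P := pf p s (W :|: f) (E :\ f) / pf p s W (E :\ f) in h.
set y := \prod_(u in f) _ / _ in h *.
have z0 := pf_gt0 p01 s01 W (E :\ f).
have Pb : 0 <= P <= p ^+ k.
  have := pf_ratio_bounds tm eps1 s01 W (E :\ f) f.
  by rewrite (_ : f :\: W = f) ?(tame_unif tm fE)//; apply/setDidPl.
have pkp : p ^+ k <= p.
  by rewrite -[leRHS]expr1 ler_wiXn2l ?(ltW p0)//; [case/andP: p01 => _ /ltW|exact: ltnW].
have -> : pf p s (W :|: f) (E :\ f) / pf p s W E = P / (1 - s * P).
  rewrite -{2}(setD1K fE) pf_edge ?in_setD1 ?eqxx// /P; field.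
  rewrite gt_eqF//=; rewrite -pf_edge ?in_setD1 ?eqxx// gt_eqF//.
  exact: pf_gt0.
have := ratio_shift s01 Pb (le_trans pkp p2); set Q := P / _ => /andP[Q1 Q2].
have -> : Q - p ^+ k * y = (Q - P) + p ^+ k * (P / p ^+ k - y).
  by field; rewrite gt_eqF.
rewrite [leRHS]mulrDr addrC; apply: le_trans (ler_normD _ _) _; apply: lerD.
  by rewrite normrM gtr0_norm// ler_pM2l.
rewrite ger0_norm ?subr_ge0// lerBlDl; apply: (le_trans Q2); rewrite lerD2l.
rewrite expr2 mulrCA ler_pM2l// ler_pM2l//; apply: (le_trans pkp).
by case: tm => _ /andP[].
Qed.

Lemma edge_rate_approx N m : (k + m * k <= N)%N ->
  `|edge_rate E p s - p ^+ k / c ^+ k * \sum_(e in E) \prod_(u in e) Fiter E c s m.+1 u|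
  <= #|E|%:R * (p ^+ k * (k%:R * marginal_err k c eps rho N m + 2 * eps)).
Proof.
move=> kN; rewrite /edge_rate mulr_sumr -sumrB.
apply: le_trans (ler_norm_sum _ _ _) _; rewrite mulr_natl -sumr_const.
apply: ler_sum => e eE.
have := @edge_prob N m set0 e; rewrite cards0 add0n set0U => /(_ kN eE).
rewrite mulrAC mulrA; apply.
  by rewrite -setI_eq0 setI0.
(* With nothing occupied no edge is bad: by [bad_inter_gt0] a witness would meet the empty set. *)
apply/negP => /exists_inP[g gE /and3P[ge gse _]].
by have := bad_inter_gt0 (tame_unif tm) eE gE ge gse; rewrite setI0 cards0.
Qed.

End EdgeRate.

(** * The log partition function *)

Section GridConstants.
Variable R : realType.

(* [D] stands for [Delta^(-1/(k-1))]. *)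
Definition scaled (V : finType) (E : {set {set V}}) (k : nat) (c p D eps : R) : Prop :=
  [/\ 0 < D, D ^+ k.-1 * (maxdeg E)%:R = 1 & `|(p / (c * D)) ^+ k - 1| <= eps].

Lemma dist_le_three (a b c' d' e1 e2 e3 : R) : `|a - b| <= e1 -> `|b - c'| <= e2 ->
  `|c' - d'| <= e3 -> `|a - d'| <= e1 + e2 + e3.
Proof.
by rewrite !ler_norml => /andP[? ?] /andP[? ?] /andP[? ?]; apply/andP; split; lra.
Qed.

Lemma telescope_bound (lb la D Bb Ba x e1 e2 : R) :
  `|(lb - la) - D * (Bb - Ba)| <= e1 -> `|la - D * (Ba - x)| <= e2 ->
  `|lb - D * (Bb - x)| <= e1 + e2.
Proof.
move=> h1 h2; have -> : lb - D * (Bb - x) =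
  ((lb - la) - D * (Bb - Ba)) + (la - D * (Ba - x)) by ring.
by apply: le_trans (ler_normD _ _) _; exact: lerD.
Qed.

(** Displacement of vertex values per unit of mesh, when both the change of tilt and [rho ^+ m] are
    at most the mesh. *)
Definition step_lip (k : nat) (c rho : R) : R :=
  c * (c ^+ k.-1 + 2 * Num.sqrt (c ^+ k.-1) * (lip_const k c rho + Num.sqrt (c ^+ k.-1))).

(** Coefficient of the squared mesh in [grid_step]: drift of the edge sum within a step, failure of
    stationarity at the left end, curvature of the Bethe free energy. *)
Definition grid_const (k : nat) (c rho : R) : R :=
  k%:R * (1 + c) ^+ k * step_lip k c rho + 2 * c ^+ k.-1 * step_lip k c rho
  + bethe_curv k c (1 + c) * step_lip k c rho ^+ 2.

End GridConstants.

Section FreeEnergy.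
Import mathcomp.boot.finset mathcomp.boot.fintype.
Variable R : realType.
Variables (V : finType) (E : {set {set V}}) (k : nat) (c p D eps rho zeta : R).
Hypothesis k2 : (2 <= k)%N.
Hypothesis c0 : 0 < c.
Hypothesis tm : tame E k c p eps.
Hypothesis sc : scaled E k c p D eps.
Hypothesis eps1 : eps <= 2^-1.
Hypothesis zeta01 : 0 < zeta <= 1.
Hypothesis rho01 : 0 <= rho < 1.
Hypothesis hrho : zeta * (k.-1)%:R * c ^+ k.-1 <= rho ^+ 2 * expR 1.

Let d : R := (maxdeg E)%:R.
Let C : R := c ^+ k.-1.
Notation Fiter := (Fiter E c).
Notation step_lip := (step_lip k c rho).
Notation grid_const := (grid_const k c rho).
Notation lip_const := (lip_const k c rho).

Let d0 : 0 < d. Proof. exact: tame_d0 tm. Qed.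
Let k1 : (1 <= k)%N. Proof. exact: ltnW. Qed.
Let unif := tame_unif tm.
Let D0 : 0 < D. Proof. by case: sc. Qed.
Let C0 : 0 < C. Proof. exact: exprn_gt0. Qed.

Lemma scaled_Dk : D ^+ k = D / d.
Proof.
case: sc => _ h _; rewrite -(prednK k1) exprS; congr (_ * _).
by rewrite -[LHS](mulfK (lt0r_neq0 d0)) h mul1r.
Qed.

Lemma hrho_le s : 0 <= s <= zeta -> s * (k.-1)%:R * c ^+ k.-1 <= rho ^+ 2 * expR 1.
Proof.
move=> /andP[s0 sz]; apply: le_trans hrho.
by rewrite -!mulrA ler_wpM2r// mulr_ge0// exprn_ge0// ltW.
Qed.

Lemma step_lip_ge0 : 0 <= step_lip.
Proof.
have L0 : 0 <= lip_const by exact: lip_const_ge0 c0 rho01.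
have c1 := ltW c0.
by rewrite mulr_ge0// addr_ge0 ?exprn_ge0// !mulr_ge0 ?sqrtr_ge0// addr_ge0 ?sqrtr_ge0.
Qed.

Lemma scaled_edges : #|E|%:R * p ^+ k <= 2 * c ^+ k * (D * #|V|%:R).
Proof.
have p0 := tame_p0 tm.
have : p ^+ k <= 2 * c ^+ k * D ^+ k.
  case: sc => _ _; rewrite ler_norml => /andP[_ h].
  have cD0 : 0 < (c * D) ^+ k by rewrite exprn_gt0// mulr_gt0.
  rewrite -mulrA -exprMn -ler_pdivrMr// -expr_div_n.
  by have e2 := eps1; move: h e2; set x := _ ^+ k; lra.
rewrite scaled_Dk => h.
have hE := card_edges_le R unif k1.
apply: le_trans (ler_wpM2l (ler0n _ _) h) _.
have -> : #|E|%:R * (2 * c ^+ k * (D / d)) = 2 * c ^+ k * D * (#|E|%:R / d) by ring.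
rewrite [leRHS]mulrA ler_wpM2l ?mulr_ge0 ?exprn_ge0 ?(ltW c0) ?(ltW D0)//.
by rewrite ler_pdivrMr// mulrC.
Qed.

Lemma scaled_pk : `|p ^+ k / c ^+ k - D / d| <= eps * (D / d).
Proof.
case: sc => _ _ h; rewrite -scaled_Dk.
have Dk0 : 0 < D ^+ k by rewrite exprn_gt0.
have -> : p ^+ k / c ^+ k - D ^+ k = ((p / (c * D)) ^+ k - 1) * D ^+ k.
  by rewrite expr_div_n exprMn; field; rewrite !gt_eqF ?exprn_gt0.
by rewrite normrM (gtr0_norm Dk0) ler_wpM2r// ltW.
Qed.

Lemma sum_edges_le (x : V -> R) : (forall u, 0 <= x u <= c) ->
  0 <= \sum_(e in E) \prod_(u in e) x u <= d * #|V|%:R * c ^+ k.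
Proof.
move=> xb; apply/andP; split.
  by apply: sumr_ge0 => e _; apply: prodr_ge0 => u _; case/andP: (xb u).
apply: (@le_trans _ _ (#|E|%:R * c ^+ k)); last first.
  by apply: ler_wpM2r; [rewrite exprn_ge0// ltW|exact: (@card_edges_le R _ _ _ unif k1)].
rewrite mulr_natl -sumr_const; apply: ler_sum => e eE.
by rewrite -(unif eE) -prodr_const; apply: ler_prod => u _.
Qed.

(** Taking [y] as the image of any [y0] near the iterate covers two cases: inner steps have
    [y0 = Fiter b m], the last step has the true fixed point, [y = y0 = xs]. A step costs the rate
    error over [N] plus [grid_const] over [N ^ 2]. *)
Lemma grid_step (N K m : nat) (a b : R) (y y0 : V -> R) :
  (0 < N)%N -> rho ^+ m <= N%:R^-1 -> (k + m * k <= K)%N ->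
  0 <= a -> a < b -> b <= zeta -> b - a <= N%:R^-1 ->
  (forall u, 0 <= y0 u <= c) -> message_close E (rho ^+ m * Num.sqrt C) (Fiter b m) y0 ->
  (forall u, y u = Fmap E c b y0 u) ->
  `|(ln (pf p b set0 E) - ln (pf p a set0 E))
    - D * (Bethe E c b y - Bethe E c a (Fiter a m.+1))|
  <= D * #|V|%:R * N%:R^-1 *
     (2 * c ^+ k * (k%:R * marginal_err k c eps rho K m + 2 * eps) + eps * c ^+ k
      + grid_const / N%:R).
Proof.
move=> N0 rm kK a0 ab bz baN y0b y0c yE.
have [r0 r1] := andP rho01; have [z0 z1] := andP zeta01.
have e0 := tame_eps0 tm; have p01 := tame_p01 tm eps1.
set v : R := #|V|%:R; set h : R := N%:R^-1.
have h0 : 0 < h by rewrite invr_gt0 ltr0n.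
have v0 : 0 <= v by [].
have a01 : 0 <= a <= 1 by rewrite a0/=; exact: le_trans (ltW ab) (le_trans bz z1).
have b01 : 0 <= b <= 1 by rewrite (le_trans a0 (ltW ab))/=; exact: le_trans bz z1.
have yF : y = Fmap E c b y0 by apply: boolp.funext.
have sC := sqrtr_ge0 C.
have L0 : 0 <= lip_const by exact: lip_const_ge0 c0 rho01.
have S0 := step_lip_ge0.
have E0 := set0_notin k2 tm.
have rmC : 0 <= rho ^+ m * Num.sqrt C by rewrite mulr_ge0// exprn_ge0.
have close s : 0 <= s <= 1 -> s <= zeta -> `|s - b| <= h ->
    forall u, `|y u - Fiter s m.+1 u| <= step_lip * h.
  move=> s01 sz sb u; rewrite distrC yF.
  have hs : s * (k.-1)%:R * C <= rho ^+ 2 * expR 1.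
    by apply: hrho_le; rewrite sz andbT; case/andP: s01.
  have hl := Fiter_lip unif c0 d0 rho01 m s01 b01 hs.
  have := message_close_trans hl y0c => hm.
  have t0 : 0 <= lip_const * `|s - b| + rho ^+ m * Num.sqrt C.
    by rewrite addr_ge0// mulr_ge0.
  apply: le_trans (Fmap_dist unif c0 d0 u s01 b01 (fun u => Fiter_bounds_le E c0 m u s01)
     y0b t0 hm) _.
  rewrite /step_lip -[leRHS]mulrA ler_wpM2l ?(ltW c0)// [leRHS]mulrDl.
  apply: lerD; first by rewrite mulrC ler_wpM2l ?(ltW C0).
  rewrite -[leRHS]mulrA ler_wpM2l ?mulr_ge0// [leRHS]mulrDl.
  by apply: lerD; [rewrite ler_wpM2l|rewrite mulrC ler_wpM2l].
have [t [/andP[at_ tb] ->]] := ln_pf_MVT p01 E0 ab (proj2 (andP b01)).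
have t0 : 0 <= t by exact: le_trans a0 (ltW at_).
have tz : t <= zeta by exact: le_trans (ltW tb) bz.
have t01 : 0 <= t < 1 by rewrite t0/=; exact: lt_le_trans tb (proj2 (andP b01)).
have t01' : 0 <= t <= 1 by rewrite t0/= ltW//; case/andP: t01.
have ht : t * (k.-1)%:R * C <= rho ^+ 2 * expR 1 by apply: hrho_le; rewrite t0.
set w := Fiter t m.+1.
set x := Fiter a m.+1.
have yx u : `|y u - x u| <= step_lip * h.
  apply: close => //; first by exact: le_trans (ltW ab) bz.
  by rewrite distrC ger0_norm// subr_ge0 ltW.
have yw u : `|y u - w u| <= step_lip * h.
  apply: close => //; rewrite distrC ger0_norm ?subr_ge0 ?(ltW tb)//.
  by apply: le_trans baN; rewrite lerD2l lerN2 ltW.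
have Lh0 : 0 <= step_lip * h by rewrite mulr_ge0// ltW.
have xb u : c * expR (- C) <= x u <= c.
  rewrite {1}/x /= (Fmap_ge unif c0 d0)//=; first by case/andP: (Fiter_bounds_le E c0 m.+1 u a01).
  by move=> u'; exact: Fiter_bounds_le.
have yb u : c * expR (- C) <= y u <= c.
  rewrite yF (Fmap_ge unif c0 d0)//=.
  by have /andP[] := Fmap_bounds E c0 u (proj1 (andP b01)) (fun u => proj1 (andP (y0b u))).
have yb0 u : 0 <= y u <= c.
  case/andP: (yb u) => y1 ->; rewrite andbT; apply: le_trans y1.
  by rewrite mulr_ge0 ?expR_ge0 ?(ltW c0).
(* [x] is the image of [Fiter a m], whose messages are within [rho ^+ m * Num.sqrt C] of its own, so
   it is stationary up to [2 * C * rho ^+ m]. *)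
have stat u : `|ln (x u / c) + a / d * \sum_(e in E | u \in e) \prod_(w in e :\ u) x w|
    <= 2 * C * h.
  have ha : a * (k.-1)%:R * C <= rho ^+ 2 * expR 1.
    by apply: hrho_le; rewrite a0/=; exact: le_trans (ltW ab) bz.
  have hc := Fiter_succ_close unif c0 d0 rho01 m a01 ha.
  have := Fmap_close unif c0 d0 u a01 a01 (fun u => Fiter_bounds_le E c0 m u a01)
    (fun u => Fiter_bounds_le E c0 m.+1 u a01) rmC hc.
  rewrite -[Fmap E c a (Fiter a m) u]/(x u) -/x [ln (Fmap E c a x u / c)]ln_Fmap// opprK.
  move=> hh; apply: (le_trans hh); rewrite subrr normr0 mul0r add0r.
  have -> : 2 * Num.sqrt C * (rho ^+ m * Num.sqrt C) = 2 * Num.sqrt C ^+ 2 * rho ^+ m by ring.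
  by rewrite sqr_sqrtr ?(ltW C0)// ler_wpM2l ?mulr_ge0 ?(ltW C0).
have M1 : 1 <= 1 + c by rewrite lerDl ltW.
have cM : c <= 1 + c by rewrite lerDr.
have hB := Bethe_diff unif k1 c0 d0 b a01 Lh0 M1 cM xb yb yx stat.
set SY := \sum_(e in E) \prod_(u in e) y u in hB.
set SW : R := \sum_(e in E) \prod_(u in e) w u.
set dB := Bethe E c b y - Bethe E c a x in hB *.
have hrate : `|edge_rate E p t - p ^+ k / c ^+ k * SW| <=
    2 * c ^+ k * (D * v) * (k%:R * marginal_err k c eps rho K m + 2 * eps).
  have := edge_rate_approx k2 c0 tm eps1 t01 rho01 ht kK; rewrite -/w -/SW => hh.
  apply: (le_trans hh); rewrite mulrA ler_wpM2r//; last exact: scaled_edges.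
  rewrite addr_ge0 ?mulr_ge0 ?(ltW e0)// /marginal_err addr_ge0//.
    by rewrite mulr_ge0 ?(ltW e0)// (step_err_ge0 _ c0).
  by rewrite !mulr_ge0// (depth_err_ge0 c0 tm rho01).
have hSW := sum_edges_le (fun u => Fiter_bounds_le E c0 m.+1 u t01').
rewrite -/w -/SW -/v in hSW.
have h2 : `|p ^+ k / c ^+ k * SW - D / d * SW| <= D * v * (eps * c ^+ k).
  rewrite -mulrBl normrM; case/andP: hSW => SW0 SW1; rewrite (ger0_norm SW0).
  apply: (@le_trans _ _ (eps * (D / d) * (d * v * c ^+ k))).
    by apply: ler_pM => //; exact: scaled_pk.
  by apply: eq_ler; field; rewrite gt_eqF.
have h3 : `|D / d * SW - D / d * SY| <= D * v * (k%:R * (1 + c) ^+ k * (step_lip * h)).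
  rewrite -mulrBr normrM gtr0_norm ?divr_gt0//.
  apply: (@le_trans _ _ (D / d * (d * v * (k%:R * (1 + c) ^+ k * (step_lip * h))))); last first.
    by apply: eq_ler; field; rewrite gt_eqF.
  rewrite ler_wpM2l ?divr_ge0 ?(ltW D0) ?(ltW d0)// -sumrB.
  apply: le_trans (ler_norm_sum _ _ _) _.
  apply: (@le_trans _ _ (#|E|%:R * (k%:R * (1 + c) ^+ k * (step_lip * h)))); last first.
    apply: ler_wpM2r; last exact: (@card_edges_le R _ _ _ unif k1).
    by rewrite mulr_ge0// mulr_ge0// exprn_ge0// (le_trans _ M1).
  rewrite mulr_natl -sumr_const; apply: ler_sum => e eE.
  have cb (z : V -> R) : (forall u, 0 <= z u <= c) -> forall u, 0 <= z u <= 1 + c.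
    by move=> zb u; case/andP: (zb u) => -> zc; exact: le_trans zc _.
  have wy u : `|w u - y u| <= step_lip * h by rewrite distrC; exact: yw.
  move: (unif eE); set L := step_lip * h in Lh0 wy * => <-.
  exact: prod_dist M1 Lh0 (cb _ yb0) (cb _ (fun u => Fiter_bounds_le E c0 m.+1 u t01')) wy.
have h4 := dist_le_three hrate h2 h3.
(* The edge sum at [y] cancels: the explicit [s]-derivative of the Bethe free energy is minus that
   sum over [d], which is what the rate integrates to after scaling by [D]. *)
have -> : - edge_rate E p t * (b - a) - D * dB =
   - ((b - a) * (edge_rate E p t - D / d * SY)) - D * (dB + (b - a) / d * SY) by ring.
apply: le_trans (ler_normB _ _) _; rewrite normrN !normrM (gtr0_norm D0).
rewrite [`|b - a|]ger0_norm ?subr_ge0 ?(ltW ab)//.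
apply: (@le_trans _ _ (h * (2 * c ^+ k * (D * v) *
        (k%:R * marginal_err k c eps rho K m + 2 * eps) +
       D * v * (eps * c ^+ k) +
       D * v * (k%:R * (1 + c) ^+ k * (step_lip * h))) +
   D * (v * (step_lip * h * (2 * C * h) + bethe_curv k c (1 + c) * (step_lip * h) ^+ 2)))).
  apply: lerD; last by rewrite ler_wpM2l ?(ltW D0).
  by apply: ler_pM; rewrite // subr_ge0 ltW.
by apply: eq_ler; rewrite /grid_const -/C -/h; ring.
Qed.

Lemma Fiter_s0 m v : Fiter 0 m v = c.
Proof. by case: m => [//|m] /=; rewrite /Fmap mul0r oppr0 mul0r expR0 mulr1. Qed.

Lemma Bethe_s0 m : Bethe E c 0 (Fiter 0 m) = c * #|V|%:R.
Proof.
rewrite /Bethe mul0r oppr0 mul0r sub0r.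
under eq_bigr do rewrite Fiter_s0 divff ?gt_eqF// ln1 sub0r mulrN1.
by rewrite sumrN opprK sumr_const mulr_natr.
Qed.

(** Telescoping over [N] equal steps from [s = 0], where the log partition function vanishes and the
    Bethe free energy is [c * #|V|%:R]; this is the origin of the subtracted term. *)
Lemma free_energy_grid (N K m : nat) (xs : V -> R) :
  (0 < N)%N -> rho ^+ m <= N%:R^-1 -> (k + m * k <= K)%N ->
  in_box c xs -> is_fixed_point E c zeta xs ->
  `|ln (pf p zeta set0 E) - D * (Bethe E c zeta xs - c * #|V|%:R)|
  <= D * #|V|%:R *
     (2 * c ^+ k * (k%:R * marginal_err k c eps rho K m + 2 * eps) + eps * c ^+ k
      + grid_const / N%:R).
Proof.
move=> N0 rm kK xb xF; have [z0 z1] := andP zeta01; have [r0 r1] := andP rho01.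
set err := _ + grid_const / _.
pose s i : R := zeta * i%:R / N%:R.
have Np : 0 < N%:R :> R by rewrite ltr0n.
have sS i : s i.+1 - s i = zeta / N%:R by rewrite /s -natr1; ring.
have s0 i : 0 <= s i by rewrite /s divr_ge0// mulr_ge0// ltW.
have sz i : (i <= N)%N -> s i <= zeta.
  by move=> iN; rewrite /s ler_pdivrMr// ler_wpM2l ?(ltW z0)// ler_nat.
have sle i : s i < s i.+1 by rewrite -subr_gt0 sS divr_gt0.
have sN i : s i.+1 - s i <= N%:R^-1.
  by rewrite sS ler_piMl// invr_ge0 ltW.
have grid i : (i < N)%N ->
    `|ln (pf p (s i) set0 E) - D * (Bethe E c (s i) (Fiter (s i) m.+1) - c * #|V|%:R)|
    <= D * #|V|%:R * (i%:R / N%:R) * err.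
  elim: i => [|i IH] iN.
    have -> : s 0%N = 0 by rewrite /s mulr0 mul0r.
    by rewrite pf_s0 ln1 Bethe_s0 subrr mulr0 subrr normr0 !mul0r mulr0 mul0r.
  have {}IH := IH (ltnW iN).
  have s01 : 0 <= s i.+1 <= 1 by rewrite s0/= (le_trans (sz _ (ltnW iN))).
  have cl : message_close E (rho ^+ m * Num.sqrt C) (Fiter (s i.+1) m) (Fiter (s i.+1) m).
    by move=> u e eE ue; rewrite subrr normr0 mulr_ge0 ?exprn_ge0.
  have := grid_step N0 rm kK (s0 i) (sle i) (sz _ (ltnW iN)) (sN i)
    (fun u => Fiter_bounds_le E c0 m u s01) cl (fun u => erefl _).
  rewrite -/err -/(Fiter (s i.+1) m.+1) => hs.
  have -> : D * #|V|%:R * (i.+1%:R / N%:R) * err =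
     D * #|V|%:R * N%:R^-1 * err + D * #|V|%:R * (i%:R / N%:R) * err by rewrite -natr1; ring.
  exact: telescope_bound hs IH.
have NE : N.-1.+1 = N by rewrite prednK.
have {}grid : _ := grid N.-1 ltac:(by rewrite NE).
have sNz : s N.-1.+1 = zeta by rewrite NE /s mulfK// gt_eqF.
have zz : 0 <= zeta <= 1 by rewrite ltW.
have cl := Fiter_fixed_close unif c0 d0 rho01 m zz hrho xb xF.
(* The last step lands on the given fixed point instead of an iterate. *)
have := grid_step (y := xs) (y0 := xs) N0 rm kK (s0 N.-1) (sle N.-1)
  (sz N.-1.+1 ltac:(by rewrite NE)) (sN N.-1) xb.
rewrite sNz => /(_ cl (fun u => esym (xF u))) hs.
rewrite -/err in hs.
have -> : D * #|V|%:R * err =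
     D * #|V|%:R * N%:R^-1 * err + D * #|V|%:R * (N.-1%:R / N%:R) * err.
  have -> : N.-1%:R = N%:R - 1 :> R by rewrite -[in RHS]NE -natr1 addrK.
  by field; rewrite gt_eqF.
exact: telescope_bound hs grid.
Qed.

End FreeEnergy.

(** * Lower tail probabilities *)

Section Probability.
Import mathcomp.boot.finset mathcomp.boot.fintype.
Variables (R : realType) (V : finType) (E : {set {set V}}).
Implicit Types (p s q mu delta : R) (S T e f : {set V}).

Notation cnt T := ((numX E T)%:R : R).

Lemma probp_gt0 p (A : pred {set V}) : 0 < p < 1 -> A set0 -> 0 < probp p A.
Proof.
move=> p01 A0; rewrite /probp (bigD1 set0)//= ltr_pwDl//; first exact: bwt_gt0.
by apply: sumr_ge0 => T _; exact: ltW (bwt_gt0 p01 T).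
Qed.

Lemma numX0 : set0 \notin E -> numX E set0 = 0%N.
Proof.
move=> E0; apply/eqP; rewrite cards_eq0; apply/eqP/setP => f; rewrite !inE subset0.
by apply/negP => /andP[fE /eqP f0]; rewrite f0 (negbTE E0) in fE.
Qed.

Lemma tilt_expR s T : s < 1 -> (1 - s) ^+ numX E T = expR (ln (1 - s) * cnt T).
Proof. by move=> s1; rewrite expRM_natr lnK// posrE subr_gt0. Qed.

Lemma lower_tail_markov p s mu : 0 < p < 1 -> 0 <= s < 1 ->
  probp p (fun T => cnt T <= mu) <= expR (- ln (1 - s) * mu) * pf p s set0 E.
Proof.
move=> p01 /andP[s0 s1]; rewrite /pf /probp mulr_sumr.
rewrite [leRHS](eq_bigl predT); last by move=> T; rewrite sub0set.
rewrite big_mkcond/=; apply: ler_sum => T _.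
have b0 := bwt_gt0 p01 T; rewrite tilt_expR// mulrCA -expRD.
case: ifP => XT; last by rewrite mulr_ge0 ?expR_ge0 ?ltW.
rewrite ler_peMr ?(ltW b0)// -[leLHS]expR0 ler_expR mulNr addrC subr_ge0.
by apply: ler_wnM2l => //; apply: ln_le0; lra.
Qed.

Lemma probp0_pf1 p : probp p (fun T => numX E T == 0%N) = pf p 1 set0 E.
Proof.
rewrite /pf /probp [RHS](eq_bigl predT); last by move=> T; rewrite sub0set.
rewrite big_mkcond/=; apply: eq_bigr => T _.
by rewrite subrr expr0n; case: eqP => _; rewrite ?mulr1// mulr0.
Qed.

Lemma sum_tilt_numX p s : \sum_(T : {set V}) bwt p T * (1 - s) ^+ numX E T * cnt T =
  \sum_(e in E) pf p s e E.
Proof.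
rewrite /pf (exchange_big_dep predT)//=; apply: eq_bigr => T _.
rewrite mulr_natr -sumr_const; apply: eq_bigl => e.
by rewrite inE.
Qed.

Lemma sum_tilt_numX2 p s :
  \sum_(T : {set V}) bwt p T * (1 - s) ^+ numX E T * cnt T ^+ 2 =
  \sum_(e in E) \sum_(f in E) pf p s (e :|: f) E.
Proof.
transitivity (\sum_(e in E) \sum_(T : {set V} | e \subset T)
    bwt p T * (1 - s) ^+ numX E T * cnt T).
  rewrite (exchange_big_dep predT)//=; apply: eq_bigr => T _.
  rewrite expr2 mulrA [RHS](eq_bigl (mem [set e in E | e \subset T])); last first.
    by move=> e; rewrite !inE.
  by rewrite sumr_const mulr_natr.
apply: eq_bigr => e eE; rewrite /pf.
rewrite (exchange_big_dep (fun T => e \subset T))/=; last first.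
  by move=> f T fE; rewrite subUset => /andP[].
apply: eq_bigr => T eT; rewrite mulr_natr -sumr_const; apply: eq_bigl => f.
by rewrite inE subUset eT.
Qed.

(** In the window [(1 - s) ^+ numX E T] is at most [expR (ln (1 - s) * ((1 - delta) * mu))], so
    removing the tilt multiplies each weight by at least the inverse. *)
Lemma tilt_lower p s mu delta : 0 < p < 1 -> 0 <= s < 1 ->
  expR (- ln (1 - s) * ((1 - delta) * mu)) *
    (\sum_(T : {set V} | `|cnt T - mu| <= delta * mu) bwt p T * (1 - s) ^+ numX E T)
  <= probp p (fun T => cnt T <= (1 + delta) * mu).
Proof.
move=> p01 /andP[s0 s1]; rewrite /probp mulr_sumr.
apply: (@le_trans _ _ (\sum_(T : {set V} | `|cnt T - mu| <= delta * mu) bwt p T)).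
  apply: ler_sum => T; rewrite ler_norml => /andP[XT _].
  have b0 := bwt_gt0 p01 T; rewrite tilt_expR// mulrCA -expRD.
  rewrite ler_piMr ?(ltW b0)// expR_le1 mulNr addrC subr_le0.
  by apply: ler_wnM2l; [apply: ln_le0; lra|lra].
rewrite [leRHS](bigID (fun T => `|cnt T - mu| <= delta * mu))/=.
rewrite -[leLHS]addr0; apply: lerD; last first.
  by apply: sumr_ge0 => T _; exact: ltW (bwt_gt0 p01 T).
apply: eq_ler; apply: eq_bigl => T; apply/idP/andP => [h|[]//].
by split=> //; move: h; rewrite ler_norml => /andP[_]; lra.
Qed.

(** The tilted measure is not normalised, so its moments appear as [m1] and [m2] times
    [pf p s set0 E]; the allowance [(delta * mu) ^+ 2 / 2] leaves half of the mass in the window. *)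
Lemma tilt_chebyshev p s mu delta m1 m2 : 0 < p < 1 -> 0 <= s < 1 -> 0 < delta * mu ->
  \sum_(T : {set V}) bwt p T * (1 - s) ^+ numX E T * cnt T = m1 * pf p s set0 E ->
  \sum_(T : {set V}) bwt p T * (1 - s) ^+ numX E T * cnt T ^+ 2 = m2 * pf p s set0 E ->
  m2 - 2 * mu * m1 + mu ^+ 2 <= (delta * mu) ^+ 2 / 2 ->
  pf p s set0 E / 2 <=
    \sum_(T : {set V} | `|cnt T - mu| <= delta * mu) bwt p T * (1 - s) ^+ numX E T.
Proof.
move=> p01 s01 dm h1 h2 hv; have [s0 s1] := andP s01.
pose w T := bwt p T * (1 - s) ^+ numX E T.
have w0 T : 0 <= w T.
  by rewrite mulr_ge0 ?(ltW (bwt_gt0 p01 T))// exprn_ge0// subr_ge0 ltW.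
have ZE : pf p s set0 E = \sum_T w T by apply: eq_bigl => T; rewrite sub0set.
have Z0 := pf_gt0 p01 s01 set0 E.
have var : \sum_T w T * (cnt T - mu) ^+ 2 =
    (m2 - 2 * mu * m1 + mu ^+ 2) * pf p s set0 E.
  rewrite (eq_bigr (fun T => w T * cnt T ^+ 2 - 2 * mu * (w T * cnt T) + mu ^+ 2 * w T)).
    by rewrite big_split/= sumrB -!mulr_sumr h1 h2 -ZE; ring.
  by move=> T _; set x := cnt T; set y := w T; ring.
have out : (delta * mu) ^+ 2 * (\sum_(T | ~~ (`|cnt T - mu| <= delta * mu)) w T) <=
    (delta * mu) ^+ 2 / 2 * pf p s set0 E.
  apply: (@le_trans _ _ (\sum_T w T * (cnt T - mu) ^+ 2)); last first.
    by rewrite var ler_wpM2r// ltW.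
  rewrite [leRHS](bigID (fun T => `|cnt T - mu| <= delta * mu))/= -[leLHS]add0r.
  apply: lerD; first by apply: sumr_ge0 => T _; rewrite mulr_ge0 ?sqr_ge0.
  rewrite mulr_sumr; apply: ler_sum => T; rewrite -ltNge => /ltW h.
  rewrite mulrC ler_wpM2l// -[(cnt T - mu) ^+ 2]real_normK ?num_real//.
  by rewrite ler_pXn2r ?nnegrE ?(ltW dm).
have dm2 : 0 < (delta * mu) ^+ 2 by rewrite exprn_gt0.
rewrite -mulrA ler_pM2l// in out.
have : pf p s set0 E = \sum_(T | `|cnt T - mu| <= delta * mu) w T +
    \sum_(T | ~~ (`|cnt T - mu| <= delta * mu)) w T.
  by rewrite {1}ZE (bigID (fun T => `|cnt T - mu| <= delta * mu)).
move: out; rewrite -/w; set a := pf p s set0 E; set b := \sum_(T | ~~ _) _.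
by set b' := \sum_(T | _) _; lra.
Qed.

(** Expansion of a product over vertices in which forbidden choices get weight [0]; the sum is the
    probability that a [q]-random subset of [T] contains [e]. *)
Lemma sum_thin q T e : e \subset T ->
  \sum_(S : {set V} | (S \subset T) && (e \subset S))
    q ^+ #|S| * (1 - q) ^+ (#|T| - #|S|) = q ^+ #|e|.
Proof.
move=> eT.
pose F v := if v \in T then q else 0.
pose G v := if v \in T then (if v \in e then 0 else 1 - q) else 1.
have := prod_add_sets F G.
have -> : \prod_(i : V) (F i + G i) = q ^+ #|e|.
  have -> : q ^+ #|e| = q ^+ #|e| * 1 ^+ (#|V| - #|e|) by rewrite expr1n mulr1.
  rewrite -prod_mem_set; apply: eq_bigr => v _; rewrite /F /G.
  case: (boolP (v \in T)) => vT.
    by case: ifP => _; [rewrite addr0|rewrite addrC subrK].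
  by rewrite add0r; case: ifP => // ve; rewrite (subsetP eT) in vT.
move=> ->; rewrite [RHS](bigID (fun S => (S \subset T) && (e \subset S)))/=.
rewrite [X in _ = _ + X]big1 ?addr0.
  apply: eq_bigr => S /andP[ST eS].
  rewrite (bigID (mem S))/=; congr (_ * _).
    rewrite -prodr_const; apply: eq_bigr => v vS; rewrite vS /F.
    by rewrite (subsetP ST).
  rewrite -[in (#|T| - #|S|)%N](setIidPr ST) -cardsD -prodr_const.
  rewrite [RHS](bigID (mem T))/= [X in _ = _ * X]big1 ?mulr1.
    apply: eq_big => v; first by rewrite inE.
    rewrite inE => /andP[vS vT]; rewrite (negbTE vS) /G vT.
    by case: ifP => // /(subsetP eS); rewrite (negbTE vS).
  by move=> v /andP[/negbTE -> /negbTE vT]; rewrite /G vT.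
move=> S; rewrite negb_and => /orP[] /subsetPn[v v1 v2];
  apply/eqP; rewrite prodf_seq_eq0; apply/hasP; exists v;
  rewrite ?mem_index_enum//=.
  by rewrite v1 /F (negbTE v2).
by rewrite (negbTE v2) /G (subsetP eT)// v1.
Qed.

Lemma mean_thin (k : nat) q T : kuniform E k ->
  \sum_(S : {set V} | S \subset T) q ^+ #|S| * (1 - q) ^+ (#|T| - #|S|) * cnt S =
  q ^+ k * cnt T.
Proof.
move=> unif.
transitivity (\sum_(e in E | e \subset T) \sum_(S : {set V} | (S \subset T) && (e \subset S))
    q ^+ #|S| * (1 - q) ^+ (#|T| - #|S|)).
  rewrite (exchange_big_dep (fun S => S \subset T))/=; last by move=> e S _ /andP[].
  apply: eq_bigr => S ST; rewrite mulr_natr -sumr_const; apply: eq_bigl => e.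
  rewrite inE ST/= -andbA; case: (e \in E) => //=.
  by apply/esym/andb_idl => eS; exact: subset_trans ST.
rewrite mulr_natr -sumr_const; apply: eq_big => [e|e /andP[eE eT]]; first by rewrite inE.
by rewrite sum_thin// unif.
Qed.

(* Markov's inequality for the thinned set shows that thinning pushes the count
   from slightly above [mu] to below [mu] with positive probability. *)
Lemma thinning_lower (k : nat) p q mu delta : kuniform E k -> (1 <= k)%N ->
  0 < p < 1 -> 0 <= q <= 1 -> 0 < mu -> 0 <= delta ->
  (1 - q * (1 + delta)) * probp p (fun T => cnt T <= (1 + delta) * mu)
  <= probp (p * q) (fun S => cnt S <= mu).
Proof.
move=> unif k1 p01 /andP[q0 q1] mu0 d0.
have qk : q ^+ k <= q by rewrite -[leRHS]expr1 ler_wiXn2l.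
pose wt T S : R := q ^+ #|S| * (1 - q) ^+ (#|T| - #|S|).
have wt0 T S : 0 <= wt T S by rewrite mulr_ge0// exprn_ge0// subr_ge0.
have -> : probp (p * q) (fun S => cnt S <= mu) =
    \sum_(T : {set V}) bwt p T * \sum_(S : {set V} | (S \subset T) && (cnt S <= mu)) wt T S.
  transitivity (\sum_(S : {set V} | cnt S <= mu) \sum_(T : {set V} | S \subset T) bwt p T * wt T S).
    by apply: eq_bigr => S _; rewrite -[LHS]/(bwt (p * q) S) -bwt_thin.
  rewrite (exchange_big_dep predT)//=; apply: eq_bigr => T _; rewrite mulr_sumr.
  by apply: eq_bigl => S; rewrite andbC.
rewrite /probp mulr_sumr big_mkcond/=; apply: ler_sum => T _.
have b0 := bwt_gt0 p01 T.
case: ifP => XT; last by rewrite mulr_ge0 ?(ltW b0)// sumr_ge0.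
rewrite mulrC ler_wpM2l ?(ltW b0)//.
have tot : \sum_(S : {set V} | S \subset T) wt T S = 1.
  have := @sum_thin q T set0 (sub0set T); rewrite cards0 expr0 => <-.
  by apply: eq_bigl => S; rewrite sub0set andbT.
have big : \sum_(S : {set V} | (S \subset T) && ~~ (cnt S <= mu)) wt T S <= q * (1 + delta).
  have mk : mu * (\sum_(S : {set V} | (S \subset T) && ~~ (cnt S <= mu)) wt T S) <= q ^+ k * cnt T.
    rewrite -(mean_thin q T unif) [leRHS](bigID (fun S => cnt S <= mu))/= -[leLHS]add0r.
    apply: lerD; first by apply: sumr_ge0 => S _; rewrite mulr_ge0// wt0.
    rewrite mulr_sumr; apply: ler_sum => S /andP[_]; rewrite -ltNge => /ltW h.
    by rewrite mulrC ler_wpM2l// wt0.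
  rewrite -(ler_pM2l mu0); apply: (le_trans mk).
  rewrite [leRHS]mulrC -mulrA; apply: ler_pM => //; first exact: exprn_ge0.
move: tot; rewrite (bigID (fun S => cnt S <= mu))/= => tot.
by move: big tot; set a := \sum_(S | _ && ~~ _) _; set b := \sum_(S | _) _; lra.
Qed.

(** Undoes the loss of density caused by thinning. Occupied vertices only gain weight, so pointwise
    the likelihood ratio is at least [((1 - p) / (1 - p * q)) ^+ #|V|]. *)
Lemma density_lower p q (A : pred {set V}) : 0 < p <= 4^-1 -> 0 <= q <= 1 ->
  expR (- (4 * (1 - q) * p * #|V|%:R)) * probp (p * q) A <= probp p A.
Proof.
move=> /andP[p0 p4] /andP[q0 q1].
have pq : 0 <= p * q <= p by rewrite mulr_ge0 ?(ltW p0)//= ler_piMr// ltW.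
have p1 : 0 < 1 - p by lra.
have pq1 : 0 < 1 - p * q by lra.
set r := (1 - p) / (1 - p * q).
have r0 : 0 < r by rewrite divr_gt0.
have r1 : r <= 1 by rewrite ler_pdivrMr// mul1r lerD2l lerN2; case/andP: pq.
have lr : - (4 * (1 - q) * p) <= ln r.
  pose u := p * (1 - q) / (1 - p * q).
  have -> : r = 1 - u by rewrite /r /u; field; rewrite gt_eqF.
  have q1' : 0 <= 1 - q by lra.
  have u0 : 0 <= u by rewrite /u divr_ge0 ?(ltW pq1)// mulr_ge0// ltW.
  have u2 : u <= 2 * (p * (1 - q)).
    rewrite ler_pdivrMr//; have : 0 <= p * (1 - q) by rewrite mulr_ge0// ltW.
    by move=> h; case/andP: pq => *; nra.
  have p1q : p * (1 - q) <= p by rewrite ler_piMr ?(ltW p0)//; lra.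
  have ub : 0 <= u <= 2^-1 by rewrite u0/=; lra.
  have /andP[h _] := ln1B_bounds ub.
  have := dbl_sqr_le ub; lra.
have re : expR (- (4 * (1 - q) * p * #|V|%:R)) <= r ^+ #|V|.
  by rewrite -[r]lnK ?posrE// -expRM_natr ler_expR -mulNr ler_wpM2r.
rewrite /probp mulr_sumr; apply: ler_sum => S _.
have SV : (#|S| <= #|V|)%N by exact: max_card.
apply: (@le_trans _ _ (r ^+ (#|V| - #|S|) * ((p * q) ^+ #|S| * (1 - p * q) ^+ (#|V| - #|S|)))).
  rewrite ler_wpM2r ?mulr_ge0 ?exprn_ge0 ?(ltW pq1)//; first by case/andP: pq.
  apply: (le_trans re); apply: ler_wiXn2l => //; [exact: ltW|exact: leq_subr].
rewrite mulrCA -exprMn divfK ?gt_eqF//; apply: ler_wpM2r; first by rewrite exprn_ge0// ltW.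
by apply: lerXn2r; rewrite ?nnegrE ?(ltW p0)//; case/andP: pq.
Qed.

End Probability.

Section Archimedean.
Local Open Scope classical_set_scope.
Local Open Scope ring_scope.
Variable R : realType.

Lemma exists_expr_le (rho h : R) : 0 <= rho < 1 -> 0 < h -> exists m, rho ^+ m <= h.
Proof.
move=> /andP[r0 r1] h0.
have /cvgr0Pnorm_le/(_ h h0) : (fun m => rho ^+ m) @ \oo --> (0 : R).
  by apply: cvg_expr; rewrite ger0_norm.
case=> m _ /(_ m (leqnn m)) /=; rewrite ger0_norm ?exprn_ge0// => hm.
by exists m.
Qed.

Lemma exists_div_le (A h : R) : 0 <= A -> 0 < h -> exists2 N, (0 < N)%N & A / N%:R <= h.
Proof.
move=> A0 h0; have Ah : 0 <= A / h by rewrite divr_ge0// ltW.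
exists (Num.bound (A / h)).+1 => //.
rewrite ler_pdivrMr ?ltr0n// mulrC -ler_pdivrMr//.
by apply: le_trans (ltW (archi_boundP Ah)) _; rewrite ler_nat.
Qed.

End Archimedean.

(** * Approximation uniform over tame hypergraphs *)

Section Approximation.
Import mathcomp.boot.finset mathcomp.boot.fintype.
Variable R : realType.

Definition err_slope (k : nat) (c rho : R) (K : nat) : R :=
  step_err k c K + c ^+ k.-1 * (k.-1)%:R * step_err k c K / (1 - rho).

Lemma marginal_errE (k : nat) (c eps rho : R) (K m : nat) : 0 < c -> rho < 1 ->
  marginal_err k c eps rho K m =
  err_slope k c rho K * eps + 2 * c ^+ k.-1 * rho ^+ m.
Proof.
move=> c0 r1; rewrite /marginal_err /depth_err /err_slope.
have sC : Num.sqrt (c ^+ k.-1) ^+ 2 = c ^+ k.-1 by rewrite sqr_sqrtr// exprn_ge0// ltW.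
set a := step_err _ _ _; set sq := Num.sqrt _ in sC *; rewrite -sC; field.
by rewrite subr_eq0 gt_eqF.
Qed.

Lemma err_slope_ge0 (k : nat) (c rho : R) (K : nat) : 0 < c -> 0 <= rho < 1 ->
  0 <= err_slope k c rho K.
Proof.
move=> c0 /andP[r0 r1]; have h := step_err_ge0 k c0 K; have c1 := ltW c0.
rewrite /err_slope addr_ge0// divr_ge0 ?subr_ge0 ?(ltW r1)//.
by rewrite !mulr_ge0// exprn_ge0.
Qed.

(** Order of choices: the number [N] of grid steps, then the depth [m], then the size [K] of
    conditioning sets, and last [eps]. By [marginal_errE] the part of the error not linear in [eps]
    is controlled by [rho ^+ m]. *)
Lemma free_energy_approx (k : nat) (c rho e : R) : (2 <= k)%N -> 0 < c ->
  0 <= rho < 1 -> 0 < e ->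
  exists2 e0 : R, 0 < e0 & forall (V : finType) (E : {set {set V}}) (p D eps zeta : R) (xs : V -> R),
    eps <= e0 -> tame E k c p eps -> scaled E k c p D eps -> 0 < zeta <= 1 ->
    zeta * (k.-1)%:R * c ^+ k.-1 <= rho ^+ 2 * expR 1 ->
    in_box c xs -> is_fixed_point E c zeta xs ->
    `|ln (pf p zeta set0 E) - D * (Bethe E c zeta xs - c * #|V|%:R)| <= e * (D * #|V|%:R).
Proof.
move=> k2 c0 rho01 e_gt0; have [r0 r1] := andP rho01; have c1 := ltW c0.
set C : R := c ^+ k.-1.
have C0 : 0 <= C by rewrite exprn_ge0.
have ck0 : 0 <= c ^+ k by rewrite exprn_ge0.
have G0 : 0 <= grid_const k c rho.
  have S0 := step_lip_ge0 k c0 rho01.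
  have B0 : 0 <= bethe_curv k c (1 + c).
    rewrite /bethe_curv addr_ge0 ?mulr_ge0 ?exprn_ge0 ?invr_ge0 ?mulr_ge0 ?expR_ge0//.
    by rewrite addr_ge0.
  rewrite /grid_const addr_ge0//; last by rewrite mulr_ge0// exprn_ge0.
  rewrite addr_ge0//; last by rewrite mulr_ge0// mulr_ge0.
  by rewrite mulr_ge0// mulr_ge0// exprn_ge0// addr_ge0.
set A := 4 * c ^+ k * k%:R * C + grid_const k c rho.
have A0 : 0 <= A by rewrite /A addr_ge0// !mulr_ge0.
have [N N0 hN] := exists_div_le A0 (divr_gt0 e_gt0 (ltr0n R 2)).
have Ni : 0 < N%:R^-1 :> R by rewrite invr_gt0 ltr0n.
have [m hm] := exists_expr_le rho01 Ni.
pose K := (k + m * k)%N.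
pose Q := 2 * c ^+ k * (k%:R * err_slope k c rho K + 2) + c ^+ k.
have S0 := err_slope_ge0 k K c0 rho01.
have Q0 : 0 <= Q by rewrite /Q addr_ge0 ?mulr_ge0// addr_ge0 ?mulr_ge0.
exists (Num.min 2^-1 (e / 2 / (Q + 1))).
  by rewrite lt_min invr_gt0 ltr0n/= !divr_gt0// ltr_wpDl.
move=> V E p D eps zeta xs; rewrite le_min => /andP[eps1 eps2] tm sc z01 hr xb xF.
have := free_energy_grid k2 c0 tm sc eps1 z01 rho01 hr N0 hm (leqnn K) xb xF.
move=> h; apply: (le_trans h); rewrite mulrC ler_wpM2r//.
  by rewrite mulr_ge0//; case: sc => /ltW.
rewrite marginal_errE// -/C.
have eQ : eps * Q <= e / 2.
  have e0 := tame_eps0 tm.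
  apply: (@le_trans _ _ (eps * (Q + 1))); first by rewrite ler_wpM2l ?(ltW e0)// lerDl.
  by rewrite -ler_pdivlMr// ltr_wpDl.
have -> : 2 * c ^+ k * (k%:R * (err_slope k c rho K * eps + 2 * C * rho ^+ m) + 2 * eps)
   + eps * c ^+ k + grid_const k c rho / N%:R =
   eps * Q + (4 * c ^+ k * k%:R * C * rho ^+ m + grid_const k c rho / N%:R).
  by rewrite /Q; ring.
have : 4 * c ^+ k * k%:R * C * rho ^+ m <= 4 * c ^+ k * k%:R * C / N%:R.
  by rewrite ler_wpM2l// !mulr_ge0.
move: hN; rewrite /A mulrDl; lra.
Qed.

(** [W] may have up to [k] vertices because the second moment conditions on another edge; hence the
    extra [k] in [K]. *)
Lemma edge_approx (k : nat) (c rho e : R) : (2 <= k)%N -> 0 < c ->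
  0 <= rho < 1 -> 0 < e ->
  exists2 e0 : R, 0 < e0 & forall (V : finType) (E : {set {set V}}) (p eps s : R) (xs : V -> R),
    eps <= e0 -> tame E k c p eps -> 0 <= s < 1 ->
    s * (k.-1)%:R * c ^+ k.-1 <= rho ^+ 2 * expR 1 ->
    in_box c xs -> is_fixed_point E c s xs ->
    forall W f : {set V}, (#|W| <= k)%N -> f \in E -> [disjoint f & W] -> ~~ bad E W f ->
    `|pf p s (W :|: f) (E :\ f) / pf p s W E - p ^+ k * (\prod_(u in f) xs u / c ^+ k)|
      <= p ^+ k * e.
Proof.
move=> k2 c0 rho01 e_gt0; have [r0 r1] := andP rho01; have c1 := ltW c0.
set C : R := c ^+ k.-1.
have C0 : 0 <= C by rewrite exprn_ge0.
have ck0 : 0 < c ^+ k by rewrite exprn_gt0.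
set A := 2 * k%:R * C + k%:R * (1 + c) ^+ k * (c * (2 * C)) / c ^+ k.
have A0 : 0 <= A.
  rewrite /A addr_ge0//; first by rewrite !mulr_ge0.
  by rewrite divr_ge0 ?(ltW ck0)// !mulr_ge0// exprn_ge0// addr_ge0.
have A1 : 0 < A + 1 by rewrite ltr_wpDl.
have e2 : 0 < e / 2 by rewrite divr_gt0.
have [m hm] := exists_expr_le rho01 (divr_gt0 e2 A1).
pose K := (k + k + m * k)%N.
pose Q := k%:R * err_slope k c rho K + 2.
have S0 := err_slope_ge0 k K c0 rho01.
have Q0 : 0 < Q by rewrite /Q ltr_wpDl// mulr_ge0.
exists (Num.min 2^-1 (e / 2 / Q)).
  by rewrite lt_min invr_gt0 ltr0n/= !divr_gt0.
move=> V E p eps s xs; rewrite le_min => /andP[eps1 eps2] tm s01 hr xb xF W f Wk fE fW fb.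
have WK : (#|W| + k + m * k <= K)%N by rewrite !leq_add2r.
have h := edge_prob k2 c0 tm eps1 s01 rho01 hr WK fE fW fb.
have pk0 : 0 < p ^+ k by rewrite exprn_gt0// (tame_p0 tm).
have s01' : 0 <= s <= 1 by case/andP: s01 => -> /ltW.
have d0 := tame_d0 tm; have unif := tame_unif tm.
have cl := Fiter_fixed_close unif c0 d0 rho01 m s01' hr xb xF.
have rC0 : 0 <= rho ^+ m * Num.sqrt C by rewrite mulr_ge0 ?exprn_ge0 ?sqrtr_ge0.
have dist u : `|Fiter E c s m.+1 u - xs u| <= c * (2 * C) * rho ^+ m.
  rewrite -(xF u).
  have := Fmap_dist unif c0 d0 u s01' s01' (fun u => Fiter_bounds_le E c0 m u s01') xb rC0 cl.
  rewrite subrr normr0 mul0r add0r => hh; apply: (le_trans hh).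
  have sC : Num.sqrt C ^+ 2 = C by rewrite sqr_sqrtr.
  move: sC; set q := Num.sqrt C => sC.
  by apply: eq_ler; rewrite -sC; ring.
have Mb (z : V -> R) : (forall u, 0 <= z u <= c) -> forall u, 0 <= z u <= 1 + c.
  by move=> zb u; case/andP: (zb u) => -> zc /=; apply: (le_trans zc); rewrite lerDr.
have M1 : 1 <= 1 + c by rewrite lerDl.
have T0 : 0 <= c * (2 * C) * rho ^+ m by rewrite !mulr_ge0// exprn_ge0.
have := prod_dist f M1 T0 (Mb _ xb) (Mb _ (fun u => Fiter_bounds_le E c0 m.+1 u s01')) dist.
rewrite (unif _ fE) => hprod.
set Py := \prod_(u in f) Fiter E c s m.+1 u in h hprod.
set Px := \prod_(u in f) xs u in hprod *.
set P := pf p s _ _ / _ in h *.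
have -> : P - p ^+ k * (Px / c ^+ k) =
  (P - p ^+ k * (Py / c ^+ k)) + p ^+ k * ((Py - Px) / c ^+ k) by ring.
apply: le_trans (ler_normD _ _) _.
rewrite [`|p ^+ k * _|]normrM (gtr0_norm pk0).
apply: (@le_trans _ _ (p ^+ k * (k%:R * marginal_err k c eps rho K m + 2 * eps) +
   p ^+ k * (k%:R * (1 + c) ^+ k * (c * (2 * C) * rho ^+ m) / c ^+ k))).
  apply: lerD => //; rewrite ler_wpM2l ?(ltW pk0)// normrM normfV (gtr0_norm ck0).
  by rewrite ler_wpM2r// invr_ge0 ltW.
rewrite -mulrDr ler_wpM2l ?(ltW pk0)// marginal_errE// -/C.
have -> : k%:R * (err_slope k c rho K * eps + 2 * C * rho ^+ m) + 2 * eps +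
   k%:R * (1 + c) ^+ k * (c * (2 * C) * rho ^+ m) / c ^+ k = eps * Q + A * rho ^+ m.
  by rewrite /Q /A; ring.
have : eps * Q <= e / 2 by rewrite -ler_pdivlMr.
have : A * rho ^+ m <= e / 2.
  apply: (@le_trans _ _ ((A + 1) * rho ^+ m)).
    by rewrite ler_wpM2r ?exprn_ge0// lerDl.
  by rewrite mulrC -ler_pdivlMr.
lra.
Qed.

End Approximation.

(** * Moments of the tilted edge count *)

Section Moments.
Import mathcomp.boot.finset mathcomp.boot.fintype.
Variable R : realType.

Section Fixed.
Variables (V : finType) (E : {set {set V}}) (k : nat) (c p eps s : R).
Hypothesis k2 : (2 <= k)%N.
Hypothesis c0 : 0 < c.
Hypothesis tm : tame E k c p eps.
Hypothesis eps1 : eps <= 2^-1.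
Hypothesis s01 : 0 <= s < 1.
Implicit Types (e f T W : {set V}).

(** Common bound for all [(maxdeg_l E l)%:R * p ^+ (k - l)]: [l = 1] gives at most [2 * c ^+ k.-1],
    larger [l] at most [eps]. *)
Let M0 : R := 2 * c ^+ k.-1 + 1.

Lemma codeg_const l : (1 <= l <= k.-1)%N -> (maxdeg_l E l)%:R * p ^+ (k - l) <= M0.
Proof.
move=> /andP[l1 lk]; have C0 : 0 <= c ^+ k.-1 by rewrite exprn_ge0// ltW.
have := l1; rewrite leq_eqVlt => /orP[/eqP <-|l2].
  rewrite subn1 mulrC; have /andP[_] := tame_pk c0 tm eps1.
  by rewrite -mulr_natl /maxdeg /M0; lra.
have := tame_codeg tm (introT andP (conj l2 lk)) => h; apply: (le_trans h).
by rewrite /M0; have := eps1; lra.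
Qed.

Lemma sum_codeg_const e (F : {set V} -> R) : e \in E ->
  (forall T, T \subset e -> (1 <= #|T| <= k.-1)%N -> F T <= M0) ->
  \sum_(T in powerset e | (1 <= #|T| <= k.-1)%N) F T <= 2 ^+ k * M0.
Proof.
move=> eE hF; have M00 : 0 <= M0 by rewrite addr_ge0// mulr_ge0// exprn_ge0// ltW.
apply: (@le_trans _ _ (\sum_(T in powerset e) M0)).
  rewrite [leRHS](bigID (fun T : {set V} => (1 <= #|T| <= k.-1)%N))/=.
  rewrite -[leLHS]addr0 lerD//; last by rewrite sumr_ge0.
  by apply: ler_sum => T; rewrite powersetE => /andP[Te Tk]; exact: hF.
rewrite sumr_const -[leLHS]mulr_natl ler_wpM2r// card_powerset_bound//.
by rewrite (tame_unif tm eE).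
Qed.

Definition pair_const : R := 2 ^+ k * M0 * (M0 + 1) + 1.

(** Pairs for which the product estimate fails add only a constant to the expected count given [e]:
    [1] for [f = e], [2 ^+ k * M0] for overlapping edges, [2 ^+ k * M0 * M0] for disjoint bad ones.
    As the mean tends to infinity, this is negligible in the second moment. *)
Lemma bad_pairs_sum e : e \in E ->
  \sum_(f in E | ~~ ([disjoint f & e] && ~~ bad E e f)) p ^+ #|f :\: e| <= pair_const.
Proof.
move=> eE; have p0 := ltW (tame_p0 tm); have unif := tame_unif tm.
have M00 : 0 <= M0 by rewrite addr_ge0// mulr_ge0// exprn_ge0// ltW.
pose Bd := [set f in E | [disjoint f & e] && bad E e f].
pose err f := (if f \in Bd then p ^+ k else 0)
  + \sum_(T in powerset e | (1 <= #|T| <= k.-1)%N) (if T \subset f then p ^+ (k - #|T|) else 0)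
  + (if f == e then 1 else 0).
have E1 f : 0 <= (if f \in Bd then p ^+ k else 0) by case: ifP => // _; rewrite exprn_ge0.
have E2 f : 0 <= \sum_(T in powerset e | (1 <= #|T| <= k.-1)%N)
    (if T \subset f then p ^+ (k - #|T|) else 0).
  by apply: sumr_ge0 => T _; case: ifP => // _; rewrite exprn_ge0.
have E3 f : 0 <= (if f == e then 1 else 0 : R) by case: ifP.
apply: (@le_trans _ _ (\sum_(f in E) err f)).
  rewrite [leRHS](bigID (fun f => ~~ ([disjoint f & e] && ~~ bad E e f)))/=.
  rewrite -[leLHS]addr0; apply: lerD; last by apply: sumr_ge0 => f _; rewrite !addr_ge0.
  apply: ler_sum => f /andP[fE]; rewrite negb_and negbK /err.
  have [->|fe] := eqVneq f e.
    by move=> _; rewrite setDv cards0 expr0 lerDr addr_ge0.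
  case: (boolP [disjoint f & e]) => fd /=.
    move=> fb; rewrite (_ : f \in Bd); last by rewrite inE fE fd.
    rewrite (_ : f :\: e = f); last exact/setDidPl.
    by rewrite (unif _ fE) addr0 lerDl.
  move=> _; rewrite addr0.
  apply: (@le_trans _ _ (\sum_(T in powerset e | (1 <= #|T| <= k.-1)%N)
    (if T \subset f then p ^+ (k - #|T|) else 0))); last by rewrite lerDr.
  rewrite (bigD1 (f :&: e))/=; last first.
    rewrite powersetE subsetIr/= card_gt0 setI_eq0 fd/= -ltnS prednK ?(ltnW k2)//.
    rewrite -(unif _ fE) proper_card// properEneq subsetIl andbT.
    apply: contra fe => /eqP/setIidPl fse.
    by rewrite eqEcard fse (unif _ fE) (unif _ eE) leqnn.
  rewrite subsetIl cardsD (unif _ fE) lerDl.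
  by apply: sumr_ge0 => T _; case: ifP => // _; rewrite exprn_ge0.
rewrite /err !big_split/=.
have S1 : \sum_(f in E) (if f \in Bd then p ^+ k else 0) <= 2 ^+ k * M0 * M0.
  rewrite -big_mkcondr/= (eq_bigl (mem Bd)); last first.
    by move=> f; rewrite !inE andbA andbb.
  rewrite sumr_const -[leLHS]mulr_natl.
  apply: (@le_trans _ _ ((\sum_(T in powerset e | (1 <= #|T| <= k.-1)%N)
     (maxdeg_l E #|T|)%:R * (maxdeg_l E (k - #|T|))%:R) * p ^+ k)).
    rewrite ler_wpM2r ?exprn_ge0//; under eq_bigr do rewrite -natrM.
    by rewrite -natr_sum ler_nat; exact: card_bad0.
  rewrite mulr_suml -mulrA mulrCA [leRHS]mulrC.
  rewrite [leRHS]mulrC [leRHS]mulrA [_ * 2 ^+ k]mulrC.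
  have := @sum_codeg_const e (fun T => (maxdeg_l E #|T|)%:R * p ^+ (k - #|T|)) eE
    (fun T _ h => codeg_const h).
  move=> /(ler_wpM2r M00); apply: le_trans; rewrite mulr_suml; apply: ler_sum => T.
  move=> /andP[_ /andP[T1 Tk]].
  have Tk' : (#|T| <= k)%N by exact: leq_trans Tk (leq_pred _).
  have -> : p ^+ k = p ^+ (k - #|T|) * p ^+ #|T| by rewrite -exprD subnK.
  rewrite mulrACA ler_wpM2l ?mulr_ge0 ?exprn_ge0//.
  have Tk2 : (1 <= k - #|T| <= k.-1)%N.
    by rewrite subn_gt0 -[X in (_ < X)%N](prednK (ltnW k2)) ltnS Tk/= -subn1 leq_sub2l.
  by have := codeg_const Tk2; rewrite subKn.
have S2 : \sum_(f in E) \sum_(T in powerset e | (1 <= #|T| <= k.-1)%N)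
    (if T \subset f then p ^+ (k - #|T|) else 0) <= 2 ^+ k * M0.
  rewrite exchange_big/=.
  apply: le_trans (@sum_codeg_const e (fun T => (maxdeg_l E #|T|)%:R * p ^+ (k - #|T|)) eE
    (fun T _ h => codeg_const h)).
  apply: ler_sum => T _; rewrite sum_indicator ler_wpM2r ?exprn_ge0// ler_nat.
  exact: hdeg_le.
have S3 : \sum_(f in E) (if f == e then 1 else 0 : R) = 1.
  by rewrite (bigD1 e)//= eqxx big1 ?addr0// => f /andP[_ /negbTE ->].
rewrite S3 /pair_const mulrDr mulr1; move: S1 S2; set a := 2 ^+ k * M0 * M0; lra.
Qed.

Variables (a : {set V} -> R) (e2 : R).
Hypothesis a0 : forall f, f \in E -> 0 <= a f.
Hypothesis e20 : 0 <= e2.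
Hypothesis ha : forall W f, (#|W| <= k)%N -> f \in E -> [disjoint f & W] -> ~~ bad E W f ->
  `|pf p s (W :|: f) (E :\ f) / pf p s W E - p ^+ k * a f| <= p ^+ k * e2.

Let Y : R := #|E|%:R * p ^+ k.
Let S1 : R := (1 - s) * (p ^+ k * \sum_(f in E) a f).

Lemma pf_full W f : f \in E -> f \subset W -> pf p s W E = (1 - s) * pf p s W (E :\ f).
Proof.
move=> fE fW; rewrite -{1}(setD1K fE) pf_edge ?in_setD1 ?eqxx//.
by rewrite (setUidPl fW); ring.
Qed.

Lemma mean_tilt : `|\sum_(e in E) pf p s e E / pf p s set0 E - S1| <= e2 * Y.
Proof.
have [s0 s1] := andP s01; have unif := tame_unif tm.
rewrite /S1 !mulr_sumr -sumrB; apply: le_trans (ler_norm_sum _ _ _) _.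
rewrite /Y mulrCA mulr_natl -sumr_const; apply: ler_sum => e eE.
have fb : ~~ bad E set0 e.
  apply/negP => /exists_inP[g gE /and3P[ge gse _]].
  by have := bad_inter_gt0 unif eE gE ge gse; rewrite setI0 cards0.
have := ha (_ : (#|set0 : {set V}| <= k)%N) eE _ fb.
rewrite cards0 set0U => /(_ isT) h.
have {}h := h (_ : [disjoint e & set0]).
rewrite (pf_full eE (subxx e)) -mulrA -mulrBr normrM ger0_norm; last by lra.
apply: (@le_trans _ _ (1 * (p ^+ k * e2))).
  by apply: ler_pM => //; [lra|lra|apply: h; rewrite -setI_eq0 setI0].
by rewrite mul1r mulrC.
Qed.

(** For fixed [e], the sum over [f] divided by [pf p s e E] is the expected count given that [e] is
    occupied; good pairs contribute at most [S1 + e2 * Y] to it. *)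
Lemma second_tilt : \sum_(e in E) \sum_(f in E) pf p s (e :|: f) E / pf p s set0 E <=
  (\sum_(e in E) pf p s e E / pf p s set0 E) * (S1 + e2 * Y + pair_const).
Proof.
have [s0 s1] := andP s01; have unif := tame_unif tm.
have p01 := tame_p01 tm eps1; have p0 := ltW (tame_p0 tm).
rewrite mulr_suml; apply: ler_sum => e eE.
have Z0 := pf_gt0 p01 s01 set0 E; have Ze := pf_gt0 p01 s01 e E.
rewrite (eq_bigr (fun f => pf p s e E / pf p s set0 E * (pf p s (e :|: f) E / pf p s e E))).
  rewrite -mulr_sumr ler_wpM2l//; first by rewrite divr_ge0// ltW.
  rewrite (bigID (fun f => ~~ ([disjoint f & e] && ~~ bad E e f)))/= addrC; apply: lerD; last first.
    apply: le_trans (bad_pairs_sum eE); apply: ler_sum => f _.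
    by case/andP: (pf_ratio_bounds tm eps1 s01 e E f).
  apply: (@le_trans _ _ (\sum_(f in E) (1 - s) * (p ^+ k * (a f + e2)))).
    rewrite [leRHS](bigID (fun f => ~~ ([disjoint f & e] && ~~ bad E e f)))/=.
    rewrite -[leLHS]add0r; apply: lerD.
      apply: sumr_ge0 => f /andP[fE _].
      by rewrite mulr_ge0 ?subr_ge0 ?(ltW s1)// mulr_ge0 ?exprn_ge0// addr_ge0// a0.
    apply: ler_sum => f /andP[fE]; rewrite negbK => /andP[fd fb].
    rewrite (pf_full fE (subsetUr e f)) -mulrA ler_wpM2l//; first by lra.
    have ek : (#|e| <= k)%N by rewrite (unif _ eE).
    have := ha ek fE fd fb; rewrite ler_norml => /andP[_].
    by rewrite lerBlDr mulrDr addrC.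
  rewrite -!mulr_sumr big_split/= mulrDr mulrDr /S1 lerD2l sumr_const -[e2 *+ _]mulr_natl.
  apply: (@le_trans _ _ (1 * (p ^+ k * (#|E|%:R * e2)))).
    by rewrite ler_wpM2r ?mulr_ge0 ?exprn_ge0//; lra.
  by apply: eq_ler; rewrite /Y; ring.
move=> f _; field; by rewrite !gt_eqF.
Qed.

(** [S1] is the predicted mean and [mu] the target, both at scale [Y]. With [g = e3 + e2], the [5]
    is [1] from [mu * (mu - m1)] plus [4] from [2 * (m1 * (g * Y))], since [m1 <= 2 * Y]. *)
Lemma variance_tilt (mu e3 : R) : 0 <= mu <= Y -> `|S1 - mu| <= e3 * Y -> 0 <= e3 ->
  e3 + e2 <= 1 -> pair_const <= (e3 + e2) * Y ->
  (\sum_(e in E) \sum_(f in E) pf p s (e :|: f) E / pf p s set0 E)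
   - 2 * mu * (\sum_(e in E) pf p s e E / pf p s set0 E) + mu ^+ 2
   <= 5 * (e3 + e2) * Y ^+ 2.
Proof.
move=> /andP[mu0 muY] hS e30 e321 hB.
have h1 := mean_tilt; have h2 := second_tilt.
set m2 := \sum_(e in E) \sum_(f in E) _ in h2 *.
set m1 := \sum_(e in E) _ in h1 h2 *.
have Y0 : 0 <= Y by rewrite mulr_ge0// exprn_ge0// ltW// (tame_p0 tm).
have m10 : 0 <= m1.
  apply: sumr_ge0 => e _; rewrite divr_ge0// ltW// pf_gt0//; exact: tame_p01 tm eps1.
set g := e3 + e2 in hB e321 *.
have g0 : 0 <= g by rewrite addr_ge0.
have hm : `|m1 - mu| <= g * Y.
  have -> : m1 - mu = (m1 - S1) + (S1 - mu) by ring.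
  apply: le_trans (ler_normD _ _) _; rewrite /g [e3 + _]addrC mulrDl; exact: lerD.
have hS1 : S1 + e2 * Y <= mu + g * Y.
  by move: hS; rewrite ler_norml /g mulrDl => /andP[_]; lra.
have h3 : m2 <= m1 * (mu + 2 * (g * Y)).
  apply: (le_trans h2); rewrite ler_wpM2l//; lra.
have gY : g * Y <= Y by rewrite ler_piMl.
have gY0 : 0 <= g * Y by rewrite mulr_ge0.
move: hm; rewrite ler_norml => /andP[hm1 hm2].
have m1Y : m1 <= 2 * Y by lra.
have t1 : mu * (mu - m1) <= Y * (g * Y).
  apply: (@le_trans _ _ (mu * (g * Y))); first by rewrite ler_wpM2l//; lra.
  by rewrite ler_wpM2r.
have t2 : m1 * (g * Y) <= 2 * Y * (g * Y) by rewrite ler_wpM2r.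
have -> : 5 * g * Y ^+ 2 = Y * (g * Y) + 2 * (2 * Y * (g * Y)) by ring.
have : m2 - 2 * mu * m1 + mu ^+ 2 <= mu * (mu - m1) + 2 * (m1 * (g * Y)) by lra.
lra.
Qed.

End Fixed.

(* A small fixed tilt already beats the threshold [eta < 1] linearly. *)
Lemma lower_tail_linear (k : nat) (c eta : R) : (2 <= k)%N -> 0 < c -> 0 <= eta < 1 ->
  exists kap e0 : R, [/\ 0 < kap, 0 < e0 & forall (V : finType) (E : {set {set V}}) (p eps : R),
    eps <= e0 -> tame E k c p eps ->
    ln (probp p (fun T => (numX E T)%:R <= eta * (#|E|%:R * p ^+ k))) <=
      - kap * (#|E|%:R * p ^+ k)].
Proof.
move=> k2 c0 /andP[eta0 eta1]; set C : R := c ^+ k.-1; have c1 := ltW c0.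
have C0 : 0 < C by rewrite exprn_gt0.
have kp : 0 < k%:R :> R by rewrite ltr0n ltnW.
pose rho : R := 2^-1.
have rho01 : 0 <= rho < 1 by rewrite /rho invr_ge0 ler0n invf_lt1 ?ltr1n.
(* As [eta = 1 - 8 * g], the final factor [(1 + 2 * g) * eta - (1 - 2 * g)] is at most [- 4 * g],
   more than the required [- g]. *)
pose g : R := (1 - eta) / 8.
have g0 : 0 < g by rewrite /g divr_gt0// subr_gt0.
have g8 : g <= 8^-1 by rewrite /g ler_pdivrMr// mulVf// gerBl.
(* Small enough that [s * (k%:R * C) <= g]: the contraction then holds with [rho = 2^-1], and every
   edge product of iterates stays above [(1 - g) * c ^+ k]. *)
pose s : R := g / (k%:R * C + 1).
have kC : 0 < k%:R * C + 1 by rewrite ltr_wpDl// mulr_ge0 ?ltW.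
have s0 : 0 < s by rewrite divr_gt0.
have sg : s <= g by rewrite /s ler_pdivrMr// ler_peMr ?(ltW g0)// lerDr mulr_ge0 ?ltW.
have skC : s * (k%:R * C) <= g.
  rewrite /s mulrAC ler_pdivrMr// ler_wpM2l ?(ltW g0)// lerDl//.
have hr t : 0 <= t <= s -> t * (k.-1)%:R * C <= rho ^+ 2 * expR 1.
  move=> /andP[t0 ts]; apply: (@le_trans _ _ (s * (k%:R * C))).
    rewrite -mulrA; apply: ler_pM => //; first by rewrite mulr_ge0 ?(ltW C0).
    by rewrite ler_wpM2r ?(ltW C0)// ler_nat leq_pred.
  apply: (le_trans skC); apply: (le_trans g8).
  have e1 : 1 + 1 <= expR 1 :> R by exact: expR_ge1Dx.
  have -> : rho ^+ 2 = 4^-1 by rewrite /rho; field.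
  by move: e1; set x := expR 1; lra.
have g2 : 0 < g / 2 by rewrite divr_gt0.
pose Q0 : R := 2 * k%:R * C.
have Q00 : 0 <= Q0 by rewrite /Q0 !mulr_ge0// ltW.
have [m hm] := exists_expr_le rho01 (divr_gt0 g2 (ltr_wpDl Q00 ltr01)).
pose K := (k + m * k)%N.
pose Q := k%:R * err_slope k c rho K + 2.
have S0 := err_slope_ge0 k K c0 rho01.
have Qp : 0 < Q by rewrite /Q ltr_wpDl// mulr_ge0// ltW.
exists (s * g); exists (Num.min 2^-1 (g / 2 / Q)); split.
- by rewrite mulr_gt0.
- by rewrite lt_min invr_gt0 ltr0n/= divr_gt0.
move=> V E p eps; rewrite le_min => /andP[eps1 eps2] tm.
have p01 := tame_p01 tm eps1; have p0 := tame_p0 tm; have d0 := tame_d0 tm.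
have unif := tame_unif tm.
have E0 := set0_notin k2 tm.
set Y : R := #|E|%:R * p ^+ k.
have Y0 : 0 <= Y by rewrite mulr_ge0// exprn_ge0// ltW.
have s12 : 0 <= s <= 2^-1 by rewrite (ltW s0)/=; apply: le_trans sg _; lra.
have s01 : 0 <= s < 1 by case/andP: s12 => -> h /=; lra.
have P0 : 0 < probp p (fun T => (numX E T)%:R <= eta * Y).
  by apply: probp_gt0 => //=; rewrite numX0// mulr_ge0.
have := lower_tail_markov E (eta * Y) p01 s01.
have Z0 := pf_gt0 p01 s01 set0 E.
rewrite -ler_ln ?posrE ?mulr_gt0 ?expR_gt0// lnM ?posrE ?expR_gt0// expRK => h.
apply: (le_trans h) => {h P0}.
have s1 : s <= 1 by case/andP: s01 => _ /ltW.
have [t [/andP[t0 ts]]] := ln_pf_MVT p01 E0 s0 s1.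
rewrite pf_s0 ln1 !subr0 => ->.
have t01 : 0 <= t < 1 by rewrite (ltW t0)/=; exact: lt_le_trans ts s1.
have ht : t * (k.-1)%:R * C <= rho ^+ 2 * expR 1 by apply: hr; rewrite (ltW t0) ltW.
have := edge_rate_approx k2 c0 tm eps1 t01 rho01 ht (leqnn K).
rewrite marginal_errE// -/C; last by case/andP: rho01.
set er := edge_rate E p t.
have lowP : #|E|%:R * (1 - g) <=
   (\sum_(e in E) \prod_(u in e) Fiter E c t m.+1 u) / c ^+ k.
  rewrite ler_pdivlMr ?exprn_gt0// -mulrA mulr_natl -sumr_const.
  apply: ler_sum => e eE; have ce : #|e| = k by exact: unif.
  apply: (@le_trans _ _ (\prod_(u in e) (c * expR (- (t * C))))).
    rewrite prodr_const ce exprMn mulrC ler_wpM2l ?exprn_ge0// -expRM_natl.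
    apply: le_trans (expR_ge1Dx _); rewrite lerD2l mulrN lerN2.
    apply: le_trans skC; rewrite mulrCA ler_wpM2r ?mulr_ge0 ?(ltW C0)// ltW//.
  apply: ler_prod => u _; rewrite mulr_ge0 ?expR_ge0//=.
  rewrite /C; apply: (@Fmap_ge_s R V E k c unif c0 d0 t (Fiter E c t m) u (ltW t0)) => w.
  by apply: Fiter_bounds_le => //; case/andP: t01 => -> /ltW.
move=> h.
have herr : k%:R * (err_slope k c rho K * eps + 2 * C * rho ^+ m) + 2 * eps <= g.
  have -> : k%:R * (err_slope k c rho K * eps + 2 * C * rho ^+ m) + 2 * eps =
    eps * Q + Q0 * rho ^+ m by rewrite /Q /Q0; ring.
  have h1 : eps * Q <= g / 2 by rewrite -ler_pdivlMr.
  have h2 : Q0 * rho ^+ m <= g / 2.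
    apply: (@le_trans _ _ ((Q0 + 1) * rho ^+ m)).
      by rewrite ler_wpM2r ?exprn_ge0 ?lerDl//; case/andP: rho01.
    by rewrite mulrC -ler_pdivlMr// ltr_wpDl.
  lra.
have hle : Y * (1 - 2 * g) <= er.
  move: h; rewrite ler_norml => /andP[h _].
  have h1 : #|E|%:R * (p ^+ k * (k%:R * (err_slope k c rho K * eps + 2 * C * rho ^+ m) + 2 * eps))
     <= Y * g by rewrite mulrA ler_wpM2l.
  have h2 : Y * (1 - g) <= p ^+ k / c ^+ k * (\sum_(e in E) \prod_(u in e) Fiter E c t m.+1 u).
    have -> : Y * (1 - g) = p ^+ k * (#|E|%:R * (1 - g)) by rewrite /Y; ring.
    by rewrite -[leRHS]mulrA ler_wpM2l ?exprn_ge0 ?(ltW p0)// [leRHS]mulrC.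
  move: h h1 h2; rewrite !mulrBr !mulr1; set A := #|E|%:R * _; set B := p ^+ k / _ * _; lra.
have /andP[hl _] := ln1B_bounds s12.
have hl2 : - ln (1 - s) * (eta * Y) <= (s + s ^+ 2 *+ 2) * (eta * Y).
  by apply: ler_wpM2r; [exact: mulr_ge0|rewrite lerNl opprD].
have hs2 : s ^+ 2 *+ 2 <= s * (2 * g).
  rewrite -mulr_natl expr2 mulrCA ler_wpM2l ?(ltW s0)// ler_wpM2l//.
apply: (@le_trans _ _ ((s + s * (2 * g)) * (eta * Y) - Y * (1 - 2 * g) * s)).
  apply: lerD; first (apply: (le_trans hl2); apply: ler_wpM2r; [exact: mulr_ge0|by rewrite lerD2l]).
  by rewrite mulNr lerN2 ler_wpM2r// ltW.
have -> : (s + s * (2 * g)) * (eta * Y) - Y * (1 - 2 * g) * s =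
   (s * Y) * ((1 + 2 * g) * eta - (1 - 2 * g)) by ring.
have -> : - (s * g) * Y = (s * Y) * (- g) by ring.
apply: ler_wpM2l; first exact: mulr_ge0 (ltW s0) Y0.
have ee : eta = 1 - 8 * g by rewrite /g; field.
rewrite {1}ee; nra.
Qed.

End Moments.

(** * Two-sided estimate of the lower tail *)

Section LowerTail.
Import mathcomp.boot.finset mathcomp.boot.fintype.
Variable R : realType.

Lemma expr_le_bound (x : R) n : (1 <= n)%N -> 0 <= x -> x ^+ n <= 2 -> x <= 2.
Proof.
move=> n1 x0 xn; rewrite leNgt; apply/negP => x2.
suff : x <= x ^+ n by move=> h; lra.
by rewrite -[leLHS]expr1 ler_weXn2l//; lra.
Qed.

Lemma lower_tail_assembly (L lnZ A mu th S e e1 pV lam ck c Th Y : R) :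
  0 <= S -> 0 <= e1 -> 0 <= th <= Th -> 0 <= mu <= Y -> Y <= 2 * ck * S ->
  pV <= 2 * c * S -> e1 * (8 * c + Th * ck) <= e / 4 -> lam <= e / 4 * S ->
  `|lnZ - A| <= e / 4 * S -> L <= th * mu + lnZ ->
  - (4 * e1 * pV) + th * ((1 - e1 / 2) * mu) - lam + lnZ <= L ->
  `|L - (A + th * mu)| <= e * S.
Proof.
move=> S0 e10 /andP[th0 thT] /andP[mu0 muY] YS pVS he hlam hZ hup hlo.
move: hZ; rewrite ler_norml => /andP[hZ1 hZ2].
have eS : 0 <= e / 4 * S by apply: le_trans (normr_ge0 (lnZ - A)) _; rewrite ler_norml hZ1.
have h1 : 4 * e1 * pV <= 4 * e1 * (2 * c * S) by rewrite ler_wpM2l// mulr_ge0.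
have h2 : th * mu <= Th * (2 * ck * S).
  by apply: ler_pM => //; exact: le_trans YS.
have h3 : e1 / 2 * (th * mu) <= e1 / 2 * (Th * (2 * ck * S)) by rewrite ler_wpM2l// divr_ge0.
have h4 : e1 * (8 * c + Th * ck) * S <= e / 4 * S by rewrite ler_wpM2r.
rewrite ler_norml; apply/andP; split; last by lra.
have -> : - (e * S) = - (e / 4 * S) - e / 4 * S - e / 4 * S - e / 4 * S by field.
have e5 : th * ((1 - e1 / 2) * mu) = th * mu - e1 / 2 * (th * mu) by ring.
rewrite e5 in hlo.
have e6 : e1 * (8 * c + Th * ck) * S = 4 * e1 * (2 * c * S) + e1 / 2 * (Th * (2 * ck * S)).
  by field.
rewrite e6 in h4; move: h1 h3 h4 hlo hZ1 hlam eS.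
set a := th * mu; set b := e1 / 2 * a; set f := e1 / 2 * _; set g := 4 * e1 * _; set h := 4 * e1 * pV.
set q := e / 4 * S; lra.
Qed.

Lemma half_le_of_near (q v x w : R) : - q <= v - x * w -> q <= x / 2 * w -> x / 2 * w <= v.
Proof. lra. Qed.

Lemma near1_le2 (x d : R) : `|x - 1| <= d -> d <= 2^-1 -> x <= 2.
Proof. by rewrite ler_norml => /andP[_]; lra. Qed.

Lemma thin_factor (x : R) : 0 <= x <= 2^-1 -> x / 2 <= 1 - (1 - x) * (1 + x / 2).
Proof. by move=> ?; nra. Qed.

Lemma half_mul_le (d x y : R) : - (d * x) <= y - x -> 0 <= x -> d <= 2^-1 -> x / 2 <= y.
Proof.
move=> h x0 d2; have : d * x <= 2^-1 * x by rewrite ler_wpM2r.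
lra.
Qed.

Lemma scaled_edges_ge (V : finType) (E : {set {set V}}) (k : nat) (c p D eps CE : R) :
  (2 <= k)%N -> 0 < c -> tame E k c p eps -> scaled E k c p D eps -> eps <= 2^-1 ->
  0 < CE -> CE * (maxdeg E)%:R * #|V|%:R <= #|E|%:R ->
  CE * c ^+ k / 2 * (D * #|V|%:R) <= #|E|%:R * p ^+ k.
Proof.
move=> k2 c0 tm sc eps1 CE0 hCE; have d0 := tame_d0 tm; have [D0 _ _] := sc.
have ck0 : 0 < c ^+ k by rewrite exprn_gt0.
have := scaled_pk k2 c0 tm sc; rewrite ler_norml => /andP[hpk _].
have Dd0 : 0 < D / (maxdeg E)%:R by rewrite divr_gt0.
have hpk2 : c ^+ k * (D / (maxdeg E)%:R) / 2 <= p ^+ k.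
  have -> : p ^+ k = c ^+ k * (p ^+ k / c ^+ k) by rewrite mulrCA divff ?mulr1 ?gt_eqF.
  rewrite -mulrA ler_pM2l//.
  exact: half_mul_le hpk (ltW Dd0) eps1.
apply: (@le_trans _ _ ((CE * (maxdeg E)%:R * #|V|%:R) * (c ^+ k * (D / (maxdeg E)%:R) / 2))).
  by apply: eq_ler; field; rewrite gt_eqF.
apply: ler_pM => //; first by rewrite !mulr_ge0// ltW.
by rewrite divr_ge0// mulr_ge0 ?ltW.
Qed.

Lemma lower_tail_approx (k : nat) (c rho eta CE e : R) : (2 <= k)%N -> 0 < c ->
  0 <= rho < 1 -> 0 < eta < 1 -> 0 < CE -> 0 < e ->
  exists2 e0 : R, 0 < e0 &
  forall (V : finType) (E : {set {set V}}) (p D eps zeta : R) (xs : V -> R),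
    eps <= e0 -> tame E k c p eps -> scaled E k c p D eps ->
    CE * (maxdeg E)%:R * #|V|%:R <= #|E|%:R -> 1 <= e0 * (D * #|V|%:R) ->
    0 < zeta < 1 -> zeta * (k.-1)%:R * c ^+ k.-1 <= rho ^+ 2 * expR 1 ->
    in_box c xs -> is_fixed_point E c zeta xs ->
    `|(1 - zeta) * (\sum_(f in E) \prod_(u in f) xs u) - eta * c ^+ k * #|E|%:R|
       <= e0 * (c ^+ k * #|E|%:R) ->
    `|ln (probp p (fun T => (numX E T)%:R <= eta * (#|E|%:R * p ^+ k)))
      - (D * (Bethe E c zeta xs - c * #|V|%:R) - ln (1 - zeta) * (eta * (#|E|%:R * p ^+ k)))|
    <= e * (D * #|V|%:R).
Proof.
move=> k2 c0 rho01 /andP[eta0 eta1] CE0 e_gt0; have c1 := ltW c0.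
have ck0 : 0 < c ^+ k by rewrite exprn_gt0.
pose Th := - ln (eta / 2).
have Th0 : 0 <= Th by rewrite /Th oppr_ge0 ln_le0//; lra.
pose G := 8 * c + Th * c ^+ k.
have G0 : 0 <= G by rewrite /G addr_ge0// mulr_ge0// ltW.
have e4 : 0 < e / 4 by rewrite divr_gt0.
(* Thinning keeps each vertex with probability [1 - e1], and the window [delta = e1 / 2] satisfies
   [(1 - e1) * (1 + delta) < 1]. [G] collects the costs proportional to [e1]: [8 * c] for the change
   of density, [Th * c ^+ k] for the window. *)
pose e1 := Num.min 2^-1 (e / 4 / (G + 1)).
have e10 : 0 < e1 by rewrite lt_min invr_gt0 ltr0n/= divr_gt0// ltr_wpDl.
have e12 : e1 <= 2^-1 by rewrite /e1 ge_min lexx.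
have e1G : e1 * G <= e / 4.
  apply: (@le_trans _ _ (e1 * (G + 1))); first by rewrite ler_wpM2l ?(ltW e10)// lerDl.
  by rewrite -ler_pdivlMr ?ltr_wpDl// /e1 ge_min lexx orbT.
pose delta := e1 / 2.
have delta0 : 0 < delta by rewrite divr_gt0.
(* Makes the variance bound [5 * (g + g) * Y ^+ 2] equal to the Chebyshev allowance
   [(delta * mu) ^+ 2 / 2] for [mu = eta * Y]. *)
pose g := delta ^+ 2 * eta ^+ 2 / 20.
have g0 : 0 < g by rewrite divr_gt0// mulr_gt0// exprn_gt0.
have g1 : g + g <= 1.
  have d1 : delta ^+ 2 <= 1 by rewrite expr_le1// ?ltW// /delta; lra.
  have h1 : eta ^+ 2 <= 1 by rewrite expr_le1// ltW.
  have : delta ^+ 2 * eta ^+ 2 <= 1 by rewrite mulr_ile1// exprn_ge0// ltW.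
  by rewrite /g; lra.
have q01 : 0 <= 1 - e1 <= 1 by lra.
have e1b : 0 <= e1 <= 2^-1 by rewrite ltW.
have q4 : 4^-1 <= 2^-1 :> R by lra.
have [ea ea0 hfree] := free_energy_approx k2 c0 rho01 e4.
have [eb eb0 hedge] := edge_approx k2 c0 rho01 g0.
pose B := pair_const k c.
have B0 : 0 < B.
  have h : 0 <= 2 * c ^+ k.-1 by rewrite mulr_ge0// exprn_ge0.
  by rewrite /B /pair_const ltr_wpDl// !mulr_ge0// ?addr_ge0// exprn_ge0.
(* Logarithmic cost of two constants: tilted mass at least [1 / 2] in the window, and success
   probability at least [e1 / 2] for the thinning. *)
pose lam := - ln (e1 / 4).
have lam0 : 0 <= lam by rewrite /lam oppr_ge0 ln_le0//; lra.
pose e0 := Num.min (Num.min (Num.min ea eb) (Num.min 4^-1 (eta / 2)))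
  (Num.min (Num.min g (g * CE * c ^+ k / B)) (e / 4 / (lam + 1))).
exists e0.
  by rewrite /e0 !lt_min ea0 eb0 invr_gt0 ltr0n g0 !divr_gt0// ?mulr_gt0// ltr_wpDl.
have : e0 <= e0 by [].
rewrite {2}/e0 !le_min.
move=> /andP[/andP[/andP[e0a e0b] /andP[e04 e0eta]] /andP[/andP[e0g e0B] e0lam]].
move: e0 e0a e0b e04 e0eta e0g e0B e0lam => e0 e0a e0b e04 e0eta e0g e0B e0lam.
move=> V E p D eps zeta xs epse tm sc hCE hS /andP[z0 z1] hr xb xF hz.
have eps1 : eps <= 2^-1 by apply: le_trans epse (le_trans e04 q4).
have p01 := tame_p01 tm eps1; have p0 := tame_p0 tm; have d0 := tame_d0 tm.
have pk0 : 0 < p ^+ k by rewrite exprn_gt0.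
have unif := tame_unif tm; have E0 := set0_notin k2 tm.
have [D0 DkE hpD] := sc.
have z01 : 0 <= zeta < 1 by rewrite ltW.
have z01' : 0 < zeta <= 1 by rewrite z0 ltW.
set S := D * #|V|%:R in hS *.
have S0 : 0 <= S by rewrite mulr_ge0// ltW.
have S1 : 0 < S.
  rewrite lt_def S0 andbT; apply/negP => /eqP S00.
  by move: hS; rewrite S00 mulr0 ler10.
set Y := #|E|%:R * p ^+ k.
have Y0 : 0 <= Y by rewrite mulr_ge0// ltW.
have YS : Y <= 2 * c ^+ k * S := scaled_edges k2 c0 tm sc eps1.
have YlS : CE * c ^+ k / 2 * S <= Y := scaled_edges_ge k2 c0 tm sc eps1 CE0 hCE.
have Y1 : 0 < Y by apply: lt_le_trans YlS; rewrite mulr_gt0// divr_gt0// mulr_gt0.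
set mu := eta * Y.
have mu0 : 0 < mu by rewrite mulr_gt0.
have muY : mu <= Y by rewrite ler_piMl// ltW.
have free := hfree V E p D eps zeta xs (le_trans epse e0a) tm sc z01' hr xb xF.
rewrite -/S in free.
have edge := hedge V E p eps zeta xs (le_trans epse e0b) tm z01 hr xb xF.
pose a (f : {set V}) : R := \prod_(u in f) xs u / c ^+ k.
have a0 f : f \in E -> 0 <= a f.
  move=> _; rewrite /a divr_ge0 ?(ltW ck0)// prodr_ge0// => u _.
  by case/andP: (xb u).
have hS1 : `|(1 - zeta) * (p ^+ k * \sum_(f in E) a f) - mu| <= g * Y.
  have -> : (1 - zeta) * (p ^+ k * \sum_(f in E) a f) - mu = p ^+ k / c ^+ k *
     ((1 - zeta) * (\sum_(f in E) \prod_(u in f) xs u) - eta * c ^+ k * #|E|%:R).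
    by rewrite /a -mulr_suml /mu /Y; field; rewrite gt_eqF.
  rewrite normrM ger0_norm ?divr_ge0 ?(ltW pk0) ?(ltW ck0)//.
  apply: (@le_trans _ _ (p ^+ k / c ^+ k * (e0 * (c ^+ k * #|E|%:R)))).
    by rewrite ler_wpM2l// divr_ge0// ltW.
  have -> : p ^+ k / c ^+ k * (e0 * (c ^+ k * #|E|%:R)) = e0 * Y.
    by rewrite /Y; field; rewrite gt_eqF.
  by rewrite ler_wpM2r.
have hB : B <= (g + g) * Y.
  have h1 : e0 * B <= g * CE * c ^+ k by rewrite -ler_pdivlMr.
  have h2 : B <= e0 * S * B by rewrite ler_peMl// ltW.
  apply: (le_trans h2); have -> : e0 * S * B = e0 * B * S by ring.
  apply: (@le_trans _ _ (g * CE * c ^+ k * S)); first by rewrite ler_wpM2r.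
  have -> : g * CE * c ^+ k * S = (g + g) * (CE * c ^+ k / 2 * S) by field.
  by rewrite ler_wpM2l// addr_ge0// ltW.
have Z0 := pf_gt0 p01 z01 set0 E.
have var := variance_tilt k2 c0 tm eps1 z01 a0 (ltW g0) edge
  (introT andP (conj (ltW mu0) muY)) hS1 (ltW g0) g1 hB.
have dm : 0 < delta * mu by rewrite mulr_gt0.
have var2 : 5 * (g + g) * Y ^+ 2 <= (delta * mu) ^+ 2 / 2.
  by apply: eq_ler; rewrite /g /mu; field.
have cheb := tilt_chebyshev (E := E) p01 z01 dm _ _ (le_trans var var2).
have {}cheb := cheb _ _.
have E1 : \sum_(T : {set V}) bwt p T * (1 - zeta) ^+ numX E T * (numX E T)%:R =
    (\sum_(f in E) pf p zeta f E / pf p zeta set0 E) * pf p zeta set0 E.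
  by rewrite sum_tilt_numX -mulr_suml divfK// gt_eqF.
have E2 : \sum_(T : {set V}) bwt p T * (1 - zeta) ^+ numX E T * (numX E T)%:R ^+ 2 =
    (\sum_(f in E) \sum_(f' in E) pf p zeta (f :|: f') E / pf p zeta set0 E) * pf p zeta set0 E.
  rewrite sum_tilt_numX2 mulr_suml; apply: eq_bigr => f fE.
  by rewrite -mulr_suml divfK// gt_eqF.
have {}cheb := cheb E1 E2.
have tilt := tilt_lower E mu delta p01 z01.
have thin := thinning_lower unif (ltnW k2) p01 q01 mu0 (ltW delta0).
have p4 : 0 < p <= 4^-1.
  rewrite p0/=; apply: le_trans (le_trans epse e04).
  by case: tm => _ /andP[].
have dens := density_lower (fun T => (numX E T)%:R <= mu) p4 q01.
set P := probp p (fun T => (numX E T)%:R <= mu) in dens *.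
have P0 : 0 < P by apply: probp_gt0 => //=; rewrite numX0// ltW.
set th := - ln (1 - zeta).
have zc0 : 0 < 1 - zeta by rewrite subr_gt0.
have th0 : 0 <= th by rewrite /th oppr_ge0 ln_le0// gerBl ltW.
(* Each edge product is at most [c ^+ k], so the relation defining [zeta] gives
   [1 - zeta >= eta - e0], and [e0 <= eta / 2]. This bounds [- ln (1 - zeta)] by [Th]. *)
have zeta_le : eta / 2 <= 1 - zeta.
  have hX := sum_edges_le (E := E) k2 c0 tm xb.
  have EE0 : 0 < #|E|%:R :> R by move: Y1; rewrite /Y pmulr_lgt0.
  have XE : \sum_(f in E) \prod_(u in f) xs u <= c ^+ k * #|E|%:R.
    rewrite mulrC mulr_natl -sumr_const; apply: ler_sum => f fE.
    by rewrite -(unif f fE) -prodr_const; apply: ler_prod => u _; exact: xb.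
  move: hz; rewrite ler_norml => /andP[hz _].
  have cE0 : 0 < c ^+ k * #|E|%:R by rewrite mulr_gt0.
  have h1 : (1 - zeta) * (\sum_(f in E) \prod_(u in f) xs u) <= (1 - zeta) * (c ^+ k * #|E|%:R).
    by rewrite ler_wpM2l// ltW.
  rewrite -(ler_pM2r cE0); apply: le_trans h1.
  have h2 : e0 * (c ^+ k * #|E|%:R) <= eta / 2 * (c ^+ k * #|E|%:R) by rewrite ler_pM2r.
  by move: hz; rewrite -[eta * c ^+ k * _]mulrA => hz; exact: half_le_of_near hz h2.
have thT : th <= Th by rewrite /th /Th lerN2 ler_ln ?posrE// divr_gt0.
have pV : p * #|V|%:R <= 2 * c * S.
  have x0 : 0 <= p / (c * D) by rewrite divr_ge0 ?mulr_ge0 ?ltW.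
  have x2 : (p / (c * D)) ^+ k <= 2.
    exact: near1_le2 hpD eps1.
  have := expr_le_bound (ltnW k2) x0 x2; rewrite ler_pdivrMr ?mulr_gt0// => h.
  by rewrite /S mulrA ler_wpM2r//; apply: (le_trans h); apply: eq_ler; ring.
have lamS : lam <= e / 4 * S.
  have l1 : 0 < lam + 1 by rewrite ltr_wpDl.
  have h1 : e0 * (lam + 1) <= e / 4 by rewrite -ler_pdivlMr.
  apply: (@le_trans _ _ ((lam + 1) * (e0 * S))); last first.
    by rewrite mulrA [_ * e0]mulrC ler_wpM2r.
  apply: (@le_trans _ _ (lam + 1)); first by rewrite lerDl.
  by rewrite ler_peMr// ltW.
have -> : D * (Bethe E c zeta xs - c * #|V|%:R) - ln (1 - zeta) * mu =
   D * (Bethe E c zeta xs - c * #|V|%:R) + th * mu by rewrite /th mulNr.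
have mu0Y : 0 <= mu <= Y by rewrite ltW.
have th0T : 0 <= th <= Th by rewrite th0.
apply: (lower_tail_assembly S0 (ltW e10) th0T mu0Y YS pV e1G lamS free).
  have := lower_tail_markov E mu p01 z01; rewrite -/P -/th.
  rewrite -ler_ln ?posrE ?mulr_gt0 ?expR_gt0// lnM ?posrE ?expR_gt0// expRK.
  by [].
have low : expR (- (4 * e1 * (p * #|V|%:R))) * (e1 / 2 *
    (expR (th * ((1 - delta) * mu)) * (pf p zeta set0 E / 2))) <= P.
  apply: le_trans dens; have -> : 1 - (1 - e1) = e1 by ring.
  rewrite -[4 * e1 * p * _]mulrA ler_pM2l ?expR_gt0//.
  apply: le_trans thin; apply: ler_pM.
  - by rewrite divr_ge0// ltW.
  - by rewrite mulr_ge0 ?expR_ge0 ?divr_ge0 ?(ltW Z0).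
  - exact: thin_factor.
  by apply: le_trans tilt; rewrite ler_pM2l ?expR_gt0.
rewrite -ler_expR [leRHS]lnK ?posrE//; apply: le_trans low; apply: eq_ler.
rewrite /lam opprK !expRD [expR (ln (e1 / 4))]lnK ?posrE ?divr_gt0//.
by rewrite [expR (ln (pf _ _ _ _))]lnK ?posrE// /delta; field.
Qed.

End LowerTail.

(** * Sequences of hypergraphs *)

Section Scaling.
Import mathcomp.boot.finset mathcomp.boot.fintype.
Variable R : realType.

Lemma expr_near1 (x h : R) n : `|x - 1| <= h -> h <= 1 -> 0 <= x ->
  `|x ^+ n - 1| <= n%:R * 2 ^+ n * h.
Proof.
move=> xh h1 x0; have h0 : 0 <= h by exact: le_trans xh.
have x2 : x <= 2 by move: xh; rewrite ler_norml => /andP[_]; lra.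
elim: n => [|n IH]; first by rewrite expr0 subrr normr0 !mul0r.
have -> : x ^+ n.+1 - 1 = x * (x ^+ n - 1) + (x - 1) by rewrite exprS; ring.
apply: le_trans (ler_normD _ _) _; rewrite normrM (ger0_norm x0) -natr1.
have -> : (n%:R + 1) * 2 ^+ n.+1 * h = 2 * (n%:R * 2 ^+ n * h) + 2 ^+ n.+1 * h.
  by rewrite exprS; ring.
apply: lerD; first exact: ler_pM.
by apply: (le_trans xh); rewrite ler_peMl// exprn_ege1// ler1n.
Qed.

Lemma powR_rootK (x : R) n : (0 < n)%N -> 0 <= x -> powR x (n%:R^-1) ^+ n = x.
Proof.
move=> n0 x0; rewrite -powR_mulrn ?powR_ge0// -powRrM mulVf ?powRr1//.
by rewrite pnatr_eq0 -lt0n.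
Qed.

Lemma powR_divn (x : R) n m : 0 <= x -> powR x (m%:R / n%:R) = powR x (n%:R^-1) ^+ m.
Proof. by move=> x0; rewrite -powR_mulrn ?powR_ge0// -powRrM mulrC. Qed.

Lemma maxdeg_l_unif (V : finType) (E : {set {set V}}) (k : nat) :
  kuniform E k -> (maxdeg_l E k <= 1)%N.
Proof.
move=> unif; apply/bigmax_leqP => S /eqP Sk.
rewrite -(cards1 S); apply/subset_leq_card/subsetP => f; rewrite !inE => /andP[fE Sf].
by rewrite eq_sym eqEcard Sf (unif _ fE) Sk leqnn.
Qed.

(** Every edge through [v] contains a pair [[set v; u]]. For [k >= 3] this makes the vertex set
    large, since codegrees of pairs are small compared with the maximum degree. *)
Lemma maxdeg_le_codeg (V : finType) (E : {set {set V}}) (k : nat) : (2 <= k)%N ->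
  kuniform E k -> (maxdeg E <= #|V| * maxdeg_l E 2)%N.
Proof.
move=> k2 unif; apply/bigmax_leqP => S /cards1P[v ->].
apply: (@leq_trans #|\bigcup_(u in [set~ v])
    [set f in E | [set v; u] \subset f]|%SET).
  apply/subset_leq_card/subsetP => f; rewrite !inE sub1set => /andP[fE vf].
  have /set0Pn[u] : f :\ v != set0.
    by rewrite -card_gt0 cardsD (setIidPr _) ?sub1set// cards1 (unif _ fE) subn_gt0.
  rewrite !inE => /andP[uv uf]; apply/bigcupP; exists u; first by rewrite !inE.
  by rewrite inE fE subUset !sub1set vf.
apply: leq_trans (card_bigcup_le _ _) _.
apply: (@leq_trans (\sum_(u in [set~ v]) maxdeg_l E 2)).
  apply: leq_sum => u; rewrite !inE => uv.
  have -> : 2%N = #|[set v; u]| by rewrite cards2 eq_sym uv.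
  by apply: leq_trans (hdeg_le E _); apply/subset_leq_card/subsetP => f; rewrite !inE.
by rewrite sum_nat_const leq_mul2r max_card orbT.
Qed.

(* Cauchy-Schwarz twice on the number of paths of length two. *)
Lemma graph_double_count (V : finType) (E : {set {set V}}) : kuniform E 2 ->
  4 * #|E|%:R ^+ 2 <=
  #|V|%:R * (#|V|%:R ^+ 2 * (Gamma E 2)%:R + #|V|%:R * (maxdeg E)%:R) :> R.
Proof.
move=> unif.
pose A w v := (w != v) && ([set v; w] \in E).
have degA w : #|[set v | A w v]| = #|[set f in E | w \in f]|.
  rewrite -(card_in_imset (f := fun v => [set v; w])).
    apply: eq_card => f; apply/imsetP/idP.
      by case=> v; rewrite !inE => /andP[wv vwE ->]; rewrite vwE !inE eqxx orbT.
    rewrite inE => /andP[fE wf].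
    have /cards1P[v fv] : #|f :\ w| == 1%N.
      by rewrite cardsD (setIidPr _) ?sub1set// cards1 (unif _ fE).
    exists v; last by rewrite -(setD1K wf) fv setUC.
    have : v \in f :\ w by rewrite fv set11.
    by rewrite !inE /A => /andP[vw vf]; rewrite eq_sym vw/= setUC -fv setD1K.
  move=> v v'; rewrite !inE => /andP[wv _] /andP[wv' _] eqvv.
  have : v \in [set v'; w] by rewrite -eqvv !inE eqxx.
  by rewrite !inE [v == w]eq_sym (negbTE wv) orbF => /eqP.
have sumA : (2 * #|E| = \sum_w #|[set v | A w v]|)%N.
  transitivity (\sum_w \sum_(f in E | w \in f) 1)%N; last first.
    by apply: eq_bigr => w _; rewrite degA -sum1_card; apply: eq_bigl => f; rewrite inE.
  rewrite (exchange_big_dep (mem E))/=; last by move=> w f _ /andP[].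
  rewrite mulnC -sum_nat_const; apply: eq_bigr => f fE.
  rewrite -(unif _ fE) -sum1_card; apply: eq_bigl => w.
  by rewrite fE.
have symA w v : A w v = A v w by rewrite /A eq_sym setUC.
have sumA2 : (\sum_w #|[set v | A w v]| ^ 2 <= #|V| ^ 2 * Gamma E 2 + #|V| * maxdeg E)%N.
  have -> : (\sum_w #|[set v | A w v]| ^ 2 = \sum_v \sum_v' #|[set w | A w v && A w v']|)%N.
    transitivity (\sum_w \sum_(v | A w v) \sum_(v' | A w v') 1)%N.
      apply: eq_bigr => w _; rewrite sum_nat_const sum1_card.
      by rewrite -mulnn; congr muln; apply: eq_card => v; rewrite !inE.
    rewrite (exchange_big_dep predT)//=; apply: eq_bigr => v _.
    rewrite (exchange_big_dep predT)//=; apply: eq_bigr => v' _.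
    by rewrite sum1_card; apply: eq_card => w; rewrite !inE.
  apply: (@leq_trans (\sum_(v : V) (#|V| * Gamma E 2 + maxdeg E))); last first.
    by rewrite sum_nat_const mulnDr mulnA -mulnn leqnn.
  apply: leq_sum => v _; rewrite (bigD1 v)//= addnC; apply: leq_add; last first.
    apply: leq_trans (hdeg1_le E v); rewrite -degA; apply/subset_leq_card/subsetP => w.
    by rewrite !inE symA => /andP[].
  apply: (@leq_trans (\sum_(v' | v' != v) Gamma E 2)); last first.
    by rewrite sum_nat_const leq_mul2r max_card orbT.
  apply: leq_sum => v' v'v.
  rewrite /Gamma (bigD1 v)//= leq_max; apply/orP; left.
  rewrite (bigD1 v')//= leq_max; apply/orP; left.
  rewrite -(card_imset _ (@set1_inj V)).
  apply/subset_leq_card/subsetP => S /imsetP[w]; rewrite inE => /andP[/andP[_ wv] /andP[_ wv']] ->.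
  by apply: mem_set; rewrite /= cards1 eqxx/= wv wv'.
have := @sqr_sum_le R V predT #|V|%:R (fun w => #|[set v | A w v]|%:R).
move=> /(_ (lexx _)).
rewrite -natr_sum -sumA natrM => h.
rewrite (_ : 4 * _ = (2 * #|E|%:R) ^+ 2); last by ring.
apply: (le_trans h); rewrite ler_wpM2l//.
under eq_bigr do rewrite -natrX.
by rewrite -natr_sum -natrX -!natrM -natrD ler_nat.
Qed.

End Scaling.

(** * Finite inequalities that imply tameness *)

Section FiniteCriterion.
Import mathcomp.boot.finset mathcomp.boot.fintype.
Variables (R : realType) (V : finType) (E : {set {set V}}) (k : nat) (c p e h : R).
Hypothesis k2 : (2 <= k)%N.
Hypothesis unif : kuniform E k.
Hypothesis c0 : 0 < c.
Let d : R := (maxdeg E)%:R.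
Let D : R := powR d (- ((k.-1)%:R)^-1).
Hypothesis d0 : 0 < d.

Let k1 : (0 < k.-1)%N. Proof. by rewrite -ltnS prednK// ltnW. Qed.

Lemma rate_gt0 : 0 < D. Proof. exact: powR_gt0. Qed.

Lemma rateX : D ^+ k.-1 * d = 1.
Proof. by rewrite /D powRN exprVn powR_rootK ?(ltW d0)// mulVf// gt_eqF. Qed.

Lemma rate_le (b : R) : 0 < b -> (b ^+ k.-1)^-1 <= d -> D <= b.
Proof.
move=> b0 hb; rewrite -(@ler_pXn2r _ k.-1)// ?nnegrE ?(ltW b0) ?(ltW rate_gt0)//.
rewrite -(ler_pM2r d0) rateX.
by rewrite -ler_pdivrMl ?exprn_gt0// mulr1.
Qed.

Lemma codeg_rate l : (maxdeg_l E l)%:R / powR d ((k - l)%:R / (k.-1)%:R) =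
  (maxdeg_l E l)%:R * D ^+ (k - l).
Proof. by rewrite powR_divn ?(ltW d0)// /D powRN exprVn. Qed.

Hypothesis e01 : 0 < e <= 1.
Hypothesis hx : `|p / (c * D) - 1| <= h.
Hypothesis hh : k%:R * 2 ^+ k * h <= e.
Hypothesis D1 : D <= 1.
Hypothesis De : 2 * c * D <= e.
Hypothesis hd : 1 <= e * d.
Hypothesis hcd : forall l, (2 <= l <= k.-1)%N ->
  (maxdeg_l E l)%:R / powR d ((k - l)%:R / (k.-1)%:R) <= e / (1 + 2 * c) ^+ k.
Hypothesis hG : (Gamma E k)%:R / d <= e.

Let h0 : 0 <= h. Proof. exact: le_trans hx. Qed.

Let h2 : h <= 2^-1.
Proof.
have [_ e1] := andP e01.
have : 2 * h <= k%:R * 2 ^+ k * h; last by move=> h1; have := le_trans h1 (le_trans hh e1); lra.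
rewrite ler_wpM2r// -[leLHS]mul1r; apply: ler_pM => //; first by rewrite ler1n ltnW.
by rewrite -[leLHS]expr1 ler_weXn2l ?ler1n// ltnW.
Qed.

Let x0 : 0 < p / (c * D).
Proof. by move: hx h2; rewrite ler_norml => /andP[]; lra. Qed.

Let pE : p = p / (c * D) * (c * D).
Proof. by rewrite divfK// mulf_neq0// gt_eqF// rate_gt0. Qed.

Let p_gt0 : 0 < p. Proof. by rewrite pE mulr_gt0// mulr_gt0// rate_gt0. Qed.

Let p_le : p <= 2 * c * D.
Proof.
rewrite {1}pE -[leRHS]mulrA ler_wpM2r ?mulr_ge0 ?(ltW c0) ?(ltW rate_gt0)//.
by move: hx h2; rewrite ler_norml => /andP[]; lra.
Qed.

(** The codegree condition at [l = 2] bounds the codegree times [D ^+ (k - 2)] by [e], and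
    [D ^+ k.-1 * d = 1] makes the inverse of that power equal to [D * d]. *)
Lemma codeg_two_rate : (3 <= k)%N -> (maxdeg_l E 2)%:R <= e * (D * d).
Proof.
move=> k3; have [e0 _] := andP e01; have D0 := rate_gt0.
have l2 : (2 <= 2 <= k.-1)%N by rewrite leqnn /= -ltnS prednK // ltnW.
have := hcd l2; rewrite codeg_rate => hl.
have Dk : 0 < D ^+ (k - 2) by rewrite exprn_gt0.
rewrite -(ler_pM2r Dk); apply: (le_trans hl).
have -> : e * (D * d) * D ^+ (k - 2) = e * (D ^+ k.-1 * d).
  have -> : k.-1 = (k - 2).+1 by rewrite -subn1 -subSn// subSS.
  by rewrite exprS; ring.
have c21 : 1 <= 1 + 2 * c by rewrite lerDl mulr_ge0// ltW.
have cp : 0 < (1 + 2 * c) ^+ k by rewrite exprn_gt0// (lt_le_trans ltr01).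
by rewrite rateX mulr1 ler_piMr ?(ltW e0)// invf_le1// exprn_ege1.
Qed.

Lemma tame_of_bounds : tame E k c p e.
Proof.
have [e0 e1] := andP e01; have D0 := rate_gt0.
split=> //.
- by rewrite p_gt0/=; exact: le_trans p_le De.
- have -> : p ^+ k.-1 * (maxdeg E)%:R / c ^+ k.-1 = (p / (c * D)) ^+ k.-1 * (D ^+ k.-1 * d).
    by rewrite expr_div_n exprMn; field; rewrite !gt_eqF ?exprn_gt0.
  rewrite rateX mulr1.
  apply: le_trans (expr_near1 k.-1 hx _ (ltW x0)) _; first by apply: le_trans h2 _; lra.
  apply: le_trans hh; rewrite ler_wpM2r//; apply: ler_pM => //.
    by rewrite ler_nat leq_pred.
  by rewrite ler_weXn2l ?ler1n// leq_pred.
(* Passing from powers of [D] to powers of [p <= 2 * c * D] costs at most [(1 + 2 * c) ^+ k], whence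
   the denominator in [hcd]. *)
- move=> l lk; have := hcd lk; rewrite codeg_rate => hl.
  apply: (@le_trans _ _ ((maxdeg_l E l)%:R * D ^+ (k - l) * (1 + 2 * c) ^+ k)).
    rewrite -mulrA ler_wpM2l//.
    apply: (@le_trans _ _ ((2 * c * D) ^+ (k - l))).
      by apply: lerXn2r; rewrite ?nnegrE ?(ltW p_gt0)// !mulr_ge0 ?(ltW c0) ?(ltW D0).
    rewrite exprMn mulrC ler_wpM2l ?exprn_ge0 ?(ltW D0)//.
    have c1 := ltW c0.
    apply: (@le_trans _ _ ((1 + 2 * c) ^+ (k - l))).
      by apply: lerXn2r; rewrite ?nnegrE ?mulr_ge0// ?addr_ge0 ?mulr_ge0// lerDr.
    by rewrite ler_weXn2l ?leq_subr// lerDl mulr_ge0.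
  by rewrite -ler_pdivlMr// exprn_gt0//; have := c0; lra.
(* For [k = 2] the codegree range is empty, but simplicity gives [maxdeg_l E 2 <= 1], and
   [1 <= e * d]. *)
- have := k2; rewrite leq_eqVlt => /orP[/eqP kE|k3].
    by apply: le_trans hd; rewrite lern1; have := maxdeg_l_unif unif; rewrite -kE.
  apply: le_trans (codeg_two_rate k3) _; rewrite ler_wpM2l ?(ltW e0)//.
  by rewrite ler_piMl// ltW.
by rewrite -ler_pdivrMr.
Qed.

Lemma scaled_of_bounds : scaled E k c p D e.
Proof.
split; [exact: rate_gt0|exact: rateX|].
have [_ e1] := andP e01.
apply: le_trans (expr_near1 k hx _ (ltW x0)) hh.
by apply: le_trans h2 _; lra.
Qed.

End FiniteCriterion.

(** * Bounds valid for all large n *)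

Section Sequence.
Local Open Scope classical_set_scope.
Local Open Scope ring_scope.
Variable R : realType.

Lemma near_forall_between (P : nat -> nat -> Prop) (K : nat) :
  (forall l, (2 <= l <= K)%N -> \forall n \near \oo, P l n) ->
  \forall n \near \oo, forall l, (2 <= l <= K)%N -> P l n.
Proof.
elim: K => [|K IH] h.
  by near=> n => l /andP[l2 l0]; have := leq_trans l2 l0.
have {}IH := IH (fun l hl => h l ltac:(by case/andP: hl => -> /leqW)).
case: (leqP 2 K.+1) => K2.
  have hK := h K.+1 ltac:(by rewrite K2 leqnn).
  near=> n => l /andP[l2]; rewrite leq_eqVlt => /orP[/eqP ->|lK].
    by near: n.
  by apply: (near IH n) => //; rewrite l2.
by near=> n => l /andP[l2 lK]; rewrite ltnNge (leq_trans l2 lK) in K2.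
Unshelve. all: by end_near. Qed.

Variables (k : nat) (V : nat -> finType) (E : forall n, {set {set V n}}) (c : R) (p : nat -> R).
Hypothesis k2 : (2 <= k)%N.
Hypothesis unif : forall n, kuniform (E n) k.
Hypothesis tl : tree_like R E k.
Hypothesis c0 : 0 < c.
Let d n : R := (maxdeg (E n))%:R.
Let D n : R := powR (d n) (- ((k.-1)%:R)^-1).
Hypothesis hp : asymp p (fun n => c * D n).

Lemma near_maxdeg_ge (A : R) : \forall n \near \oo, A <= d n.
Proof. by case: tl => /cvgryPge/(_ A). Qed.

Lemma near_tame (e : R) : 0 < e <= 1 -> \forall n \near \oo,
  [/\ 0 < d n, `|p n / (c * D n) - 1| <= e, tame (E n) k c (p n) e,
      scaled (E n) k c (p n) (D n) e &
      (3 <= k)%N -> (maxdeg_l (E n) 2)%:R <= e * (D n * d n)].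
Proof.
move=> /andP[e0 e1]; case: (tl) => hD hcd hG _.
pose K : R := k%:R * 2 ^+ k.
have K1 : 1 <= K.
  by rewrite -[leLHS]mul1r; apply: ler_pM => //; rewrite ?ler1n ?(ltnW k2)// exprn_ege1// ler1n.
have K0 : 0 < K by exact: lt_le_trans K1.
pose h := e / K.
have h0 : 0 < h by rewrite divr_gt0.
have he : h <= e by rewrite ler_pdivrMr// ler_peMr// ltW.
have c2 : 0 < (1 + 2 * c) ^+ k by rewrite exprn_gt0// addr_gt0// mulr_gt0.
have ec0 : 0 < e / (1 + 2 * c) ^+ k by rewrite divr_gt0.
have hc : forall l, (2 <= l <= k.-1)%N -> \forall n \near \oo,
    (maxdeg_l (E n) l)%:R / powR (d n) ((k - l)%:R / (k.-1)%:R) <= e / (1 + 2 * c) ^+ k.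
  move=> l lk; have /cvgr0Pnorm_le/(_ _ ec0) := hcd l lk.
  by apply: filterS => n; exact: le_trans (ler_norm _).
have {}hc := near_forall_between hc.
have hx : \forall n \near \oo, `|p n / (c * D n) - 1| <= h.
  have /cvgrPdist_le/(_ _ h0) := hp.
  by apply: filterS => n; rewrite distrC.
have hg : \forall n \near \oo, (Gamma (E n) k)%:R / d n <= e.
  have /cvgr0Pnorm_le/(_ _ e0) := hG.
  by apply: filterS => n; exact: le_trans (ler_norm _).
have ec : 0 < e / (2 * c) by rewrite divr_gt0// mulr_gt0.
have A1 := near_maxdeg_ge 1.
have A2 := near_maxdeg_ge (e^-1).
have A3 := near_maxdeg_ge ((1 ^+ k.-1)^-1).
have A4 := near_maxdeg_ge (((e / (2 * c)) ^+ k.-1)^-1).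
near=> n.
have dn : 0 < d n by apply: lt_le_trans ltr01 _; near: n.
have xn : `|p n / (c * D n) - 1| <= h by near: n.
have hh : k%:R * 2 ^+ k * h <= e by rewrite /h mulrCA divff ?mulr1// gt_eqF.
have e01 : 0 < e <= 1 by rewrite e0.
have D1 : D n <= 1 by apply: (rate_le k2) => //; near: n.
have De : 2 * c * D n <= e.
  rewrite -ler_pdivlMl ?mulr_gt0// mulrC; apply: (rate_le k2) => //; near: n; exact: A4.
have hd : 1 <= e * d n.
  by rewrite -ler_pdivrMl// mulr1; near: n.
have hcn : forall l, (2 <= l <= k.-1)%N ->
    (maxdeg_l (E n) l)%:R / powR (d n) ((k - l)%:R / (k.-1)%:R) <= e / (1 + 2 * c) ^+ k.
  by near: n.
have hgn : (Gamma (E n) k)%:R / d n <= e by near: n.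
split=> //.
- exact: le_trans he.
- exact: tame_of_bounds xn hh D1 De hd hcn hgn.
- exact: scaled_of_bounds xn hh.
exact: codeg_two_rate hcn.
Unshelve. all: by end_near. Qed.

Lemma near_edges : exists2 CE : R, 0 < CE &
  \forall n \near \oo, CE * d n * #|V n|%:R <= #|E n|%:R.
Proof.
case: tl => _ _ _ [CE [CE0 hE]]; exists CE => //.
apply: filterS hE => n h.
have [v0|v0] := eqVneq #|V n| 0%N; first by rewrite v0 mulr0.
by rewrite -ler_pdivlMr// ltr0n lt0n.
Qed.

(** For [k >= 3] combine Delta <= |V| Delta_2 with Delta_2 = o(D Delta). For [k = 2] the codegree
    range is empty, and [graph_double_count] is used instead: Gamma = o(Delta) and the edge density
    force |V| / Delta to infinity, while [D n = (d n)^-1]. *)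
Lemma near_volume (e : R) : 0 < e <= 1 ->
  \forall n \near \oo, 1 <= e * (D n * #|V n|%:R).
Proof.
move=> /andP[e0 e1]; have [CE CE0 hE] := near_edges.
have := k2; rewrite leq_eqVlt => /orP[/eqP kE|k3]; last first.
  have ht := near_tame (introT andP (conj e0 e1)).
  near=> n.
  have [dn _ _ _ /(_ k3) h] : [/\ 0 < d n, `|p n / (c * D n) - 1| <= e, tame (E n) k c (p n) e,
      scaled (E n) k c (p n) (D n) e &
      (3 <= k)%N -> (maxdeg_l (E n) 2)%:R <= e * (D n * d n)] by near: n.
  have h2 : d n <= #|V n|%:R * (maxdeg_l (E n) 2)%:R.
    by rewrite -natrM /d ler_nat; exact: maxdeg_le_codeg k2 (@unif n).
  rewrite -(ler_pM2r dn) mul1r; apply: (le_trans h2).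
  apply: (le_trans (ler_wpM2l (ler0n _ _) h)); apply: eq_ler; ring.
case: (tl) => _ _ hG _.
pose g := e * CE ^+ 2.
have g0 : 0 < g by rewrite mulr_gt0// exprn_gt0.
have hg : \forall n \near \oo, (Gamma (E n) k)%:R / d n <= g.
  have /cvgr0Pnorm_le/(_ _ g0) := hG.
  by apply: filterS => n; exact: le_trans (ler_norm _).
have A1 := near_maxdeg_ge 1.
have A2 := near_maxdeg_ge ((CE ^+ 2)^-1).
near=> n.
have dn : 0 < d n by apply: lt_le_trans ltr01 _; near: n.
have hEn : CE * d n * #|V n|%:R <= #|E n|%:R by near: n.
have hgn : (Gamma (E n) k)%:R <= g * d n by rewrite -ler_pdivrMr//; near: n.
have hA2 : 1 <= CE ^+ 2 * d n.
  by rewrite -ler_pdivrMl ?exprn_gt0// mulr1; near: n.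
have DE : D n * d n = 1.
  by have := rateX k2 dn; rewrite -/(D n) -kE expr1.
have unif2 : kuniform (E n) 2 by rewrite kE; exact: (@unif n).
have dc := graph_double_count R unif2; rewrite -/(d n) in dc.
rewrite -kE in hgn.
set v : R := #|V n|%:R in hEn dc *.
have v0 : 0 < v.
  rewrite ltr0n lt0n; apply: contraTneq dn => V0.
  have := maxdeg_le_codeg k2 (@unif n); rewrite V0 mul0n leqn0 => /eqP E0.
  by rewrite /d E0 ltxx.
have dc2 : 4 * (CE * d n * v) ^+ 2 <= v * (v ^+ 2 * (g * d n) + v * d n).
  apply: le_trans (le_trans dc _).
    by rewrite ler_wpM2l// lerXn2r ?nnegrE ?mulr_ge0 ?(ltW CE0) ?(ltW dn) ?(ltW v0).
  by rewrite ler_wpM2l ?(ltW v0)// lerD2r ler_wpM2l// exprn_ge0// ltW.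
have dc3 : 4 * CE ^+ 2 * d n <= g * v + 1.
  have w0 : 0 < v ^+ 2 * d n by rewrite mulr_gt0// exprn_gt0.
  rewrite -(ler_pM2r w0).
  have -> : 4 * CE ^+ 2 * d n * (v ^+ 2 * d n) = 4 * (CE * d n * v) ^+ 2 by ring.
  by apply: (le_trans dc2); apply: eq_ler; ring.
have dc4 : CE ^+ 2 * d n <= CE ^+ 2 * (e * v).
  have -> : CE ^+ 2 * (e * v) = g * v by rewrite /g; ring.
  move: dc3 hA2; set y := g * v; rewrite -mulrA; set w := CE ^+ 2 * d n; lra.
rewrite ler_pM2l ?exprn_gt0// in dc4.
rewrite -(ler_pM2r dn) mul1r; apply: (le_trans dc4); apply: eq_ler.
have -> : e * (D n * v) * d n = e * v * (D n * d n) by ring.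
by rewrite DE mulr1.
Unshelve. all: by end_near. Qed.

End Sequence.

(** * Asymptotics of the lower tail probability *)

Section Main.
Local Open Scope classical_set_scope.
Local Open Scope ring_scope.
Variable R : realType.

Lemma exists_sqr_ratio (r : R) : 0 <= r < expR 1 ->
  exists2 rho : R, 0 <= rho < 1 & r <= rho ^+ 2 * expR 1.
Proof.
move=> /andP[r0 re]; have e0 := expR_gt0 (1 : R).
exists (Num.sqrt (r / expR 1)); last by rewrite sqr_sqrtr ?divr_ge0 ?(ltW e0)// divfK// gt_eqF.
rewrite sqrtr_ge0/= -[ltRHS]sqrtr1 ltr_sqrt//.
by rewrite ltr_pdivrMr// mul1r.
Qed.

(** Some tail already has its supremum below [e]; that supremum is finite because the terms are
    nonnegative, and it yields one contraction factor for all large [n]. *)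
Lemma limsup_lt_expR1 (u : nat -> R) : (forall n, 0 <= u n) ->
  (limn_esup (fun n => (u n)%:E) < (expR 1)%:E)%E ->
  exists2 rho : R, 0 <= rho < 1 & \forall n \near \oo, u n <= rho ^+ 2 * expR 1.
Proof.
move=> u0 /ereal_inf_lt[y [A [N _ NA] <-]].
set S := ereal_sup _ => Se.
have uS n : (N <= n)%N -> ((u n)%:E <= S)%E.
  by move=> Nn; apply: ereal_sup_ubound; exists n => //; exact: NA.
have S0 : (0%:E <= S)%E by apply: le_trans (uS N (leqnn N)); rewrite lee_fin.
have [r rE] : exists r, S = r%:E.
  by move: Se S0; case: S {uS} => [r||]//; exists r.
rewrite rE !lee_fin lte_fin in uS S0 Se *.
have [rho rho01 hr] := exists_sqr_ratio (introT andP (conj S0 Se)).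
exists rho => //; exists N => // n /= /uS; rewrite lee_fin => h; exact: le_trans hr.
Qed.

Lemma expr_lt_of_lt_root (a x : R) n : (0 < n)%N -> 0 < a -> 0 <= x ->
  x < powR a (n%:R^-1) -> x ^+ n < a.
Proof.
move=> n0 a0 x0 hx; rewrite -[ltRHS](powR_rootK n0 (ltW a0)).
by rewrite ltrXn2r// ?nnegrE ?powR_ge0// -lt0n.
Qed.

Variables (k : nat) (V : nat -> finType) (E : forall n, {set {set V n}}) (c : R) (p : nat -> R).
Hypothesis k2 : (2 <= k)%N.
Hypothesis unif : forall n, kuniform (E n) k.
Hypothesis tl : tree_like R E k.
Hypothesis c0 : 0 < c.
Let d n : R := (maxdeg (E n))%:R.
Let D n : R := powR (d n) (- ((k.-1)%:R)^-1).
Hypothesis hp : asymp p (fun n => c * D n).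
Let S n : R := D n * #|V n|%:R.

Definition regular (e : R) (n : nat) : Prop := exists2 eps, eps <= e &
  [/\ eps <= 2^-1, 0 < d n, `|p n / (c * D n) - 1| <= e, tame (E n) k c (p n) eps &
      scaled (E n) k c (p n) (D n) eps].

Lemma near_regular (e : R) : 0 < e -> \forall n \near \oo, regular e n.
Proof.
move=> e0; pose e' := Num.min e 2^-1.
have e'0 : 0 < e' <= 1.
  by rewrite lt_min e0 invr_gt0 ltr0n/= ge_min invf_le1 ?ler1n ?orbT.
have := near_tame k2 unif tl c0 hp e'0; apply: filterS => n [dn xn tn sn _].
have e'e : e' <= e by rewrite /e' ge_min lexx.
exists e' => //; split=> //; first by rewrite /e' ge_min lexx orbT.
exact: le_trans e'e.
Qed.

Lemma near_volume_ge (e : R) : 0 < e -> \forall n \near \oo, 1 <= e * S n.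
Proof.
move=> e0; pose e' := Num.min e 1.
have e'0 : 0 < e' <= 1 by rewrite lt_min e0 ltr01/= ge_min lexx orbT.
have := near_volume k2 unif tl c0 hp e'0; apply: filterS => n h.
apply: (le_trans h); rewrite -/(S n).
have S0 : 0 <= S n by rewrite mulr_ge0// powR_ge0.
by rewrite ler_wpM2r// /e' ge_min lexx.
Qed.

Lemma near_edges_gt0 : \forall n \near \oo, 0 < #|E n|%:R :> R.
Proof.
have [CE CE0 hE] := near_edges tl.
have hS := near_volume_ge ltr01; have ht := near_regular ltr01.
near=> n.
have [eps _ [_ dn _ _ _]] : regular 1 n by near: n.
have Sn : 1 <= 1 * S n by near: n.
have v0 : 0 < #|V n|%:R :> R.
  rewrite lt_def ler0n andbT; apply/negP => /eqP v0.
  by move: Sn; rewrite /S v0 mulr0 mulr0 ler10.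
apply: (@lt_le_trans _ _ (CE * d n * #|V n|%:R)); first by rewrite !mulr_gt0.
by near: n.
Unshelve. all: by end_near. Qed.

Lemma near_free_energy (rho e : R) (zeta : nat -> R) (xs : forall n, V n -> R) :
  0 <= rho < 1 -> 0 < e -> (forall n, 0 < zeta n <= 1) ->
  (\forall n \near \oo, zeta n * (k.-1)%:R * c ^+ k.-1 <= rho ^+ 2 * expR 1) ->
  (forall n, in_box c (xs n) /\ is_fixed_point (E n) c (zeta n) (xs n)) ->
  \forall n \near \oo,
    `|ln (pf (p n) (zeta n) finset.set0 (E n)) - D n * (Bethe (E n) c (zeta n) (xs n) - c * #|V n|%:R)|
      <= e * S n.
Proof.
move=> rho01 e0 z01 hz hxs.
have [e1 e10 h] := free_energy_approx k2 c0 rho01 e0.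
have ht := near_regular e10.
near=> n.
have [eps epse [_ _ _ tn sn]] : regular e1 n by near: n.
have [xb xF] := hxs n.
by apply: h epse tn sn (z01 n) _ xb xF; near: n.
Unshelve. all: by end_near. Qed.

Lemma lower_tail0 n : probp (p n) (fun T => (numX (E n) T)%:R <= 0 * meanX (E n) k (p n)) =
  pf (p n) 1 finset.set0 (E n).
Proof.
by rewrite -probp0_pf1 /probp; apply: eq_bigl => T; rewrite mul0r lern0.
Qed.

Lemma near_lower_tail (eta rho e : R) (zeta : nat -> R) (xs : forall n, V n -> R) (o : nat -> R) :
  0 <= eta < 1 -> 0 <= rho < 1 -> 0 < e -> (forall n, 0 < zeta n <= 1) ->
  (\forall n \near \oo, zeta n * (k.-1)%:R * c ^+ k.-1 <= rho ^+ 2 * expR 1) ->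
  (forall n, in_box c (xs n) /\ is_fixed_point (E n) c (zeta n) (xs n)) ->
  o @ \oo --> (0 : R) ->
  (forall n, (1 - zeta n) * (\sum_(e in E n) \prod_(u in e) xs n u)
                  = (1 + o n) * eta * c ^+ k * (#|E n|%:R)) ->
  \forall n \near \oo,
    `|ln (probp (p n) (fun T => (numX (E n) T)%:R <= eta * meanX (E n) k (p n)))
      - (D n * (Bethe (E n) c (zeta n) (xs n) - c * #|V n|%:R)
         - ln (1 - zeta n) * eta * meanX (E n) k (p n))| <= e * S n.
Proof.
(* If [eta = 0], the relation for [zeta] forces [zeta n = 1] once [E n] is nonempty, since fixed
   points are positive. The probability is then exactly the partition function at tilt [1], and the
   logarithmic term vanishes with [eta]. *)
move=> /andP[]; rewrite le_eqVlt => /orP[/eqP <-|eta0] eta1 rho01 e0 z01 hz hxs ho hxo.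
  have hf := near_free_energy rho01 e0 z01 hz hxs.
  have hE := near_edges_gt0.
  near=> n; rewrite lower_tail0 mulr0 mul0r subr0.
  have [xb xF] := hxs n.
  have z1 : zeta n = 1.
    have := hxo n; rewrite mulr0 !mul0r => /eqP; rewrite mulf_eq0 => /orP[|/eqP X0].
      by rewrite subr_eq0 => /eqP.
    have En : 0 < #|E n|%:R :> R by near: n.
    have [f fE] : exists f, f \in E n.
      by apply/card_gt0P; rewrite -(ltr0n R).
    have x0 u : 0 < xs n u.
      rewrite -(xF u); have /andP[zn _] := z01 n.
      have xn w : 0 <= xs n w by case/andP: (xb w).
      by case/andP: (Fmap_bounds (E n) c0 u (ltW zn) xn).
    have : 0 < \sum_(f in E n) \prod_(u in f) xs n u.
      rewrite (bigD1 f)//= ltr_pwDl ?prodr_gt0// sumr_ge0// => g _.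
      by apply: prodr_ge0 => u _; exact: ltW.
    by rewrite X0 ltxx.
  have : `|ln (pf (p n) (zeta n) finset.set0 (E n))
    - D n * (Bethe (E n) c (zeta n) (xs n) - c * #|V n|%:R)| <= e * S n by near: n.
  by rewrite z1.
have [CE CE0 hCE] := near_edges tl.
have eta01 : 0 < eta < 1 by rewrite eta0.
have [e1 e10 h] := lower_tail_approx k2 c0 rho01 eta01 CE0 e0.
have ht := near_regular e10.
have hS := near_volume_ge e10.
have hE := near_edges_gt0.
have e11 : 0 < Num.min e1 2^-1 by rewrite lt_min e10 invr_gt0 ltr0n.
have /cvgr0Pnorm_le/(_ _ e11) hon := ho.
near=> n.
have [eps epse [_ _ _ tn sn]] : regular e1 n by near: n.
have [xb xF] := hxs n.
have En : 0 < #|E n|%:R :> R by near: n.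
have : `|o n| <= Num.min e1 2^-1 by near: n.
rewrite le_min => /andP[on1 on2].
have ck0 : 0 < c ^+ k by rewrite exprn_gt0.
have cE0 : 0 < c ^+ k * #|E n|%:R by rewrite mulr_gt0.
(* At [zeta n = 1] the left side of [hxo] would vanish, while [1 + o n >= 2^-1] keeps the right side
   positive. *)
have zn : 0 < zeta n < 1.
  have /andP[-> z1] := z01 n; rewrite lt_neqAle z1 andbT /=.
  apply/negP => /eqP z1'; have := hxo n; rewrite z1' subrr mul0r => /esym/eqP.
  rewrite -mulrA !mulf_eq0 (gt_eqF eta0) (gt_eqF ck0) (gt_eqF En) !orbF => /eqP.
  by move: on2; rewrite ler_norml => /andP[]; lra.
have hz1 : `|(1 - zeta n) * (\sum_(f in E n) \prod_(u in f) xs n u) - eta * c ^+ k * #|E n|%:R|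
    <= e1 * (c ^+ k * #|E n|%:R).
  rewrite hxo.
  have -> : (1 + o n) * eta * c ^+ k * #|E n|%:R - eta * c ^+ k * #|E n|%:R =
    (o n * eta) * (c ^+ k * #|E n|%:R) by ring.
  rewrite normrM [`|c ^+ k * _|]gtr0_norm// ler_wpM2r ?(ltW cE0)//.
  rewrite normrM [`|eta|]gtr0_norm//; apply: le_trans on1.
  by rewrite ler_piMr// ltW.
have hCEn : CE * (maxdeg (E n))%:R * #|V n|%:R <= #|E n|%:R by near: n.
have hSn : 1 <= e1 * (D n * #|V n|%:R) by near: n.
have := h (V n) (E n) (p n) (D n) eps (zeta n) (xs n) epse tn sn hCEn hSn zn.
have zn' : zeta n * (k.-1)%:R * c ^+ k.-1 <= rho ^+ 2 * expR 1 by near: n.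
move=> /(_ zn' xb xF hz1); rewrite -[ln (1 - zeta n) * eta * _]mulrA; exact.
Unshelve. all: by end_near. Qed.

Lemma near_lower_tail_neg (eta : R) : 0 <= eta < 1 -> exists2 kap : R, 0 < kap &
  \forall n \near \oo,
  ln (probp (p n) (fun T => (numX (E n) T)%:R <= eta * meanX (E n) k (p n))) <= - (kap * S n).
Proof.
move=> eta01; have [kap [e1 [kap0 e10 h]]] := lower_tail_linear k2 c0 eta01.
have [CE CE0 hCE] := near_edges tl.
have ck0 : 0 < c ^+ k by rewrite exprn_gt0.
exists (kap * (CE * c ^+ k / 2)); first by rewrite mulr_gt0// divr_gt0// mulr_gt0.
have ht := near_regular e10.
near=> n.
have [eps epse [eps2 _ _ tn sn]] : regular e1 n by near: n.
have hCEn : CE * (maxdeg (E n))%:R * #|V n|%:R <= #|E n|%:R by near: n.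
apply: le_trans (h (V n) (E n) (p n) eps epse tn) _.
rewrite mulNr lerN2 -mulrA ler_wpM2l ?(ltW kap0)//.
exact: scaled_edges_ge k2 c0 tn sn eps2 CE0 hCEn.
Unshelve. all: by end_near. Qed.

End Main.

(** In the minimum, [kap / 2] keeps [M] below [- (kap / 2 * S)], hence away from [0]; [kap * e / 2]
    then bounds the quotient by [e]. *)
Lemma ratio_near1 (R : realType) (L M S e kap : R) : 0 < S -> 0 < kap -> 0 < e ->
  L <= - (kap * S) -> `|L - M| <= Num.min (kap / 2) (kap * e / 2) * S -> `|1 - L / M| <= e.
Proof.
move=> S0 kap0 e0 hL hLM.
have h1 : `|L - M| <= kap / 2 * S.
  by apply: (le_trans hLM); rewrite ler_wpM2r ?(ltW S0)// ge_min lexx.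
have h2 : `|L - M| <= kap * e / 2 * S.
  by apply: (le_trans hLM); rewrite ler_wpM2r ?(ltW S0)// ge_min lexx orbT.
have M0 : M <= - (kap / 2 * S).
  move: h1; rewrite ler_norml => /andP[h1 _].
  have e1 : kap * S = kap / 2 * S + kap / 2 * S by field.
  by rewrite e1 in hL; move: hL h1; set x := kap / 2 * S; lra.
have kS : 0 < kap / 2 * S by rewrite mulr_gt0// divr_gt0.
have Mn : M < 0 by apply: le_lt_trans M0 _; rewrite oppr_lt0.
have -> : 1 - L / M = - ((L - M) / M) by field; rewrite lt_eqF.
rewrite normrN normrM normfV ler_pdivrMr ?normr_gt0 ?lt_eqF//.
apply: (le_trans h2); rewrite (ltr0_norm Mn).
have -> : kap * e / 2 * S = e * (kap / 2 * S) by ring.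
by rewrite ler_wpM2l ?(ltW e0)// lerNr.
Qed.

Local Open Scope classical_set_scope.
Local Open Scope ring_scope.


Theorem mainTheorem10 (R : realType) (k : nat) (V : nat -> finType)
  (E : forall n, {set {set V n}}) (c : R) (p : nat -> R) :
  (2 <= k)%N ->
  (forall n, kuniform (E n) k) ->
  tree_like R E k ->
  0 < c ->
  (* p ~ c Delta^{-1/(k-1)} *)
  asymp p (fun n => c * powR ((maxdeg (E n))%:R) (- ((k.-1)%:R)^-1)) ->
  (forall (eta : R) (zeta : nat -> R) (xs : forall n, V n -> R),
     0 <= eta < 1 ->
     c < powR (expR 1 / ((1 - eta) * (k.-1)%:R)) (((k.-1)%:R)^-1) ->
     (forall n, 0 < zeta n <= 1) ->
     (limn_esup (fun n => (zeta n * (k.-1)%:R * c ^+ k.-1)%:E) < (expR 1)%:E)%E ->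
     (forall n, in_box c (xs n) /\ is_fixed_point (E n) c (zeta n) (xs n)) ->
     (\forall n \near \oo, forall y : V n -> R,
         in_box c y -> is_fixed_point (E n) c (zeta n) y -> y = xs n) ->
     (exists o : nat -> R, o @ \oo --> (0 : R) /\
        forall n, (1 - zeta n) * (\sum_(e in E n) \prod_(u in e) xs n u)
                  = (1 + o n) * eta * c ^+ k * (#|E n|%:R)) ->
     asymp
       (fun n => ln (probp (p n)
          (fun S => (numX (E n) S)%:R <= eta * meanX (E n) k (p n))))
       (fun n => powR ((maxdeg (E n))%:R) (- ((k.-1)%:R)^-1)
                   * Bethe (E n) c (zeta n) (xs n)
                 - ln (1 - zeta n) * eta * meanX (E n) k (p n)
                 - p n * (#|V n|%:R)))
  /\
  (c < powR (expR 1 / (k.-1)%:R) (((k.-1)%:R)^-1) ->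
   forall xs : forall n, V n -> R,
     (forall n, in_box c (xs n) /\ is_fixed_point (E n) c 1 (xs n)) ->
     (\forall n \near \oo, forall y : V n -> R,
         in_box c y -> is_fixed_point (E n) c 1 y -> y = xs n) ->
     (fun n => powR ((maxdeg (E n))%:R) (((k.-1)%:R)^-1) / (#|V n|%:R)
                 * ln (probp (p n) (fun S => numX (E n) S == 0%N))
               - ((#|V n|%:R)^-1 * Bethe (E n) c 1 (xs n) - c))
       @ \oo --> (0 : R)).
Proof.
move=> k2 unif tl c0 hp.
pose D n : R := powR ((maxdeg (E n))%:R) (- ((k.-1)%:R)^-1).
pose S n : R := D n * #|V n|%:R.
have k1 : (0 < k.-1)%N by rewrite -ltnS prednK// ltnW.
have C0 : 0 < c ^+ k.-1 by rewrite exprn_gt0.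
split.
  move=> eta zeta xs eta01 _ z01 hlim hxs _ [err [ho hxo]].
  have u0 n : 0 <= zeta n * (k.-1)%:R * c ^+ k.-1.
    by case/andP: (z01 n) => /ltW ? _; rewrite !mulr_ge0// ltW.
  have [rho rho01 hz] := limsup_lt_expR1 u0 hlim.
  have [kap kap0 hneg] := near_lower_tail_neg k2 unif tl c0 hp eta01.
  apply/cvgrPdist_le => e e0.
  pose m := Num.min (kap / 2) (kap * e / 2).
  have m0 : 0 < m by rewrite lt_min !divr_gt0// mulr_gt0.
  have m20 : 0 < m / 2 by rewrite divr_gt0.
  have mc0 : 0 < m / 2 / c by rewrite divr_gt0.
  have hl := near_lower_tail k2 unif tl c0 hp eta01 rho01 m20 z01 hz hxs ho hxo.
  have ht := near_regular k2 unif tl c0 hp mc0.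
  have hS := near_volume_ge k2 unif tl c0 hp (@ltr01 R).
  near=> n.
  have Sn : 0 < S n.
    by apply: lt_le_trans ltr01 _; rewrite -[leRHS]mul1r; near: n.
  apply: (ratio_near1 Sn kap0 e0); first by near: n.
  set L := ln (probp _ _).
  set F := ln (1 - zeta n) * eta * meanX (E n) k (p n).
  set B := Bethe _ _ _ _.
  have h1 : `|L - (D n * (B - c * #|V n|%:R) - F)| <= m / 2 * S n.
    rewrite {}/L {}/F {}/B /S; near: n; exact: hl.
  have [eps _ [_ dn xn _ _]] : regular k E c p (m / 2 / c) n by near: n.
  have Dn : 0 < D n by rewrite powR_gt0.
  have vn : 0 < #|V n|%:R :> R by move: Sn; rewrite /S pmulr_rgt0.
  (* The free energy carries [c * D n * #|V n|] where the claim has [p n * #|V n|]; the difference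
     is [p n / (c * D n) - 1] times [c * S n]. *)
  have h2 : `|(D n * (B - c * #|V n|%:R) - F) - (D n * B - F - p n * #|V n|%:R)| <= m / 2 * S n.
    have -> : (D n * (B - c * #|V n|%:R) - F) - (D n * B - F - p n * #|V n|%:R) =
      (p n / (c * D n) - 1) * (c * S n) by rewrite /S; field; rewrite !gt_eqF.
    rewrite normrM [`|c * S n|]gtr0_norm ?mulr_gt0//.
    apply: (@le_trans _ _ (m / 2 / c * (c * S n))); first by rewrite ler_wpM2r// ltW// mulr_gt0.
    by rewrite mulrA divfK// gt_eqF.
  rewrite -/(D n); have -> : L - (D n * B - F - p n * #|V n|%:R) =
    (L - (D n * (B - c * #|V n|%:R) - F)) +
    ((D n * (B - c * #|V n|%:R) - F) - (D n * B - F - p n * #|V n|%:R)) by ring.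
  apply: le_trans (ler_normD _ _) _.
  rewrite -/m (_ : m * S n = m / 2 * S n + m / 2 * S n); last by field.
  exact: lerD.
move=> hc xs hxs _.
have kp : 0 < (k.-1)%:R :> R by rewrite ltr0n.
have hlt : (k.-1)%:R * c ^+ k.-1 < expR 1.
  rewrite mulrC -ltr_pdivlMr//; apply: expr_lt_of_lt_root hc => //; last exact: ltW.
  by rewrite divr_gt0// expR_gt0.
have hr0 : 0 <= (k.-1)%:R * c ^+ k.-1 < expR 1 by rewrite hlt mulr_ge0// ltW.
have [rho rho01 hr] := exists_sqr_ratio hr0.
apply/cvgrPdist_le => e e0.
have z01 (n : nat) : 0 < (1 : R) <= 1 by rewrite ltr01 lexx.
have hz : \forall n \near \oo, (1 : R) * (k.-1)%:R * c ^+ k.-1 <= rho ^+ 2 * expR 1.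
  by near=> n; rewrite mul1r.
have hf := near_free_energy (zeta := fun=> 1) k2 unif tl c0 hp rho01 e0 z01 hz hxs.
have hS := near_volume_ge k2 unif tl c0 hp (@ltr01 R).
near=> n.
have Sn : 0 < S n.
  by apply: lt_le_trans ltr01 _; rewrite -[leRHS]mul1r; near: n.
have h : `|ln (pf (p n) 1 finset.set0 (E n)) - D n * (Bethe (E n) c 1 (xs n) - c * #|V n|%:R)|
   <= e * S n by near: n.
rewrite probp0_pf1 sub0r normrN.
have vn : 0 < #|V n|%:R :> R.
  by move: Sn; rewrite /S; case: #|V n| => //; rewrite mulr0 ltxx.
have Dn : 0 < D n by move: Sn; rewrite /S pmulr_lgt0.
have -> : powR ((maxdeg (E n))%:R) (((k.-1)%:R)^-1) = (D n)^-1.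
  by rewrite /D powRN invrK.
set B := Bethe _ _ _ _ in h *; set Z := ln _ in h *.
have -> : (D n)^-1 / #|V n|%:R * Z - (#|V n|%:R^-1 * B - c) =
  (Z - D n * (B - c * #|V n|%:R)) / S n by rewrite /S; field; rewrite !gt_eqF.
by rewrite normrM normfV (gtr0_norm Sn) ler_pdivrMr.
Unshelve. all: by end_near. Qed.
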